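(* Assume the standing setting below (Hypothesis H). Let $\beta>0$, $R>0$, $\lambda\in\mathbb{R}$. (i) (Spherical model.) As $N\to\infty$, $\frac1N\log Z^{sf}_N(\beta,R)$ converges almost surely, and $A^{sf}_N(\beta,R)$ converges, to $$A^{sf}(\beta,R^2)=\min_{q\ge\beta\bar\lambda}\Big(qR^2-\frac12\int_{-\bar\lambda}^{\bar\lambda}\rho(\mu)\log(q-\beta\mu)\,d\mu-\frac12\log R^2-\frac12-\frac12\log 2\Big).$$ (ii) (Gaussian model.) As $N\to\infty$, $\frac1N\log Z^{g}_N(\beta,\lambda)$ converges almost surely, and $A^{g}_N(\beta,\lambda)$ converges, to $$A^{g}(\beta,\lambda)=\max_{R^2\in(0,\infty)}\Big(A^{sf}(\beta,R^2)-\frac{\beta^2R^4}{4}+\frac{(\lambda-1)R^2}{2}+\frac12\log R^2+\frac12\Big),$$ where $A^{sf}(\beta,R^2)$ is the limit in (i).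
   Context: Standing setting (Hypothesis H). For each $N\ge1$, $J=J^{(N)}=(J_{ij})_{i,j=1}^N$ is a random real symmetric matrix from the symmetric Wigner ensemble (entries $J_{ij}$, $i\le j$, independent, $J_{ji}=J_{ij}$) with $\mathbb{E}J_{ij}=0$, $\mathbb{E}J_{ij}^2=J^2>0$, and there is $\theta_0>0$ with $\sup_{N,i,j}\mathbb{E}\,e^{\theta_0 J_{ij}^2/N}<\infty$; all matrices are defined on a common probability space. Let $\lambda_1,\dots,\lambda_N$ denote the eigenvalues of $J/\sqrt N$. Hypothesis H further requires: (1) there are constants $\bar\lambda>0$, $C_1>0$, $\theta>0$ such that for every $a>\bar\lambda$ and every eigenvalue $\lambda$ of $J/\sqrt N$, $P(|\lambda|\ge a)\le C_1e^{-\theta a^2N}$; (2) the empirical spectral distribution $\frac1N\sum_i\delta_{\lambda_i}$ converges as $N\to\infty$ to the semicircle law with density $\rho(\mu)=\frac{2\sqrt{\bar\lambda^2-\mu^2}}{\pi\bar\lambda^2}$ on $[-\bar\lambda,\bar\lambda]$. For $z\in\mathbb{R}^N$ the Hamiltonian is $H_N(z,J)=-\frac1{\sqrt N}\sum_{i,j=1}^N J_{ij}z_iz_j=-\langle z,(J/\sqrt N)z\rangle$, which in an orthonormal eigenbasis of $J/\sqrt N$ reads $-\sum_i\lambda_iz_i^2$. $\beta>0$ is the inverse temperature. Spherical model: for $R>0$, $\sigma_{R,N}$ is the uniform probability measure on the sphere $\{z\in\mathbb{R}^N:\|z\|=R\sqrt N\}$; $Z^{sf}_N(\beta,R)=\int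 e^{-\beta H_N(z,J)}\,d\sigma_{R,N}(z)$ and $A^{sf}_N(\beta,R)=\frac1N\mathbb{E}\log Z^{sf}_N(\beta,R)$. Gaussian model: for $\lambda\in\mathbb{R}$, $Z^g_N(\beta,\lambda)=\int_{\mathbb{R}^N}\frac{e^{-\|z\|^2/2}}{(2\pi)^{N/2}}\exp\big(-\beta H_N(z,J)-\frac{\beta^2}{4N}\|z\|^4+\frac{\lambda}{2}\|z\|^2\big)\,dz$ and $A^g_N(\beta,\lambda)=\frac1N\mathbb{E}\log Z^g_N(\beta,\lambda)$. *)

(* Defs.v *)
From HB Require Import structures.
From mathcomp Require Import all_boot all_order all_algebra.
From mathcomp Require Import all_classical all_reals all_analysis.
Set Implicit Arguments. Unset Strict Implicit. Unset Printing Implicit Defensive.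
Import Order.TTheory GRing.Theory Num.Theory.
Import numFieldNormedType.Exports.
Local Open Scope classical_set_scope.
Local Open Scope ring_scope.

Section Defs.
Variable R : realType.

(* Iterated Lebesgue integral over R^N (vectors are row vectors 'rV[R]_N):
   int_{R^N} f = int dx_0 int_{R^{N-1}} f(x_0, v) dv.  For the nonnegative
   integrands used below this equals the integral w.r.t. Lebesgue measure on
   R^N (Tonelli). *)
Fixpoint iint (N : nat) : ('rV[R]_N -> \bar R) -> \bar R :=
  match N return ('rV[R]_N -> \bar R) -> \bar R with
  | 0 => fun f => f 0
  | N'.+1 => fun f =>
      (\int[@lebesgue_measure R]_x iint (fun v : 'rV[R]_N' =>
                 f (row_mx (const_mx x : 'rV[R]_1) v)))%E
  end.

Definition sqnorm N (z : 'rV[R]_N) : R := \sum_(i < N) z 0 i ^+ 2.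

Definition hamiltonian N (J : 'M[R]_N) (z : 'rV[R]_N) : R :=
  - (Num.sqrt N%:R)^-1 * \sum_(i < N) \sum_(j < N) J i j * z 0 i * z 0 j.

(* Integral of g against the uniform probability measure sigma_{r,N} on the
   sphere { ||z|| = r sqrt N } in R^N, defined through the (normalized) cone
   measure, which coincides with the normalized surface measure:
   int g dsigma = (1/|B|) int_B g(r sqrt N x/||x||) dx,  B = unit ball. *)
Definition sphere_int N (r : R) (g : 'rV[R]_N -> R) : \bar R :=
  (iint (fun x : 'rV[R]_N =>
      (if sqnorm x <= 1 then g ((r * Num.sqrt N%:R / Num.sqrt (sqnorm x)) *: x)
       else 0)%:E)
   * (fine (iint (fun x : 'rV[R]_N => (if sqnorm x <= 1 then 1 else 0)%:E)))^-1%:E)%E.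

Definition Zsf N (J : 'M[R]_N) (beta r : R) : R :=
  fine (sphere_int r (fun z => expR (- beta * hamiltonian J z))).

Definition Zg N (J : 'M[R]_N) (beta lam : R) : R :=
  fine (iint (fun z : 'rV[R]_N =>
    ((2 * pi) `^ (- (N%:R / 2)) * expR (- sqnorm z / 2) *
     expR (- beta * hamiltonian J z - beta ^+ 2 / (4 * N%:R) * sqnorm z ^+ 2
           + lam / 2 * sqnorm z))%:E)).

Definition rho (lb mu : R) : R := 2 * Num.sqrt (lb ^+ 2 - mu ^+ 2) / (pi * lb ^+ 2).

Definition is_spectrum N (A : 'M[R]_N) (l : 'I_N -> R) : Prop :=
  char_poly A = \prod_(i < N) ('X - (l i)%:P).

Definition Fsf (lb beta r2 q : R) : R :=
  q * r2
  - 1 / 2 * fine (\int[@lebesgue_measure R]_(mu in `[(- lb)%R, lb])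
                    (rho lb mu * ln (q - beta * mu))%:E)%E
  - 1 / 2 * ln r2 - 1 / 2 - 1 / 2 * ln 2.

(* A^sf(beta, r2) = min_{q >= beta lb} Fsf (defined as the infimum; attainment
   is part of the theorem's conclusion) *)
Definition Asf (lb beta r2 : R) : R :=
  inf [set Fsf lb beta r2 q | q in [set q | beta * lb <= q]].

Definition Gg (lb beta lam r2 : R) : R :=
  Asf lb beta r2 - beta ^+ 2 * r2 ^+ 2 / 4 + (lam - 1) * r2 / 2 + 1 / 2 * ln r2 + 1 / 2.

Definition Ag (lb beta lam : R) : R :=
  sup [set Gg lb beta lam r2 | r2 in [set r2 | 0 < r2]].

End Defs.

Definition scaledJ (R : realType) N (A : 'M[R]_N) : 'M[R]_N :=
  (Num.sqrt (N%:R : R))^-1 *: A.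

(* Main.v *)
(** A point of the sphere of squared radius [N s] is compared with a centered Gaussian vector
    of precision matrix [q - beta A], [A = J / sqrt N], whose total mass is explicit:
    [pi^(N/2) prod_i (q - beta lambda_i)^(-1/2)].  Since [exp (- q |z|^2)] is constant on the
    sphere, every [q > beta lambda_max] bounds the spherical integral from above.  Conversely,
    when [q] is the saddle point [(1/2N) sum_i 1 / (q - beta lambda_i) = s], Chernoff bounds
    show that the Gaussian vector concentrates on the shell [|z|^2 ~ N s].  This needs a gap
    between [q] and [beta lambda_max], which fails at low temperature; it is restored by
    lowering all eigenvalues above [lb - eps] to [lb - eps], which only decreases the integral,
    creates an atom of positive mass at the top of the spectrum, and costs [O(eps)].
    Weak convergence of the spectrum and the a.s. bound on its edges then yield the limit
    [min_q (q s - 1/2 int rho ln (q - beta mu))] up to the volume of the ball.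

    In the Gaussian model the quartic weight is bounded above by its tangent lines; this gives
    the limit as a minimum over [q], and convexity identifies it with the maximum over the
    radius.  Convergence in mean follows from that in probability one because
    [|ln Z_N| / N <= C (1 + max_i lambda_i^2)], whose tails are exponentially small in [N]. *)

Require Import Defs.
From HB Require Import structures.
From mathcomp Require Import all_boot all_order all_algebra.
From mathcomp Require Import all_classical all_reals all_analysis.
From mathcomp Require Import measurable_realfun complex ring lra.
Import Order.TTheory GRing.Theory Num.Theory.
Import numFieldNormedType.Exports.
Local Open Scope classical_set_scope.
Local Open Scope ring_scope.
Set Implicit Arguments.
Unset Strict Implicit.
Unset Printing Implicit Defensive.

(** * Orthogonal diagonalization of real symmetric matrices *)

Import complex.

(** Lebesgue measure on [R^N] enters only as an iterated integral, for which translations and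
    dilations are easy but rotations are not. No orthogonal change of variables is therefore made: a
    general Gaussian integral is computed by Schur complements, where only translations of inner
    integrals occur, and a matrix is kept as a pair of an orthogonal [U] and eigenvalues [l], so
    that shifting, scaling and truncating the spectrum act on [l] alone. Polar coordinates are
    likewise replaced by integrands constant on rays, whose integrals over balls and shells differ
    by explicit powers.

    The saddle point [q] depends on [N], while [logpot] converges only pointwise and only for
    [q > beta lb]; monotonicity in [q] supplies the uniformity. At the edge itself, where
    low-temperature minimizers sit, everything rests on the square-root vanishing of [rho]: it makes
    the limit potential Hoelder of exponent 1/2 up to [beta lb], so minimizers exist without
    differentiating under the integral. *)

Lemma symmetric_real_eigenvector (R : rcfType) n (A : 'M[R]_n.+1) :
  A^T = A -> exists a, exists2 v : 'rV[R]_n.+1, v *m A = a *: v & v != 0.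
Proof.
move=> Asym; pose f := @real_complex R.
pose Ac := map_mx f A.
have AcH : Ac \is hermsymmx.
  apply: realsym_hermsym.
    apply/is_hermitianmxP; rewrite expr0 scale1r map_mx_id //.
    by rewrite /Ac map_trmx Asym.
  apply/mxOverP => i j; rewrite mxE.
  by apply/complex_realP; eexists.
have /mxOverP Dreal := hermitian_spectral_diag_real AcH.
have /complex_realP[r Dr] := Dreal 0 0.
suff : eigenvalue A r by case/eigenvalueP => v ? ?; exists r, v.
suff : eigenvalue Ac (r%:C)%C.
  by rewrite !eigenvalue_root_char -map_char_poly fmorph_root.
apply/eigenvalueP; set P := spectralmx Ac.
have Pu : P \in unitmx := spectral_unit _.
exists (row 0 P).
  have /orthomx_spectralP AcE := hermitian_normalmx AcH.
  rewrite -row_mul [in LHS]AcE !mulmxA mulmxV // mul1mx -/P.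
  by rewrite row_mul row_diag_mx -scalemxAl -rowE Dr.
apply/eqP => r0; have := row_unitarymxP (spectral_unitarymx Ac) 0 0.
rewrite -/P r0 dotmxE mul0mx mxE eqxx /= => /eqP.
by rewrite eq_sym oner_eq0.
Qed.

(** The reflection along [w = v - e] exchanges the unit vectors [e] and [v]: since
    [c = |w|^2 = 2 (1 - e.v)], one has [e.w = - c / 2], and [e] is moved by exactly [w]. For [v = e]
    there is nothing to reflect along and the identity serves. *)
Lemma householder (R : rcfType) n (v : 'rV[R]_n.+1) : v *m v^T = 1%:M ->
  exists2 H : 'M[R]_n.+1, H *m H^T = 1%:M & delta_mx 0 0 *m H = v.
Proof.
move=> v1; pose e : 'rV[R]_n.+1 := delta_mx 0 0.
have [->|vNe] := eqVneq v e; first by exists 1%:M; rewrite ?trmx1 ?mulmx1.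
have e1 : e *m e^T = 1%:M.
  by apply/rowP => i; rewrite !ord1 /e trmx_delta mul_delta_mx !mxE !eqxx.
pose w := v - e; pose c : R := (w *m w^T) 0 0.
have wwE : w *m w^T = c%:M by apply/rowP => i; rewrite !ord1 [RHS]mxE.
have cN0 : c != 0.
  rewrite /c mxE; under eq_bigr do rewrite [w^T _ _]mxE -expr2.
  apply: contra vNe; rewrite psumr_eq0 => [/allP w0|i _]; last exact: sqr_ge0.
  rewrite -subr_eq0; apply/eqP/rowP => i.
  by have := w0 i (mem_index_enum _); rewrite sqrf_eq0 [RHS]mxE => /eqP.
have evE : e *m v^T = v *m e^T.
  by apply/rowP => i; rewrite !ord1 !mxE; apply: eq_bigr => k _; rewrite !mxE mulrC.
have cE : c%:M = 2 *: (1%:M - e *m v^T) :> 'M[R]_1.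
  rewrite -wwE /w linearB /= mulmxBl !mulmxBr v1 e1 evE.
  by apply/rowP => i; rewrite !mxE; ring.
have ewE : e *m w^T = (- c / 2)%:M.
  rewrite /w linearB /= mulmxBr e1; apply/rowP => i.
  have /matrixP/(_ 0 0) := cE; rewrite !ord1 [LHS]mxE mulr1n => ->.
  by rewrite [RHS]mxE mulr1n !mxE; field.
have weE : w + e = v by rewrite /w subrK.
clearbody c w.
pose X := w^T *m w.
have XX : X *m X = c *: X.
  by rewrite /X -mulmxA [w *m _]mulmxA wwE mul_scalar_mx -scalemxAr.
have XT : X^T = X by rewrite /X trmx_mul trmxK.
have XE : w^T *m w = X by [].
clearbody X.
exists (1%:M - (2 / c) *: X).
  have -> : (1%:M - (2 / c) *: X)^T = 1%:M - (2 / c) *: X.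
    by apply/matrixP => i j; rewrite !mxE -{1}XT mxE eq_sym.
  rewrite mulmxBl mul1mx mulmxBr mulmx1.
  rewrite -scalemxAl -scalemxAr XX; apply/matrixP => i j.
  by rewrite !mxE; field.
rewrite -/e mulmxBr mulmx1 -scalemxAr -XE mulmxA ewE mul_scalar_mx scalerA.
rewrite (_ : 2 / c * _ = -1); last by field.
by rewrite scaleN1r opprK addrC.
Qed.

(** Deflation: a Householder reflection moves a unit eigenvector to the first basis vector; the
    first row of the conjugate [B] is then [a] times that vector, by symmetry so is the first
    column, and the induction continues on the lower right block. *)
Theorem symmetric_spectral (R : rcfType) n (A : 'M[R]_n) : A^T = A ->
  exists (O : 'M[R]_n) (l : 'rV[R]_n), O *m O^T = 1%:M /\
    A = O^T *m diag_mx l *m O.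
Proof.
elim: n A => [|n IH] A Asym.
  by exists 1%:M, 0; split; apply/matrixP => -[].
have [a [v0 v0A v0N0]] := symmetric_real_eigenvector Asym.
pose c : R := (v0 *m v0^T) 0 0.
have cgt0 : 0 < c.
  rewrite /c mxE lt_neqAle; under eq_bigr do rewrite [v0^T _ _]mxE -expr2.
  rewrite sumr_ge0 ?andbT => [|i _]; last exact: sqr_ge0.
  apply: contra v0N0; rewrite eq_sym psumr_eq0 => [/allP w0|i _]; last exact: sqr_ge0.
  apply/eqP/rowP => i.
  by have := w0 i (mem_index_enum _); rewrite sqrf_eq0 [RHS]mxE => /eqP.
pose v := (Num.sqrt c)^-1 *: v0.
have v1 : v *m v^T = 1%:M.
  apply/rowP => i; rewrite !ord1 /v linearZ /= -scalemxAl -scalemxAr scalerA.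
  rewrite mxE -/c [RHS]mxE eqxx -invfM -expr2 sqr_sqrtr ?ltW //.
  by rewrite mulVf // gt_eqF.
have vA : v *m A = a *: v by rewrite /v -scalemxAl v0A !scalerA mulrC.
have [H HH eH] := householder v1.
have HTH := mulmx1C HH.
pose B := H *m A *m H^T.
have BT : B^T = B by rewrite /B !trmx_mul trmxK Asym mulmxA.
have B0 : row 0 B = a *: delta_mx 0 0.
  rewrite rowE /B !mulmxA eH vA -scalemxAl; congr (_ *: _).
  by rewrite -eH -mulmxA HH mulmx1.
have AE : A = H^T *m B *m H.
  by rewrite /B !mulmxA HTH mul1mx -mulmxA HTH mulmx1.
clearbody B.
have [U [l [UU lE]]] := IH (drsubmx (B : 'M[R]_(1 + n))) (etrans (trmx_drsub _) (congr1 _ BT)).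
have BE : B = block_mx a%:M 0 0 (drsubmx (B : 'M[R]_(1 + n))) :> 'M[R]_(1 + n).
  have Bval i i' j j' : val i = val i' -> val j = val j' -> B i j = B i' j'.
    by move=> /val_inj -> /val_inj ->.
  have u0 j : B 0 j = a *+ (j == 0).
    by move/rowP: B0 => /(_ j); rewrite !mxE eqxx mulr_natr.
  rewrite -{1}[B](@submxK _ 1 n 1 n); congr block_mx; apply/matrixP => i j.
  - rewrite !ord1 !mxE eqxx; have := u0 0; rewrite eqxx => <-.
    exact: Bval.
  - rewrite !ord1 !mxE; have := u0 (rshift 1 j); rewrite mulr0n => <-.
    exact: Bval.
  - rewrite !ord1 !mxE; have := u0 (rshift 1 i); rewrite mulr0n => <-.
    by rewrite -{1}BT mxE; apply: Bval.
pose Q : 'M[R]_(1 + n) := block_mx 1%:M 0 0 U.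
have QQ : Q *m Q^T = 1%:M.
  rewrite /Q tr_block_mx mulmx_block !trmx0 !trmx1 !mulmx0 !mul0mx !mulmx1.
  by rewrite !addr0 !add0r UU -scalar_mx_block.
exists (Q *m H), (row_mx a%:M l : 'rV[R]_(1 + n)); split.
  by rewrite trmx_mul mulmxA -(mulmxA Q) HH mulmx1.
rewrite trmx_mul !mulmxA.
have -> : H^T *m Q^T *m diag_mx (row_mx a%:M l) *m Q *m H
   = H^T *m (Q^T *m diag_mx (row_mx a%:M l) *m Q) *m H by rewrite !mulmxA.
have -> : Q^T *m diag_mx (row_mx a%:M l) *m Q = B.
  rewrite [RHS]BE lE diag_mx_row /Q tr_block_mx !mulmx_block.
  rewrite !trmx0 !trmx1 !mulmx0 !mul0mx !mulmx1 !mul1mx !addr0 !add0r !mul0mx.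
  by congr block_mx; apply/matrixP=> i j; rewrite !ord1 !mxE eqxx.
by [].
Qed.

(** * Iterated Lebesgue integrals *)

(** Measurability is tested along every measurable choice of coordinates on every measurable space,
    instead of through a sigma-algebra on row vectors. Freezing a coordinate or turning it into a
    parameter then amounts to choosing another family [c]. *)
Definition vmeas (R : realType) N (f : 'rV[R]_N -> \bar R) : Prop :=
  forall d (T : measurableType d) (c : 'I_N -> T -> R),
    (forall i, measurable_fun setT (c i)) ->
    measurable_fun setT (fun t => f (\row_i c i t)).

Definition jmeas (R : realType) d (S : measurableType d) N
    (F : S -> 'rV[R]_N -> \bar R) : Prop :=
  forall d' (T : measurableType d') (tau : T -> S) (c : 'I_N -> T -> R),
    measurable_fun setT tau -> (forall i, measurable_fun setT (c i)) ->
    measurable_fun setT (fun t => F (tau t) (\row_i c i t)).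

Lemma iint_ge0 (R : realType) N (f : 'rV[R]_N -> \bar R) :
  (forall v, 0 <= f v)%E -> (0 <= iint f)%E.
Proof.
elim: N f => [|N IH] f f0 /=; first exact: f0.
by apply: integral_ge0 => x _; apply: IH.
Qed.

Lemma row_mx_const_row (R : realType) N T (a : T -> R) (c : 'I_N -> T -> R) t :
  row_mx (const_mx (a t) : 'rV[R]_1) (\row_i c i t) =
  \row_(i < 1 + N) (match fintype.split i with inl _ => a t | inr j => c j t end).
Proof. by apply/rowP => i; rewrite !mxE; case: fintype.split => j; rewrite mxE. Qed.

(** The measurability half of Tonelli. The outer integration variable joins the parameter, so the
    induction hypothesis is used on [S * R]; this is why [S] is generalized. *)
Lemma iint_jmeas (R : realType) N d (S : measurableType d)
    (F : S -> 'rV[R]_N -> \bar R) :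
  jmeas F -> (forall s v, 0 <= F s v)%E -> measurable_fun setT (fun s => iint (F s)).
Proof.
elim: N d S F => [|N IH] d S F mF F0 /=.
  have := mF _ S id (fun _ _ => 0) (@measurable_id _ _ _)
    (fun i => measurable_cst _).
  by congr measurable_fun; apply/funext => s; congr (F s _); apply/rowP => -[].
pose G (p : S * R) := iint (fun v : 'rV[R]_N => F p.1 (row_mx (const_mx p.2 : 'rV[R]_1) v)).
have mG : measurable_fun setT G.
  apply: IH => [d' T tau c mtau mc|s v]; last exact: F0.
  under eq_fun do rewrite (row_mx_const_row (fun t => (tau t).2)).
  apply: (mF _ _ (fun t => (tau t).1)).
    exact: measurableT_comp.
  move=> i; case: splitP => j _; last exact: mc.
  exact: measurableT_comp.
apply: (@measurable_fun_fubini_tonelli_F _ _ _ _ _ (@lebesgue_measure R) G) => // p.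
by apply: iint_ge0.
Qed.

Section slices.
Context (R : realType) (N : nat) (f : 'rV[R]_N.+1 -> \bar R).
Hypotheses (mf : vmeas f) (f0 : forall v, (0 <= f v)%E).

Lemma vmeas_slice x : vmeas (fun v : 'rV[R]_N => f (row_mx (const_mx x : 'rV[R]_1) v)).
Proof.
move=> d T c mc.
under eq_fun do rewrite (row_mx_const_row (fun=> x)).
by apply: mf => i; case: splitP.
Qed.

Lemma measurable_iint_slice : measurable_fun setT
  (fun x => iint (fun v : 'rV[R]_N => f (row_mx (const_mx x : 'rV[R]_1) v))).
Proof.
apply: iint_jmeas => [d T tau c mtau mc|s v]; last exact: f0.
under eq_fun do rewrite (row_mx_const_row tau).
by apply: mf => i; case: splitP.
Qed.

End slices.

Lemma eq_iint (R : realType) N (f g : 'rV[R]_N -> \bar R) : f =1 g -> iint f = iint g.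
Proof. by move=> /funext ->. Qed.

Lemma le_iint (R : realType) N (f g : 'rV[R]_N -> \bar R) :
  vmeas f -> vmeas g -> (forall v, 0 <= f v)%E -> (forall v, f v <= g v)%E ->
  (iint f <= iint g)%E.
Proof.
elim: N f g => [|N IH] f g mf mg f0 fg /=; first exact: fg.
have g0 v : (0 <= g v)%E by apply: le_trans (fg v).
apply: ge0_le_integral => //.
- by move=> x _; apply: iint_ge0.
- exact: measurable_iint_slice.
- exact: measurable_iint_slice.
- by move=> x _; apply: IH => //; apply: vmeas_slice.
Qed.

Lemma iintD (R : realType) N (f g : 'rV[R]_N -> \bar R) :
  vmeas f -> vmeas g -> (forall v, 0 <= f v)%E -> (forall v, 0 <= g v)%E ->
  iint (fun v => f v + g v)%E = (iint f + iint g)%E.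
Proof.
elim: N f g => [//|N IH] f g mf mg f0 g0 /=.
rewrite -ge0_integralD //; last 4 first.
- by move=> x _; apply: iint_ge0.
- exact: measurable_iint_slice.
- by move=> x _; apply: iint_ge0.
- exact: measurable_iint_slice.
by apply: eq_integral => x _; apply: IH => //; apply: vmeas_slice.
Qed.

Lemma iintZl (R : realType) N (k : R) (f : 'rV[R]_N -> \bar R) :
  vmeas f -> (forall v, 0 <= f v)%E -> 0 <= k ->
  iint (fun v => k%:E * f v)%E = (k%:E * iint f)%E.
Proof.
elim: N f => [//|N IH] f mf f0 k0 /=.
rewrite -ge0_integralZl_EFin //; last 2 first.
- by move=> x _; apply: iint_ge0.
- exact: measurable_iint_slice.
by apply: eq_integral => x _; apply: IH => //; apply: vmeas_slice.
Qed.

(** Uniqueness of Lebesgue measure reduces this to half-open intervals, whose preimages are [t]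
    times shorter. *)
Lemma lebesgue_measure_affine (R : realType) (t a : R) (A : set R) : 0 < t ->
  measurable A ->
  (t%:E * pushforward (@lebesgue_measure R)
    ((fun x => (t * x + a)%R) : R -> measurableTypeR R) A = lebesgue_measure A)%E.
Proof.
move=> t0 mA.
have mphi : measurable_fun setT ((fun x => t * x + a) : R -> measurableTypeR R).
  by apply: measurable_funD => //; apply: measurable_funM.
pose m := mscale (NngNum (ltW t0)) (pushforward (@lebesgue_measure R)
  ((fun x => t * x + a) : R -> measurableTypeR R)).
suff : m mphi A = lebesgue_measure A by [].
symmetry; apply: (@lebesgue_measure_unique R (m mphi)) => //= _ [[x y]] _ <-.
rewrite /m /mscale /= /pushforward /=.
have -> : (fun x => t * x + a) @^-1` [set` `]x, y]] = [set` `](x - a) / t, (y - a) / t]].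
  apply/seteqP; split => z /=; rewrite !in_itv /= ltr_pdivrMr // ler_pdivlMr //;
  by rewrite ltrBlDr lerBrDr mulrC.
rewrite !lebesgue_measure_itv /= !lte_fin ltr_pM2r ?invr_gt0 // ltrD2r.
case: ifPn => _; last by rewrite mule0.
by rewrite -!EFinB -EFinM; congr (_%:E); field; rewrite gt_eqF.
Qed.

Lemma integral_affine (R : realType) (t a : R) (f : R -> \bar R) : 0 < t ->
  measurable_fun setT f -> (forall x, 0 <= f x)%E ->
  (\int[@lebesgue_measure R]_x f (t * x + a)%R =
   t^-1%:E * \int[@lebesgue_measure R]_x f x)%E.
Proof.
move=> t0 mf f0.
have mphi : measurable_fun setT ((fun x => t * x + a) : R -> measurableTypeR R).
  by apply: measurable_funD => //; apply: measurable_funM.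
pose m := mscale (NngNum (ltW t0)) (pushforward (@lebesgue_measure R)
  ((fun x => t * x + a) : R -> measurableTypeR R)).
rewrite [in RHS](eq_measure_integral (m mphi)); last first.
  move=> A mA _; symmetry; exact: (lebesgue_measure_affine a t0 mA).
rewrite /m ge0_integral_mscale //= ge0_integral_pushforward //=.
rewrite muleA -EFinM mulVf ?gt_eqF // mul1e preimage_setT.
by [].
Qed.

Lemma iint_shift (R : realType) N (a : 'rV[R]_N) (f : 'rV[R]_N -> \bar R) :
  vmeas f -> (forall v, 0 <= f v)%E ->
  iint (fun v => f (v + a)) = iint f.
Proof.
elim: N f a => [|N IH] f a mf f0 /=.
  by congr f; apply/rowP => -[].
rewrite -[in RHS](mul1e (integral _ _ _)) -[1%E]/(1%:E) -[1 in RHS]invr1.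
rewrite -(@integral_affine _ 1 (a 0 0)) //; last 2 first.
- exact: measurable_iint_slice.
- by move=> x; apply: iint_ge0.
apply: eq_integral => x _.
rewrite -[RHS](IH _ (rsubmx (a : 'rV[R]_(1 + N)))) //; last first.
  exact: (vmeas_slice mf).
apply: eq_iint => v; congr f.
apply/rowP => i; rewrite !mxE; case: splitP => j ij; rewrite !mxE.
  by rewrite mul1r; congr (_ + a _ _); apply: val_inj => /=; rewrite ij ord1.
by congr (_ + a _ _); apply: val_inj => /=; rewrite ij.
Qed.

Lemma iint_scale (R : realType) N (t : R) (f : 'rV[R]_N -> \bar R) : 0 < t ->
  vmeas f -> (forall v, 0 <= f v)%E ->
  iint (fun v => f (t *: v)) = ((t^-1 ^+ N)%:E * iint f)%E.
Proof.
move=> t0; elim: N f => [|N IH] f mf f0 /=.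
  by rewrite expr0 mul1e scaler0.
rewrite exprS EFinM [(t^-1%:E * _)%E]muleC -muleA.
rewrite -(@integral_affine _ t 0) //; last 2 first.
- exact: measurable_iint_slice.
- by move=> x; apply: iint_ge0.
rewrite -ge0_integralZl_EFin //; last 3 first.
- by move=> x _; apply: iint_ge0.
- apply: (measurableT_comp (measurable_iint_slice mf f0)).
  by apply: measurable_funD => //; apply: measurable_funM.
- by rewrite exprn_ge0 // invr_ge0 ltW.
apply: eq_integral => x _.
rewrite -[RHS]IH //; last exact: (vmeas_slice mf).
apply: eq_iint => v; congr f; apply/rowP => i.
by rewrite !mxE; case: splitP => j _; rewrite !mxE ?addr0.
Qed.

(** * Gaussian integrals *)

Definition quad (R : realType) N (A : 'M[R]_N) (z : 'rV[R]_N) : R :=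
  (z *m A *m z^T) 0 0.

Lemma quadE (R : realType) N (A : 'M[R]_N) (z : 'rV[R]_N) :
  quad A z = \sum_i \sum_j A i j * z 0 i * z 0 j.
Proof.
rewrite /quad mxE exchange_big /=; apply: eq_bigr => j _.
rewrite !mxE mulr_suml; apply: eq_bigr => i _.
by rewrite mulrC; ring.
Qed.

Lemma measurable_coord (R : realType) N d (T : measurableType d)
    (c : 'I_N -> T -> R) i :
  (forall i, measurable_fun setT (c i)) ->
  measurable_fun setT (fun t => (\row_i c i t) 0 i).
Proof. by move=> mc; under eq_fun do rewrite mxE; exact: mc. Qed.

Lemma measurable_quad (R : realType) N d (T : measurableType d)
    (A : T -> 'M[R]_N) (c : 'I_N -> T -> R) :
  (forall i j, measurable_fun setT (fun t => A t i j)) ->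
  (forall i, measurable_fun setT (c i)) ->
  measurable_fun setT (fun t => quad (A t) (\row_i c i t)).
Proof.
move=> mA mc; under eq_fun do rewrite quadE.
apply: measurable_sum => i; apply: measurable_sum => j.
apply: measurable_funM; last exact: measurable_coord.
by apply: measurable_funM; last exact: measurable_coord.
Qed.

Lemma integral_gauss (R : realType) (a : R) : 0 < a ->
  (\int[@lebesgue_measure R]_x (expR (- (a * x ^+ 2)))%:E =
   (Num.sqrt pi / Num.sqrt a)%:E)%E.
Proof.
move=> a0; have pi0 := pi_gt0 R.
(* The standard deviation for which the normal density is proportional to [exp (- a x^2)]. *)
pose s := (Num.sqrt (a *+ 2))^-1.
have s0 : s != 0 by rewrite invr_eq0 gt_eqF // sqrtr_gt0 mulrn_wgt0.
have s2 : s ^+ 2 = (a *+ 2)^-1.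
  by rewrite exprVn sqr_sqrtr // ltW // mulrn_wgt0.
have := integral_normal_pdf 0 s; rewrite normal_pdfE // => int1.
have E x : expR (- (a * x ^+ 2)) =
   Num.sqrt pi / Num.sqrt a * (normal_peak s * normal_fun 0 s x).
  rewrite [RHS]mulrA -[LHS]mul1r; congr (_ * _).
    rewrite /normal_peak. rewrite s2.
    move: (pi : R) pi0 => p p0; have p2 : 0 <= (a *+ 2)^-1 * p *+ 2.
      by rewrite mulrn_wge0 // mulr_ge0 ?invr_ge0 ?mulrn_wge0 ?ltW.
    rewrite -!sqrtrV ?(ltW a0) // -!sqrtrM ?ltW ?divr_gt0 //.
    by rewrite -[LHS]sqrtr1; congr Num.sqrt; field; rewrite !gt_eqF.
  rewrite /normal_fun subr0 s2; congr expR; field; rewrite gt_eqF //.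
under eq_integral do rewrite E EFinM.
rewrite ge0_integralZl_EFin //; last 2 first.
- by move=> x _; rewrite lee_fin mulr_ge0 ?normal_peak_ge0 // normal_fun_ge0.
- apply/measurable_EFinP; apply: measurable_funM => //.
  exact: measurable_normal_fun.
by rewrite int1 mule1.
Qed.

Definition posdef (R : realType) N (M : 'M[R]_N) : Prop :=
  M^T = M /\ forall z, z != 0 -> 0 < quad M z.

Lemma vmeas_exp_quad (R : realType) N (M : 'M[R]_N) :
  vmeas (fun z => (expR (- quad M z))%:E).
Proof.
move=> d T c mc; apply/measurable_EFinP; apply: measurableT_comp => //.
by apply: measurableT_comp => //; apply: measurable_quad.
Qed.

Lemma quad_congr (R : realType) m n (U : 'M[R]_(m, n)) (D : 'M[R]_n) z :
  quad (U *m D *m U^T) z = quad D (z *m U).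
Proof. by rewrite /quad trmx_mul !mulmxA. Qed.

Lemma quad_block_diag (R : realType) N (k : R) (C : 'M[R]_N) (x : 'rV[R]_1) v :
  quad (block_mx k%:M 0 0 C) (row_mx x v) = k * x 0 0 ^+ 2 + quad C v.
Proof.
rewrite /quad mul_row_block !mulmx0 addr0 add0r tr_row_mx mul_row_col mxE.
by congr (_ + _); rewrite mul_mx_scalar !mxE big_ord1 !mxE; ring.
Qed.

(** Schur complement: with [w = b C^-1], [quad M (x, v) = k x^2 + quad C (v + x w)]. For fixed [x]
    the inner integral loses [x w] by translation invariance, and a one-dimensional Gaussian in [x]
    remains. Positivity of the determinant is carried along because [C] has to be inverted. *)
Theorem gaussian_iint (R : realType) N (M : 'M[R]_N) : posdef M ->
  0 < \det M /\
  iint (fun z => (expR (- quad M z))%:E) =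
    (Num.sqrt pi ^+ N / Num.sqrt (\det M))%:E.
Proof.
elim: N M => [|N IH] M [Msym Mpos].
  rewrite det_mx00 ltr01 /= expr0 sqrtr1 divr1; split => //.
  rewrite /quad (_ : _ *m _ = 0) ?mxE ?oppr0 ?expR0 //.
  by apply/matrixP => i j; rewrite !mxE big_ord0.
pose a : R := M 0 0; pose b := ursubmx (M : 'M[R]_(1 + N)).
pose C := drsubmx (M : 'M[R]_(1 + N)).
have Csym : C^T = C by rewrite /C trmx_drsub; congr drsubmx; exact: Msym.
have bE : dlsubmx (M : 'M[R]_(1 + N)) = b^T by rewrite /b trmx_ursub; congr dlsubmx; symmetry;
  exact: Msym.
have ME : M = block_mx a%:M b b^T C :> 'M[R]_(1 + N).
  rewrite -bE -[LHS](@submxK _ 1 N 1 N); congr block_mx.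
  apply/matrixP => i j; rewrite !ord1 !mxE eqxx mulr1n.
  by congr (M _ _); apply: val_inj.
have Cpos : posdef C.
  split=> // v v0.
  have -> : quad C v = quad (M : 'M[R]_(1 + N)) (row_mx (0 : 'rV_1) v).
    rewrite /quad ME mul_row_block !mul0mx !add0r tr_row_mx mul_row_col trmx0.
    by rewrite mulmx0 add0r.
  apply: (Mpos (row_mx (0 : 'rV_1) v)); apply: contra v0 => /eqP v0.
  by rewrite -(row_mxKr (0 : 'rV_1) v) v0 linear0.
have [Cdet Cint] := IH C Cpos.
have Cu : C \in unitmx by rewrite unitmxE unitfE gt_eqF.
pose w := b *m invmx C.
have wC : w *m C = b by rewrite /w mulmxKV.
clearbody w.
have CwT : C *m w^T = b^T by rewrite -wC trmx_mul Csym.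
pose k : R := a - (w *m C *m w^T) 0 0.
pose U : 'M[R]_(1 + N) := block_mx 1%:M w 0 1%:M.
have MUE : M = U *m block_mx k%:M 0 0 C *m U^T :> 'M[R]_(1 + N).
  rewrite /U tr_block_mx !mulmx_block !trmx1 !trmx0 !mulmx0 !mul0mx !addr0.
  rewrite !add0r !mulmx1 !mul1mx wC CwT [LHS]ME; congr block_mx; last by rewrite add0r.
  by apply/matrixP => i j; rewrite !ord1 [LHS]mxE /k wC !mxE !eqxx !mulr1n subrK.
have k0 : 0 < k.
  have <- : quad (M : 'M[R]_(1 + N)) (row_mx 1%:M (- w)) = k.
    rewrite MUE quad_congr /U mul_row_block !mulmx1 mul1mx mulmx0 addr0 subrr.
    by rewrite quad_block_diag mxE expr1n mulr1 /quad !mul0mx mxE addr0.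
  apply: (Mpos (row_mx 1%:M (- w))); apply/eqP.
  move=> /(congr1 (@lsubmx _ 1 1 N)); rewrite row_mxKl linear0.
  by move=> /matrixP/(_ 0 0)/eqP; rewrite !mxE oner_eq0.
have detM : \det M = k * \det C.
  have -> : \det M = \det (M : 'M[R]_(1 + N)) by [].
  rewrite MUE !det_mulmx det_tr /U det_ublock !det1 det_ublock det_scalar1.
  by rewrite !mul1r mulr1.
split; first by rewrite detM mulr_gt0.
rewrite /=.
transitivity (\int[@lebesgue_measure R]_x ((Num.sqrt pi ^+ N / Num.sqrt (\det C))%:E * (expR (-
  (k * x ^+ 2)))%:E))%E.
  apply: eq_integral => x _.
  rewrite -Cint muleC -iintZl ?expR_ge0 //; last exact: vmeas_exp_quad.
  rewrite -[RHS](iint_shift (x *: w)) //; last first.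
    move=> d T c mc; apply: emeasurable_funM => //.
    by apply: vmeas_exp_quad.
  apply: eq_iint => v; rewrite -EFinM -expRD; congr (expR _)%:E.
  rewrite -opprD; congr (- _).
  transitivity (quad (M : 'M[R]_(1 + N)) (row_mx (const_mx x) v)) => //.
  rewrite MUE quad_congr /U mul_row_block !mulmx1 mulmx0 addr0 quad_block_diag.
  rewrite mxE [_ + v]addrC; congr (_ + quad _ (_ + _)).
  by apply/rowP => i; rewrite !mxE big_ord1 mxE.
rewrite ge0_integralZl_EFin //; last first.
  apply/measurable_EFinP; apply: measurableT_comp => //.
  by apply: measurableT_comp => //; apply: measurable_funM => //; apply: measurable_funX.
rewrite integral_gauss // -EFinM detM sqrtrM ?ltW // exprS; congr _%:E.
by field; rewrite !gt_eqF // sqrtr_gt0.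
Qed.

(** * Quadratic forms diagonal in an orthonormal basis *)

Definition orthodiag (R : realType) N (U : 'M[R]_N) (l : 'I_N -> R) : 'M[R]_N :=
  U^T *m diag_mx (\row_i l i) *m U.

Definition orthomx (R : realType) N (U : 'M[R]_N) : Prop := U *m U^T = 1%:M.

Lemma symmetric_orthodiag (R : realType) N (A : 'M[R]_N) : A^T = A ->
  exists U l, orthomx U /\ A = orthodiag U l.
Proof.
move=> /symmetric_spectral[U [l [UU AE]]]; exists U, (l 0); split=> //.
by rewrite AE /orthodiag; congr (_ *m diag_mx _ *m _); apply/rowP => i; rewrite mxE.
Qed.

Section orthodiag.
Context (R : realType) (N : nat) (U : 'M[R]_N).
Hypothesis Uortho : orthomx U.
Implicit Types (l m : 'I_N -> R) (z : 'rV[R]_N).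

Lemma orthomx_tr : U^T *m U = 1%:M.
Proof. exact: mulmx1C. Qed.

Lemma is_spectrum_orthodiag l : is_spectrum (orthodiag U l) l.
Proof.
rewrite /is_spectrum /char_poly /char_poly_mx /orthodiag.
have UTU : map_mx polyC U^T *m map_mx polyC U = 1%:M.
  by rewrite -map_mxM orthomx_tr map_mx1.
have -> : 'X%:M - map_mx polyC (U^T *m diag_mx (\row_i l i) *m U) =
   map_mx polyC U^T *m char_poly_mx (diag_mx (\row_i l i)) *m map_mx polyC U.
  rewrite /char_poly_mx mulmxBr mulmxBl !map_mxM; congr (_ - _).
  by rewrite mul_mx_scalar -scalemxAl UTU scalemx1.
rewrite !det_mulmx mulrAC -det_mulmx UTU det1 mul1r.
rewrite -/(char_poly _) char_poly_trig ?diag_mx_is_trig //.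
by apply: eq_bigr => i _; rewrite !mxE eqxx mulr1n.
Qed.

Lemma root_orthodiag l x :
  root (char_poly (orthodiag U l)) x <-> exists i, l i = x.
Proof.
rewrite is_spectrum_orthodiag rootE horner_prod; split.
  by case/prodf_eq0 => i _; rewrite hornerXsubC subr_eq0 => /eqP ->; exists i.
by case=> i <-; apply/prodf_eq0; exists i; rewrite // hornerXsubC subrr.
Qed.

Lemma det_orthodiag l : \det (orthodiag U l) = \prod_i l i.
Proof.
rewrite /orthodiag !det_mulmx mulrAC -det_mulmx orthomx_tr det1 mul1r det_diag.
by apply: eq_bigr => i _; rewrite mxE.
Qed.

Lemma tr_orthodiag l : (orthodiag U l)^T = orthodiag U l.
Proof. by rewrite /orthodiag !trmx_mul trmxK tr_diag_mx mulmxA. Qed.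

Lemma quad_orthodiag l z :
  quad (orthodiag U l) z = \sum_i l i * (z *m U^T) 0 i ^+ 2.
Proof.
rewrite /orthodiag -{2}[U]trmxK quad_congr quadE; apply: eq_bigr => i _.
rewrite (bigD1 i) //= big1 ?addr0 => [|j ji].
  by rewrite !mxE eqxx mulr1n -mulrA -expr2.
by rewrite !mxE eq_sym (negPf ji) mulr0n !mul0r.
Qed.

Lemma sqnorm_orthomx z : sqnorm (z *m U^T) = sqnorm z.
Proof.
have E (y : 'rV[R]_N) : sqnorm y = (y *m y^T) 0 0.
  by rewrite mxE; apply: eq_bigr => i _; rewrite mxE expr2.
by rewrite !E trmx_mul trmxK mulmxA -(mulmxA z) orthomx_tr mulmx1.
Qed.

Lemma quad_orthodiag_cst b z : quad (orthodiag U (fun=> b)) z = b * sqnorm z.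
Proof. by rewrite quad_orthodiag -mulr_sumr -/(sqnorm _) sqnorm_orthomx. Qed.

Lemma quad_orthodiagB l m z : quad (orthodiag U (fun i => l i - m i)) z =
  quad (orthodiag U l) z - quad (orthodiag U m) z.
Proof.
by rewrite !quad_orthodiag -sumrB; apply: eq_bigr => i _; rewrite mulrBl.
Qed.

Lemma quad_orthodiagZ b l z : quad (orthodiag U (fun i => b * l i)) z =
  b * quad (orthodiag U l) z.
Proof.
by rewrite !quad_orthodiag mulr_sumr; apply: eq_bigr => i _; rewrite mulrA.
Qed.

Lemma quad_orthodiag_le l m z : (forall i, l i <= m i) ->
  quad (orthodiag U l) z <= quad (orthodiag U m) z.
Proof.
move=> lm; rewrite !quad_orthodiag; apply: ler_sum => i _.
by rewrite ler_wpM2r ?sqr_ge0.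
Qed.

Lemma quad_orthodiag_bound b l z : (forall i, `|l i| <= b) ->
  `|quad (orthodiag U l) z| <= b * sqnorm z.
Proof.
move=> lb; rewrite ler_norml -mulNr -!quad_orthodiag_cst.
by rewrite !quad_orthodiag_le // => i; have := lb i; rewrite ler_norml => /andP[].
Qed.

Lemma sqnorm_ge0 (z : 'rV[R]_N) : 0 <= sqnorm z.
Proof. by apply: sumr_ge0 => i _; apply: sqr_ge0. Qed.

Lemma sqnorm_eq0 (z : 'rV[R]_N) : sqnorm z = 0 -> z = 0.
Proof.
move=> /eqP; rewrite psumr_eq0 => [/allP z0|i _]; last exact: sqr_ge0.
apply/rowP => i; have := z0 i (mem_index_enum _).
by rewrite sqrf_eq0 [RHS]mxE => /eqP.
Qed.

Lemma sqnormZ t (z : 'rV[R]_N) : sqnorm (t *: z) = t ^+ 2 * sqnorm z.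
Proof. by rewrite mulr_sumr; apply: eq_bigr => i _; rewrite mxE exprMn. Qed.

Lemma quadZ (A : 'M[R]_N) t z : quad A (t *: z) = t ^+ 2 * quad A z.
Proof.
rewrite !quadE mulr_sumr; apply: eq_bigr => i _; rewrite mulr_sumr.
by apply: eq_bigr => j _; rewrite !mxE; ring.
Qed.

Definition gaussvol N (d : 'I_N -> R) : R :=
  Num.sqrt pi ^+ N / Num.sqrt (\prod_i d i).

Lemma gaussvol_gt0 n (d : 'I_n -> R) : (forall i, 0 < d i) -> 0 < gaussvol d.
Proof.
move=> d0; rewrite divr_gt0 ?exprn_gt0 ?sqrtr_gt0 ?pi_gt0 //.
exact: prodr_gt0.
Qed.

Lemma gaussian_orthodiag d : (forall i, 0 < d i) ->
  iint (fun z => (expR (- quad (orthodiag U d) z))%:E) = (gaussvol d)%:E.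
Proof.
move=> d0; have [|_ ->] := @gaussian_iint R N (orthodiag U d).
  split; first exact: tr_orthodiag.
  move=> z z0; rewrite quad_orthodiag lt_neqAle sumr_ge0 ?andbT => [|i _]; last first.
    by rewrite mulr_ge0 ?sqr_ge0 // ltW.
  apply: contra z0; rewrite eq_sym psumr_eq0 => [/allP w0|i _]; last first.
    by rewrite mulr_ge0 ?sqr_ge0 // ltW.
  apply/eqP/sqnorm_eq0; rewrite -sqnorm_orthomx; apply: big1 => i _.
  have := w0 i (mem_index_enum _); rewrite mulf_eq0 gt_eqF //= => /eqP ->.
  by [].
by rewrite det_orthodiag.
Qed.

End orthodiag.

Lemma hamiltonianE (R : realType) N (J : 'M[R]_N) z :
  hamiltonian J z = - quad (scaledJ J) z.
Proof.
rewrite /hamiltonian quadE mulNr; congr (- _); rewrite mulr_sumr.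
apply: eq_bigr => i _; rewrite mulr_sumr; apply: eq_bigr => j _.
by rewrite mxE !mulrA.
Qed.

(** * Concentration of Gaussian vectors on shells *)

Definition vmeasr (R : realType) N (f : 'rV[R]_N -> R) : Prop :=
  forall d (T : measurableType d) (c : 'I_N -> T -> R),
    (forall i, measurable_fun setT (c i)) ->
    measurable_fun setT (fun t => f (\row_i c i t)).

Section vmeasr.
Context (R : realType) (N : nat).
Implicit Types f g : 'rV[R]_N -> R.

Lemma vmeas_EFin f : vmeasr f -> vmeas (fun z => (f z)%:E).
Proof. by move=> mf d T c mc; apply/measurable_EFinP; exact: mf. Qed.

Lemma vmeasr_sqnorm : vmeasr (@sqnorm R N).
Proof.
move=> d T c mc; apply: measurable_sum => i; apply: measurable_funX.
exact: measurable_coord.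
Qed.

Lemma vmeasr_quad (A : 'M[R]_N) : vmeasr (quad A).
Proof. by move=> d T c mc; apply: measurable_quad. Qed.

Lemma vmeasr_cst k : vmeasr (fun _ : 'rV[R]_N => k).
Proof. by move=> d T c mc. Qed.

Lemma vmeasrD f g : vmeasr f -> vmeasr g -> vmeasr (fun z => f z + g z).
Proof. by move=> mf mg d T c mc; apply: measurable_funD; [exact: mf|exact: mg]. Qed.

Lemma vmeasrM f g : vmeasr f -> vmeasr g -> vmeasr (fun z => f z * g z).
Proof. by move=> mf mg d T c mc; apply: measurable_funM; [exact: mf|exact: mg]. Qed.

Lemma vmeasrN f : vmeasr f -> vmeasr (fun z => - f z).
Proof. by move=> mf d T c mc; apply: measurableT_comp => //; exact: mf. Qed.

Lemma vmeasr_comp h f : measurable_fun setT h -> vmeasr f -> vmeasr (fun z => h (f z)).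
Proof. by move=> mh mf d T c mc; apply: measurableT_comp => //; exact: mf. Qed.

Lemma vmeasr_exp f : vmeasr f -> vmeasr (fun z => expR (f z)).
Proof. exact: vmeasr_comp. Qed.

Lemma vmeasr_if (h1 h2 f g : 'rV[R]_N -> R) :
  vmeasr h1 -> vmeasr h2 -> vmeasr f -> vmeasr g ->
  vmeasr (fun z => if h1 z <= h2 z then f z else g z).
Proof.
move=> m1 m2 mf mg d T c mc; apply: measurable_fun_ifT; [|exact: mf|exact: mg].
by apply: measurable_fun_ler; [exact: m1|exact: m2].
Qed.

Lemma vmeasr_shell a b f : vmeasr f ->
  vmeasr (fun z => if a < sqnorm z <= b then f z else 0).
Proof.
move=> mf d T c mc; apply: measurable_fun_ifT => //; last exact: mf.
by apply: measurable_and; [apply: measurable_fun_ltr|apply: measurable_fun_ler] => //;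
  exact: vmeasr_sqnorm.
Qed.

End vmeasr.

Lemma le_iintR (R : realType) N (f g : 'rV[R]_N -> R) :
  vmeasr f -> vmeasr g -> (forall v, 0 <= f v) -> (forall v, f v <= g v) ->
  (iint (fun v => (f v)%:E) <= iint (fun v => (g v)%:E))%E.
Proof.
move=> mf mg f0 fg; apply: le_iint; try exact: vmeas_EFin.
  by move=> v; rewrite lee_fin.
by move=> v; rewrite lee_fin.
Qed.

Lemma iintDR (R : realType) N (f g : 'rV[R]_N -> R) :
  vmeasr f -> vmeasr g -> (forall v, 0 <= f v) -> (forall v, 0 <= g v) ->
  (iint (fun v => (f v + g v)%:E) = iint (fun v => (f v)%:E) + iint (fun v => (g v)%:E))%E.
Proof.
move=> mf mg f0 g0; rewrite -iintD //; try exact: vmeas_EFin.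
Qed.

Lemma iintZR (R : realType) N (k : R) (f : 'rV[R]_N -> R) :
  vmeasr f -> (forall v, 0 <= f v) -> 0 <= k ->
  (iint (fun v => (k * f v)%:E) = k%:E * iint (fun v => (f v)%:E))%E.
Proof.
by move=> mf f0 k0; rewrite -iintZl //; exact: vmeas_EFin.
Qed.

Lemma iintR_ge0 (R : realType) N (f : 'rV[R]_N -> R) : (forall v, 0 <= f v) ->
  (0 <= iint (fun v => (f v)%:E))%E.
Proof. by move=> f0; apply: iint_ge0 => v; rewrite lee_fin. Qed.

Ltac vmeas := repeat first
  [ apply: vmeasr_exp | apply: vmeasr_shell | apply: vmeasr_if | apply: vmeasrD | apply: vmeasrN
  | apply: vmeasr_cst | apply: vmeasr_sqnorm | apply: vmeasr_quad | apply: vmeasrM ].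

(* [1 / (1 - y) <= exp(y + 2 y^2)] for [y = h / d i <= 1/2], multiplied over the coordinates. *)
Lemma gaussvol_tilt (R : realType) N (d : 'I_N -> R) (c s h : R) :
  0 < c -> (forall i, c <= d i) -> \sum_i (d i)^-1 = 2 * N%:R * s -> h <= c / 2 ->
  gaussvol (fun i => d i - h) <= expR (h * N%:R * s + N%:R * (h / c) ^+ 2) * gaussvol d.
Proof.
move=> c0 cd dsum hc.
have d0 i : 0 < d i by apply: lt_le_trans (cd i).
have dh0 i : 0 < d i - h by have := cd i; lra.
pose y i := h / d i.
(* [h] may have either sign: the upper tail of a shell uses [h], the lower tail [- h]. *)
have yle i : y i <= 1 / 2 by rewrite ler_pdivrMr //; have := cd i; lra.
have key i : d i <= expR (y i + 2 * y i ^+ 2) * (d i - h).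
  have -> : d i - h = d i * (1 - y i) by rewrite /y; field; rewrite gt_eqF.
  rewrite mulrCA -{1}[d i]mulr1 ler_wpM2l ?(ltW (d0 i)) //.
  have y1 : 0 < 1 - y i by have := yle i; lra.
  rewrite -ler_pdivrMr // div1r.
  have -> : (1 - y i)^-1 = 1 + y i / (1 - y i) by field; rewrite gt_eqF.
  apply: le_trans (expR_ge1Dx _) _; rewrite ler_expR ler_pdivrMr //.
  have := yle i; have := sqr_ge0 (y i); nra.
(* Twice the exponent of the claim, because [gaussvol] contains the square root of the product. *)
have prodle : \prod_i d i <= expR (2 * (h * N%:R * s + N%:R * (h / c) ^+ 2)) * \prod_i (d i - h).
  apply: (@le_trans _ _ (\prod_i (expR (y i + 2 * y i ^+ 2) * (d i - h)))).
    by apply: ler_prod => i _; rewrite key ltW.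
  rewrite big_split /= -expR_sum ler_wpM2r ?ler_expR //.
    by apply: prodr_ge0 => i _; apply: ltW.
  rewrite big_split /= -mulr_sumr dsum -mulr_sumr mulrDr lerD //.
    by rewrite le_eqVlt; apply/orP; left; apply/eqP; ring.
  rewrite ler_wpM2l //.
  have -> : N%:R * ((h / c) ^+ 2) = \sum_(i < N) (h / c) ^+ 2.
    by rewrite sumr_const card_ord mulr_natl.
  apply: ler_sum => i _; rewrite /y !exprMn ler_wpM2l ?sqr_ge0 //.
  by rewrite ler_pXn2r ?nnegrE ?invr_ge0 ?(ltW c0) ?(ltW (d0 i)) // lef_pV2 ?posrE.
have P0 : 0 < \prod_i d i by apply: prodr_gt0.
have Q0 : 0 < \prod_i (d i - h) by apply: prodr_gt0.
rewrite /gaussvol mulrCA ler_wpM2l ?exprn_ge0 ?sqrtr_ge0 //.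
rewrite ler_pdivlMr ?sqrtr_gt0 // ler_pdivrMl ?sqrtr_gt0 //.
set e := h * N%:R * s + N%:R * (h / c) ^+ 2 in prodle *; clearbody e.
have E2 : expR e = Num.sqrt (expR (2 * e)).
  by rewrite mulr_natl mulr2n expRD -expr2 sqrtr_sqr ger0_norm ?expR_ge0.
rewrite mulrC E2 -sqrtrM ?expR_ge0 // ler_sqrt //.
by rewrite mulr_ge0 ?expR_ge0 ?ltW.
Qed.

(** The Gaussian weight times the exponential majorant of a tail event, as in Chernoff's inequality:
    [k = h] and [e = - h N (s + dl)] for the upper tail, [k = - h] and [e = h N (s - dl)] for the
    lower one. *)
Definition tilted (R : realType) N (U : 'M[R]_N) (d : 'I_N -> R) (e k : R) (z : 'rV[R]_N) : R :=
  expR (e + k * sqnorm z - quad (orthodiag U d) z).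

Lemma tilted_ge0 (R : realType) N (U : 'M[R]_N) d e k z : 0 <= tilted U d e k z.
Proof. exact: expR_ge0. Qed.

Lemma vmeasr_tilted (R : realType) N (U : 'M[R]_N) d e k : vmeasr (tilted U d e k).
Proof. by vmeas. Qed.

Lemma iint_tilted (R : realType) N (U : 'M[R]_N) d e k : orthomx U ->
  (forall i, 0 < d i - k) ->
  iint (fun z => (tilted U d e k z)%:E) = (expR e * gaussvol (fun i => d i - k))%:E.
Proof.
move=> UU dk0; rewrite EFinM -(gaussian_orthodiag UU dk0) -iintZR ?expR_ge0 //; last by vmeas.
apply: eq_iint => z; rewrite -expRD /tilted quad_orthodiagB // quad_orthodiag_cst //.
by congr (expR _)%:E; ring.
Qed.

(** Each tail carries at most a quarter of the mass. The saddle point equation cancels the terms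
    linear in [s], leaving the exponent [- N h dl + N (h / c)^2]. The bound [h <= dl c^2 / 2] makes
    the quadratic term at most half of the linear one, and [6 <= N h dl] leaves
    [exp (- 3) <= 1 / 4]. *)
Lemma gaussian_shell (R : realType) N (U : 'M[R]_N) (d : 'I_N -> R) (c s dl h : R) :
  orthomx U -> 0 < c -> (forall i, c <= d i) ->
  \sum_i (d i)^-1 = 2 * N%:R * s -> 0 < dl ->
  0 < h -> h <= c / 2 -> h <= dl * c ^+ 2 / 2 -> 6 <= N%:R * h * dl ->
  ((gaussvol d / 2)%:E <= iint (fun z => (if (N%:R * (s - dl) < sqnorm z <= N%:R * (s + dl))%R
     then expR (- quad (orthodiag U d) z) else 0)%:E))%E.
Proof.
move=> UU c0 cd dsum dl0 h0 hc hdl hN.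
have d0 i : 0 < d i by apply: lt_le_trans (cd i).
have dk0 k : k <= c / 2 -> forall i, 0 < d i - k by move=> kc i; have := cd i; lra.
have G0 : 0 < gaussvol d := gaussvol_gt0 d0.
have tail e k : h * N%:R * (dl / 2) <= - e - (k * N%:R * s + N%:R * (k / c) ^+ 2) ->
  k <= c / 2 -> expR e * gaussvol (fun i => d i - k) <= gaussvol d / 4.
  move=> he kc.
  apply: (@le_trans _ _ (expR (- 3) * gaussvol d)).
    rewrite -(ler_pM2l (expR_gt0 (- e))) [leLHS]mulrA [leRHS]mulrA -!expRD addNr expR0 mul1r.
    apply: le_trans (gaussvol_tilt c0 cd dsum kc) _.
    by rewrite ler_wpM2r ?(ltW G0) // ler_expR; lra.
  rewrite mulrC ler_wpM2l ?(ltW G0) // expRN lef_pV2 ?posrE ?expR_gt0 //.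
  by apply: le_trans (expR_ge1Dx 3); lra.
have hc2 : (h / c) ^+ 2 <= h * (dl / 2).
  rewrite expr2 mulrACA -invfM -expr2 ler_pdivrMr ?exprn_gt0 //; nra.
have N0 : 0 <= N%:R :> R by [].
have hmc : - h <= c / 2 by lra.
have tp : expR (- (h * N%:R * (s + dl))) * gaussvol (fun i => d i - h) <= gaussvol d / 4.
  by apply: tail => //; nra.
have tm : expR (h * N%:R * (s - dl)) * gaussvol (fun i => d i - - h) <= gaussvol d / 4.
  by apply: tail => //; rewrite !mulNr sqrrN; nra.
move: tp tm; rewrite -!lee_fin -!(iint_tilted (U := U)) //; [|exact: dk0|exact: dk0].
set fp := tilted U d _ h; set fm := tilted U d _ (- h).
set f := (X in _ -> _ -> (_ <= iint (fun z => (X z)%:E))%E) => tp tm.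
have f0 z : 0 <= f z by rewrite /f; case: ifP => // _; rewrite expR_ge0.
have mf : vmeasr f by rewrite /f; vmeas.
have mp : vmeasr (fun z => fp z + fm z) by apply: vmeasrD; exact: vmeasr_tilted.
have p0 z : 0 <= fp z + fm z by apply: addr_ge0; exact: tilted_ge0.
(* Inside the shell [f] is the full weight; outside, one of the two tilts is at least the full
   weight. *)
have cover z : tilted U d 0 0 z <= f z + (fp z + fm z).
  have fp0 : 0 <= fp z by exact: tilted_ge0.
  have fm0 : 0 <= fm z by exact: tilted_ge0.
  have t0 : tilted U d 0 0 z = expR (- quad (orthodiag U d) z).
    by rewrite /tilted mul0r !add0r.
  rewrite /f; case: ifPn => [_|]; first by rewrite t0 lerDl.
  rewrite add0r negb_and -leNgt -ltNge => /orP[zs|zs].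
    have : tilted U d 0 0 z <= fm z by rewrite ler_expR; nra.
    by move=> ?; lra.
  have : tilted U d 0 0 z <= fp z by rewrite ler_expR; nra.
  by move=> ?; lra.
have := le_iintR (@vmeasr_tilted _ _ U d 0 0) (vmeasrD mf mp) (tilted_ge0 U d 0 0) cover.
rewrite iintDR // iint_tilted //; last by move=> i; rewrite subr0.
rewrite expR0 mul1r (_ : gaussvol _ = gaussvol d); last first.
  by congr gaussvol; apply/funext => i; rewrite subr0.
rewrite iintDR; [|exact: vmeasr_tilted|exact: vmeasr_tilted|exact: tilted_ge0|exact: tilted_ge0].
move/le_trans => le1.
have : ((gaussvol d)%:E <= iint (fun z => (f z)%:E) + ((gaussvol d / 4)%:E + (gaussvol d /
  4)%:E))%E.
  by apply: le1; apply: leeD => //; apply: leeD.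
rewrite -EFinD; case: (iint _) (iintR_ge0 f0) => [x _|_ _|]; first 1 last.
- by rewrite leey.
- by rewrite leeNy_eq.
by rewrite -EFinD !lee_fin => ?; lra.
Qed.

Definition shellint (R : realType) N (A : 'M[R]_N) (beta a b : R) : \bar R :=
  iint (fun z => (if a < sqnorm z <= b then expR (beta * quad A z) else 0)%:E).

(** On the shell [q * sqnorm z >= N q (s - dl)], which trades the concentrated Gaussian weight of
    precision [q - beta m] for a constant prefactor; replacing [l] by the smaller [m] only lowers
    the integrand. *)
Lemma shellint_lower (R : realType) N (U : 'M[R]_N) (l m : 'I_N -> R)
    (beta q c s dl h : R) :
  orthomx U -> 0 <= beta -> 0 <= q -> (forall i, m i <= l i) ->
  0 < c -> (forall i, c <= q - beta * m i) ->
  \sum_i (q - beta * m i)^-1 = 2 * N%:R * s -> 0 < dl ->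
  0 < h -> h <= c / 2 -> h <= dl * c ^+ 2 / 2 -> 6 <= N%:R * h * dl ->
  ((expR (N%:R * (q * (s - dl))) * (gaussvol (fun i => (q - beta * m i)%R) / 2))%:E <=
   shellint (orthodiag U l) beta (N%:R * (s - dl)) (N%:R * (s + dl)))%E.
Proof.
move=> UU b0 q0 ml c0 cd dsum dl0 h0 hc hdl hN.
have := gaussian_shell UU c0 cd dsum dl0 h0 hc hdl hN.
set d := fun i => q - beta * m i => gs.
rewrite EFinM; apply: (@le_trans _ _ _ _ _ (lee_wpmul2l _ gs)).
  by rewrite lee_fin expR_ge0.
rewrite -iintZR ?expR_ge0 //; last 2 first.
- by vmeas.
- by move=> z; case: ifP => // _; exact: expR_ge0.
apply: le_iintR; [by vmeas|by vmeas| |] => z.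
  by rewrite mulr_ge0 ?expR_ge0 //; case: ifP => // _; exact: expR_ge0.
case: ifPn => [/andP[zl zu]|]; last by rewrite mulr0.
rewrite -expRD ler_expR /d quad_orthodiagB // quad_orthodiag_cst // quad_orthodiagZ //.
have := @quad_orthodiag_le _ _ U m l z ml.
nra.
Qed.

(** * Spherical integrals *)

Definition ballint (R : realType) N (g : 'rV[R]_N -> R) : \bar R :=
  iint (fun z => (if sqnorm z <= 1 then g z else 0)%:E).

Section ball.
Context (R : realType) (N : nat).
Implicit Types g : 'rV[R]_N -> R.

Lemma vmeasr_ball g b : vmeasr g -> vmeasr (fun z => if sqnorm z <= b then g z else 0).
Proof. by move=> mg; vmeas. Qed.

Lemma ballint_ge0 g : (forall z, 0 <= g z) -> (0 <= ballint g)%E.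
Proof. by move=> g0; apply: iintR_ge0 => z; case: ifP. Qed.

Lemma orthomx1 : orthomx (1%:M : 'M[R]_N).
Proof. by rewrite /orthomx trmx1 mulmx1. Qed.

Lemma gaussian_sqnorm a : 0 < a ->
  iint (fun z : 'rV[R]_N => (expR (- (a * sqnorm z)))%:E) =
  (gaussvol (fun _ : 'I_N => a))%:E.
Proof.
move=> a0; rewrite -(gaussian_orthodiag orthomx1) //.
by apply: eq_iint => z; rewrite quad_orthodiag_cst //; exact: orthomx1.
Qed.

Lemma ballint_fin g K : vmeasr g -> (forall z, 0 <= g z <= K) ->
  ballint g \is a fin_num.
Proof.
move=> mg gK; have g0 z : 0 <= g z by case/andP: (gK z).
have K0 : 0 <= K by case/andP: (gK 0) => /le_trans; apply.
rewrite ge0_fin_numE ?ballint_ge0 //.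
apply: (@le_lt_trans _ _ (iint (fun z : 'rV[R]_N => (K * expR 1 * expR (- (1 * sqnorm z)))%:E))).
  apply: le_iintR; [exact: vmeasr_ball|by vmeas|by move=> z; case: ifP|move=> z].
  rewrite -mulrA -expRD; case: ifP => z1; last by rewrite mulr_ge0 ?expR_ge0.
  case/andP: (gK z) => _ /le_trans; apply; rewrite ler_peMr //.
  by rewrite -[leLHS]expR0 ler_expR mul1r subr_ge0.
rewrite iintZR ?gaussian_sqnorm ?ltry ?mulr_ge0 ?expR_ge0 //.
by vmeas.
Qed.

(** A function constant on rays stands for a function on the sphere; dilation then plays the role of
    polar coordinates. *)
Lemma ballint_scale g b : 0 < b -> vmeasr g -> (forall z, 0 <= g z) ->
  (forall t z, 0 < t -> g (t *: z) = g z) ->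
  iint (fun z => (if sqnorm z <= b then g z else 0)%:E) =
  ((Num.sqrt b ^+ N)%:E * ballint g)%E.
Proof.
move=> b0 mg g0 gh; have sb0 : 0 < Num.sqrt b by rewrite sqrtr_gt0.
pose f z := (if sqnorm z <= b then g z else 0)%:E.
have -> : ballint g = iint (fun z => f (Num.sqrt b *: z)).
  apply: eq_iint => z; rewrite /f sqnormZ sqr_sqrtr ?(ltW b0) // gh //.
  by rewrite -{2}[b]mulr1 ler_pM2l.
rewrite iint_scale //; last 2 first.
- exact/vmeas_EFin/vmeasr_ball.
- by move=> z; rewrite /f lee_fin; case: ifP.
by rewrite muleA -EFinM -exprMn divff ?gt_eqF // expr1n mul1e.
Qed.

Lemma shell_scale g a b K : 0 < a -> a < b -> vmeasr g -> (forall z, 0 <= g z <= K) ->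
  (forall t z, 0 < t -> g (t *: z) = g z) ->
  iint (fun z => (if a < sqnorm z <= b then g z else 0)%:E) =
  ((Num.sqrt b ^+ N - Num.sqrt a ^+ N) * fine (ballint g))%:E.
Proof.
move=> a0 ab mg gK gh; have b0 := lt_trans a0 ab.
have g0 z : 0 <= g z by case/andP: (gK z).
have gfin := ballint_fin mg gK.
have := ballint_scale b0 mg g0 gh.
have -> : iint (fun z => (if sqnorm z <= b then g z else 0)%:E) =
  (iint (fun z => (if a < sqnorm z <= b then g z else 0)%:E)
   + iint (fun z => (if sqnorm z <= a then g z else 0)%:E))%E.
  rewrite -iintDR; [|by vmeas|by vmeas|by move=> z; case: ifP|by move=> z; case: ifP].
  apply: eq_iint => z; congr _%:E; case: (leP (sqnorm z) a) => /= za.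
    by rewrite (le_trans za (ltW ab)) add0r.
  by rewrite addr0.
rewrite (ballint_scale a0 mg g0 gh) -(fineK gfin) -!EFinM mulrBl.
case: (iint _) => [r| |]; [|by rewrite addye|by rewrite addNye].
by rewrite -EFinD => -[<-]; rewrite addrK.
Qed.

End ball.

(** The Boltzmann weight on the sphere of radius [r sqrt N], extended constantly along rays: its
    integral over the unit ball is, up to the volume of the ball, its integral for the cone
    measure. *)
Definition spherefun (R : realType) N (A : 'M[R]_N) (beta r : R) (z : 'rV[R]_N) : R :=
  expR (beta * quad A ((r * Num.sqrt N%:R / Num.sqrt (sqnorm z)) *: z)).

Section sphere.
Context (R : realType) (N : nat) (U : 'M[R]_N) (l : 'I_N -> R) (beta b r : R).
Hypotheses (UU : orthomx U) (beta0 : 0 <= beta) (lb : forall i, `|l i| <= b).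
Hypotheses (r0 : 0 < r) (N0 : (0 < N)%N).

Let b0 : 0 <= b.
Proof. by apply: le_trans (lb (Ordinal N0)). Qed.

Let N0R : 0 < N%:R :> R. Proof. by rewrite ltr0n. Qed.

Let g := spherefun (orthodiag U l) beta r.

(* For [z = 0] the division gives [0], hence the value [expR 0]. *)
Lemma spherefunE z : z != 0 ->
  g z = expR (beta * (r ^+ 2 * N%:R / sqnorm z * quad (orthodiag U l) z)).
Proof.
move=> z0; rewrite /g /spherefun quadZ.
by rewrite !exprMn exprVn !sqr_sqrtr ?sqnorm_ge0.
Qed.

Lemma spherefun_bound z : expR (- (N%:R * (beta * b * r ^+ 2)))
  <= g z <= expR (N%:R * (beta * b * r ^+ 2)).
Proof.
have B0 : 0 <= N%:R * (beta * b * r ^+ 2).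
  by rewrite !mulr_ge0 // ltW.
have [->|z0] := eqVneq z 0.
  rewrite /g /spherefun scaler0 -[0](scale0r (0 : 'rV[R]_N)) quadZ expr0n /= mul0r mulr0.
  by rewrite !ler_expR oppr_le0 B0.
have s0 : 0 < sqnorm z.
  by rewrite lt_neqAle sqnorm_ge0 andbT eq_sym; apply: contra z0 => /eqP/sqnorm_eq0/eqP.
rewrite spherefunE // !ler_expR -ler_norml.
have qb := quad_orthodiag_bound UU z lb.
have K0 : 0 <= r ^+ 2 * N%:R / sqnorm z by rewrite divr_ge0 ?mulr_ge0 ?sqr_ge0 // ltW.
rewrite normrM (ger0_norm beta0) normrM (ger0_norm K0).
have -> : N%:R * (beta * b * r ^+ 2) = beta * (r ^+ 2 * N%:R / sqnorm z * (b * sqnorm z)).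
  by field; rewrite gt_eqF.
by rewrite !ler_wpM2l.
Qed.

Lemma spherefun_scale t z : 0 < t -> g (t *: z) = g z.
Proof.
move=> t0; rewrite /g /spherefun sqnormZ sqrtrM ?sqr_ge0 // sqrtr_sqr gtr0_norm //.
congr (expR (_ * quad _ _)); rewrite scalerA; congr (_ *: _).
by rewrite invfM [t^-1 * _]mulrC !mulrA mulfVK // gt_eqF.
Qed.

Lemma vmeasr_spherefun : vmeasr g.
Proof.
(* The inverse of [sqnorm z] is written as a power, which is measurable on the whole line; at
   [z = 0] the form [quad] vanishes, so the exponent is 0 on both sides. *)
have -> : g = fun z => expR (beta * ((r ^+ 2 * N%:R) * ((sqnorm z `^ (- 1))
  * quad (orthodiag U l) z))).
  apply/funext => z; have [->|z0] := eqVneq z 0.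
    rewrite /g /spherefun scaler0 -[0](scale0r (0 : 'rV[R]_N)) quadZ.
    by rewrite expr0n /= mul0r !mulr0.
  by rewrite spherefunE // powR_inv1 ?sqnorm_ge0 // !mulrA.
vmeas; apply: (vmeasr_comp (measurable_powR _)).
exact: vmeasr_sqnorm.
Qed.

Lemma spherefun_fin : ballint g \is a fin_num.
Proof.
apply: (ballint_fin (K := expR (N%:R * (beta * b * r ^+ 2))) vmeasr_spherefun) => z.
by rewrite expR_ge0 /=; case/andP: (spherefun_bound z).
Qed.

(** Projecting [z] radially onto the sphere changes its quadratic form by [N r^2 - sqnorm z] times
    the Rayleigh quotient, which is at most [b] in absolute value. *)
Lemma spherefun_shell dl z : 0 < dl -> 0 < sqnorm z ->
  `|sqnorm z - N%:R * r ^+ 2| <= N%:R * dl ->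
  g z <= expR (N%:R * (beta * b * dl)) * expR (beta * quad (orthodiag U l) z) /\
  expR (beta * quad (orthodiag U l) z) <= expR (N%:R * (beta * b * dl)) * g z.
Proof.
move=> dl0 s0 zs; have z0 : z != 0.
  apply: contraTneq s0 => ->.
  by rewrite -(scale0r (0 : 'rV[R]_N)) sqnormZ expr0n /= mul0r ltxx.
have qb := quad_orthodiag_bound UU z lb.
rewrite spherefunE // -!expRD !ler_expR.
set Q := quad _ z in qb *.
set X := r ^+ 2 * N%:R / sqnorm z * Q.
have : `|X - Q| <= N%:R * (b * dl).
  have -> : X - Q = (N%:R * r ^+ 2 - sqnorm z) * (Q / sqnorm z).
    by rewrite /X; field; rewrite gt_eqF.
  rewrite normrM distrC (_ : N%:R * (b * dl) = N%:R * dl * b); last by ring.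
  rewrite ler_pM //.
  by rewrite normrM normfV (gtr0_norm s0) ler_pdivrMr.
rewrite ler_norml => /andP[h1 h2].
split.
  rewrite (_ : N%:R * _ = beta * (N%:R * (b * dl))); last by ring.
  by rewrite -mulrDr ler_wpM2l //; lra.
rewrite (_ : N%:R * _ = beta * (N%:R * (b * dl))); last by ring.
by rewrite -mulrDr ler_wpM2l //; lra.
Qed.

Lemma sphere_lower dl : 0 < dl -> dl < r ^+ 2 ->
  (shellint (orthodiag U l) beta (N%:R * (r ^+ 2 - dl)) (N%:R * (r ^+ 2 + dl)) <=
   (expR (N%:R * (beta * b * dl)) * (Num.sqrt (N%:R * (r ^+ 2 + dl)) ^+ N *
     fine (ballint g)))%:E)%E.
Proof.
move=> dl0 dlr; have gfin := spherefun_fin.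
have g0 z : 0 <= g z by exact: expR_ge0.
have B0 : 0 < N%:R * (r ^+ 2 + dl) by rewrite mulr_gt0 // addr_gt0 // exprn_gt0.
rewrite EFinM EFinM fineK // -ballint_scale //; last 2 first.
- exact: vmeasr_spherefun.
- by move=> t z; exact: spherefun_scale.
rewrite -iintZR ?expR_ge0 //; last 2 first.
- exact/vmeasr_ball/vmeasr_spherefun.
- by move=> z; case: ifP.
apply: le_iintR; [by vmeas|apply: vmeasrM; [by vmeas|exact/vmeasr_ball/vmeasr_spherefun]| |].
  by move=> z; case: ifP => // _; exact: expR_ge0.
move=> z; case: ifP => [/andP[zl zu]|_]; last first.
  by rewrite mulr_ge0 ?expR_ge0 //; case: ifP.
rewrite zu; have s0 : 0 < sqnorm z.
  by apply: lt_trans zl; rewrite mulr_gt0 // subr_gt0.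
apply: (spherefun_shell dl0 s0 _).2.
by rewrite ler_norml; apply/andP; split; nra.
Qed.

(** The shell is taken on the inner side of the sphere, so that [q * sqnorm z <= N q r^2] holds on
    it without error. *)
Lemma sphere_upper q dl : 0 < dl -> dl < r ^+ 2 -> 0 <= q ->
  (forall i, 0 < q - beta * l i) ->
  (Num.sqrt (N%:R * r ^+ 2) ^+ N - Num.sqrt (N%:R * (r ^+ 2 - dl)) ^+ N) * fine (ballint g)
  <= expR (N%:R * (beta * b * dl + q * r ^+ 2)) * gaussvol (fun i => q - beta * l i).
Proof.
move=> dl0 dlr q0 ql; have g0 z : 0 <= g z by exact: expR_ge0.
have A0 : 0 < N%:R * (r ^+ 2 - dl) by rewrite mulr_gt0 // subr_gt0.
have AB : N%:R * (r ^+ 2 - dl) < N%:R * r ^+ 2.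
  by rewrite ltr_pM2l // gtrDl oppr_lt0.
rewrite -lee_fin [leRHS]EFinM -(gaussian_orthodiag UU ql).
rewrite -(shell_scale (K := expR (N%:R * (beta * b * r ^+ 2))) A0 AB vmeasr_spherefun);
  last 2 first.
- by move=> z; rewrite expR_ge0 /=; case/andP: (spherefun_bound z).
- by move=> t z; exact: spherefun_scale.
rewrite -iintZR ?expR_ge0 //; last by vmeas.
apply: le_iintR; [apply: vmeasr_shell; exact: vmeasr_spherefun|by vmeas| |].
  by move=> z; case: ifP.
move=> z; case: ifP => [/andP[zl zu]|_]; last by rewrite mulr_ge0 ?expR_ge0.
have s0 : 0 < sqnorm z by apply: lt_trans zl.
have [|+ _] := @spherefun_shell dl z dl0 s0.
  by rewrite ler_norml; apply/andP; split; nra.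
move=> /le_trans; apply; rewrite -!expRD ler_expR.
rewrite quad_orthodiagB // quad_orthodiag_cst // quad_orthodiagZ //.
by nra.
Qed.

End sphere.

(** * Volume of the unit ball *)

Section ballvolume.
Context (R : realType) (N : nat).

Definition ballvol : R := fine (ballint (fun _ : 'rV[R]_N => 1)).

Let cfin : ballint (fun _ : 'rV[R]_N => 1 : R) \is a fin_num.
Proof. by apply: (@ballint_fin _ _ _ 1) => // z; rewrite ler01 lexx. Qed.

Lemma ballvol_scale b : 0 < b ->
  iint (fun z : 'rV[R]_N => (if sqnorm z <= b then 1 else 0)%:E) =
  (Num.sqrt b ^+ N * ballvol)%:E.
Proof. by move=> b0; rewrite EFinM /ballvol fineK // -ballint_scale. Qed.

(** The Gaussian comparison for the zero matrix and [s = 1], whose saddle point is [q = 1 / 2].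
    Together with the lower bound below it stands in for the Gamma function and Stirling's
    formula. *)
Lemma ballvol_upper : (0 < N)%N ->
  Num.sqrt N%:R ^+ N * ballvol <= expR (N%:R / 2) * gaussvol (fun _ : 'I_N => 2^-1 : R).
Proof.
move=> N0; have N0R : 0 < N%:R :> R by rewrite ltr0n.
rewrite -lee_fin -ballvol_scale // EFinM -gaussian_sqnorm //.
rewrite -iintZR ?expR_ge0 //; last by vmeas.
apply: le_iintR; [by vmeas|by vmeas|by move=> z; case: ifP|move=> z].
case: ifP => zN; last by rewrite mulr_ge0 ?expR_ge0.
by rewrite -expRD -[leLHS]expR0 ler_expR; lra.
Qed.

Lemma ballvol_lower dl h : 0 < dl -> 0 < h -> h <= 1 / 4 -> h <= dl / 8 ->
  6 <= N%:R * h * dl ->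
  expR (N%:R * ((1 - dl) / 2)) * (gaussvol (fun _ : 'I_N => 2^-1 : R) / 2) <=
  Num.sqrt (N%:R * (1 + dl)) ^+ N * ballvol.
Proof.
move=> dl0 h0 h4 hdl hN.
have N0R : 0 < N%:R :> R.
  by rewrite lt_neqAle ler0n andbT; apply: contraTneq hN => <-; rewrite !mul0r -ltNge.
have B0 : 0 < N%:R * (1 + dl) by rewrite mulr_gt0 // addr_gt0.
have sum2 : \sum_(i < N) ((2^-1)^-1 : R) = 2 * N%:R * 1.
  by rewrite invrK sumr_const card_ord mulr1 mulr_natr.
(* The assumptions on [h] are those of [gaussian_shell] at [c = 1 / 2]. *)
have h1 : h <= 2^-1 / 2 by lra.
have h2 : h <= dl * 2^-1 ^+ 2 / 2 by lra.
have half0 : 0 < 2^-1 :> R by [].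
have := gaussian_shell (orthomx1 R N) half0 (fun _ => lexx _) sum2 dl0 h0 h1 h2 hN.
move=> /(lee_wpmul2l (x := (expR (N%:R * ((1 - dl) / 2)))%:E)).
rewrite -EFinM lee_fin => /(_ (expR_ge0 _)) le1.
rewrite -lee_fin -ballvol_scale //; apply: le_trans le1 _.
rewrite -iintZR ?expR_ge0 //; last 2 first.
- by vmeas.
- by move=> z; case: ifP => // _; exact: expR_ge0.
apply: le_iintR; [by vmeas|by vmeas| |] => z.
  by rewrite mulr_ge0 ?expR_ge0 //; case: ifP => // _; exact: expR_ge0.
case: ifP => [/andP[zl zu]|_]; last by rewrite mulr0; case: ifP.
rewrite zu -expRD -[leRHS]expR0 ler_expR quad_orthodiag_cst; last exact: orthomx1.
lra.
Qed.

End ballvolume.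

(** * Exponential asymptotics along a deterministic spectrum *)

(** Two-sided exponential bounds, rather than a limit of logarithms: positivity is built in, and
    constant prefactors such as 1/2 are absorbed by [e]. *)
Definition explim (R : realType) (Y : nat -> R) (T : R) : Prop :=
  forall e, 0 < e -> \forall N \near \oo,
    expR (N%:R * (T - e)) <= Y N <= expR (N%:R * (T + e)).

Section explim.
Context (R : realType).
Implicit Types (Y W : nat -> R) (T S : R).

Lemma explim_cvg Y T : explim Y T -> (fun N : nat => N%:R^-1 * ln (Y N)) @ \oo --> T.
Proof.
move=> YT; apply/cvgrPdist_le => e e0; near=> N.
have N0 : 0 < N%:R :> R by rewrite ltr0n; near: N; exact: nbhs_infty_gt.
have /andP[Yl Yu] : expR (N%:R * (T - e)) <= Y N <= expR (N%:R * (T + e)).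
  by near: N; exact: YT.
have Y0 : 0 < Y N by apply: lt_le_trans Yl; exact: expR_gt0.
rewrite distrC ler_distl ler_pdivlMl // ler_pdivrMl //.
rewrite -(ler_expR _ (ln _)) -(ler_expR (ln _)) lnK ?posrE //.
by rewrite Yl.
Unshelve. all: by end_near. Qed.

Lemma explim_div Y W T S : explim Y T -> explim W S ->
  explim (fun N => Y N / W N) (T - S).
Proof.
move=> YT WS e e0; have e2 : 0 < e / 2 by rewrite divr_gt0.
near=> N.
have /andP[Yl Yu] : expR (N%:R * (T - e / 2)) <= Y N <= expR (N%:R * (T + e / 2)).
  by near: N; exact: YT.
have /andP[Wl Wu] : expR (N%:R * (S - e / 2)) <= W N <= expR (N%:R * (S + e / 2)).
  by near: N; exact: WS.
have W0 : 0 < W N by apply: lt_le_trans Wl; exact: expR_gt0.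
rewrite ler_pdivlMr // ler_pdivrMr //; apply/andP; split.
  apply: le_trans Yl; apply: le_trans (ler_wpM2l (expR_ge0 _) Wu) _.
  by rewrite -expRD ler_expR; lra.
apply: le_trans Yu _; apply: le_trans (ler_wpM2l (expR_ge0 _) Wl).
by rewrite -expRD ler_expR; lra.
Unshelve. all: by end_near. Qed.

End explim.

Lemma near_expR_ge (R : realType) (k a : R) : 0 < a ->
  \forall N \near \oo, k <= expR (N%:R * a).
Proof.
move=> a0; near=> N; apply: le_trans (expR_ge1Dx _).
have : k / a <= N%:R by near: N; exact: nbhs_infty_ger.
by rewrite ler_pdivrMr //; lra.
Unshelve. all: by end_near. Qed.

Definition lnsqrtpi (R : realType) : R := ln (Num.sqrt pi).

Definition logpot (R : realType) N (beta : R) (l : 'I_N -> R) (q : R) : R :=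
  - (1 / 2) * (N%:R^-1 * \sum_i ln (q - beta * l i)).

Lemma sqrt_exprE (R : realType) (x : R) N : 0 < x ->
  Num.sqrt x ^+ N = expR (N%:R * (1 / 2 * ln x)).
Proof.
move=> x0; have -> : Num.sqrt x = expR (1 / 2 * ln x).
  rewrite -[LHS]lnK ?posrE ?sqrtr_gt0 //; congr expR.
  by rewrite -{2}[x]sqr_sqrtr ?ltW // lnXn ?sqrtr_gt0 // -mulr_natl; field.
by rewrite expRM_natl.
Qed.

Lemma gaussvolE (R : realType) N (d : 'I_N -> R) : (forall i, 0 < d i) ->
  gaussvol d = expR (N%:R * lnsqrtpi R - 1 / 2 * \sum_i ln (d i)).
Proof.
move=> d0; rewrite /gaussvol expRD; congr (_ * _).
  rewrite expRM_natl /lnsqrtpi lnK // posrE sqrtr_gt0 pi_gt0 //.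
have P0 : 0 < \prod_i d i by exact: prodr_gt0.
rewrite expRN; congr (_^-1).
rewrite -[LHS]expr1 sqrt_exprE // [1%:R * _]mul1r; congr (expR (_ * _)).
by rewrite -[RHS](@expRK R) expR_sum; congr ln; apply: eq_bigr => i _; rewrite lnK ?posrE.
Qed.

Lemma gaussvol_logpot (R : realType) N (beta : R) (l : 'I_N -> R) q :
  (0 < N)%N -> (forall i, 0 < q - beta * l i) ->
  gaussvol (fun i => q - beta * l i) = expR (N%:R * (lnsqrtpi R + logpot beta l q)).
Proof.
move=> N0 ql; rewrite gaussvolE //; congr expR; rewrite /logpot mulrDr; congr (_ + _).
by rewrite mulNr mulrN mulrCA mulVKf // pnatr_eq0 -lt0n.
Qed.

Lemma logpot_le (R : realType) N (beta : R) (l m : 'I_N -> R) q q' :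
  (forall i, 0 < q - beta * l i) -> (forall i, q - beta * l i <= q' - beta * m i) ->
  logpot beta m q' <= logpot beta l q.
Proof.
move=> q0 qq; rewrite /logpot !mulNr lerN2 ler_wpM2l // ler_wpM2l ?invr_ge0 //.
apply: ler_sum => i _; rewrite ler_ln ?posrE //.
by apply: lt_le_trans (qq i).
Qed.

(** Intermediate value theorem. At the left endpoint the at least [p N] eigenvalues equal to [M]
    contribute [2 s / p] each, hence at least [2 N s] together; at the right endpoint each of the
    [N] terms is at most [2 s]. The left endpoint guarantees a gap [p / (2 s)] above [beta M] that
    does not depend on [N]. *)
Lemma mean_inv_ivt (R : realType) N (beta M s p : R) (m : 'I_N -> R) :
  (0 < N)%N -> 0 < beta -> 0 < s -> 0 < p -> (forall i, m i <= M) ->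
  p * N%:R <= \sum_i (m i == M)%:R ->
  exists q, [/\ beta * M + p / (2 * s) <= q, q <= beta * M + 1 / (2 * s) &
    \sum_i (q - beta * m i)^-1 = 2 * N%:R * s].
Proof.
move=> N0 beta0 s0 p0 mM pN; have N0R : 0 < N%:R :> R by rewrite ltr0n.
have p1 : p <= 1.
  have : p * N%:R <= 1 * N%:R; last by rewrite ler_pM2r.
  apply: le_trans pN _; rewrite mul1r.
  apply: (@le_trans _ _ (\sum_(i < N) 1)); last by rewrite sumr_const card_ord.
  by apply: ler_sum => i _; case: (_ == _).
have c0 : 0 < p / (2 * s) by rewrite divr_gt0 // mulr_gt0.
set a := beta * M + p / (2 * s); set b := beta * M + 1 / (2 * s).
have ab : a <= b by rewrite lerD2l ler_pM2r // invr_gt0 mulr_gt0.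
pose f q := \sum_i (q - beta * m i)^-1.
have pos q i : a <= q -> 0 < q - beta * m i.
  move=> aq; have := mM i; rewrite -(ler_pM2l beta0) => ?.
  by move: aq; rewrite /a; lra.
have fcont : {within `[a, b], continuous f}.
  apply: continuous_in_subspaceT => q; rewrite inE /= in_itv /= => /andP[aq _].
  apply: (@cvg_big _ _ _ _ _ _ _ _ _ (fun i q => (q - beta * m i)^-1)) => [|i _].
    by move=> x y; exact: add_continuous.
  apply: cvgV; first by rewrite gt_eqF // pos.
  by apply: cvgB; [exact: cvg_id|exact: cvg_cst].
have fa : 2 * N%:R * s <= f a.
  have h : (p * N%:R) * (p / (2 * s))^-1 = 2 * N%:R * s.
    by field; rewrite !gt_eqF.
  rewrite -h; apply: (@le_trans _ _ (\sum_i (m i == M)%:R * (p / (2 * s))^-1)).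
    by rewrite -mulr_suml ler_wpM2r // invr_ge0 ltW.
  apply: ler_sum => i _; case: eqP => [->|_].
    by rewrite mul1r /a addrAC subrr add0r.
  by rewrite mul0r invr_ge0 ltW // pos.
have fb : f b <= 2 * N%:R * s.
  apply: (@le_trans _ _ (\sum_(i < N) (2 * s))); last first.
    by rewrite sumr_const card_ord -[leLHS]mulr_natr mulrAC lexx.
  apply: ler_sum => i _; rewrite -[leRHS]invrK lef_pV2 ?posrE ?pos //.
    by have := mM i; rewrite -(ler_pM2l beta0) /b mul1r; lra.
  by rewrite invr_gt0 mulr_gt0.
have [|q qab fq] := IVT ab fcont (v := 2 * N%:R * s).
  by rewrite ge_min fb orbT /= le_max fa.
by exists q; move: qab; rewrite in_itv /= => /andP[? ?]; split.
Qed.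

(** The saddle point moves with [N], so the lower bound must be uniform in [q]. Pointwise
    convergence on a finite grid is enough because [logpot] is nonincreasing: [q] is compared with
    the next grid point, and the mesh [h] satisfies [h s = e / 2]. *)
Lemma logpot_grid (R : realType) (beta lo hi s P e : R) (l : forall N, 'I_N -> R)
    (Lam : R -> R) :
  0 < beta -> 0 < s -> 0 < e ->
  (\forall N \near \oo, forall i, beta * l N i < lo) ->
  (forall q, lo <= q -> (fun N => logpot beta (l N) q) @ \oo --> Lam q) ->
  (forall q, lo <= q -> P <= q * s + Lam q) ->
  \forall N \near \oo, forall q, lo <= q -> q <= hi ->
    P - e <= q * s + logpot beta (l N) q.
Proof.
move=> beta0 s0 e0 llo Lcvg LP; pose h := e / (2 * s).
have h0 : 0 < h by rewrite divr_gt0 // mulr_gt0.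
pose x j : R := lo + j%:R * h.
have xlo j : lo <= x j by rewrite lerDl mulr_ge0 // ltW.
have grid J : \forall N \near \oo, forall j, (j < J)%N -> Lam (x j) - e / 2 <= logpot beta (l N)
  (x j).
  elim: J => [|J IH]; first by apply: nearW => N j; rewrite ltn0.
  have e2 : 0 < e / 2 by rewrite divr_gt0.
  have /cvgrPdist_le/(_ _ e2) HJ := Lcvg _ (xlo J).
  near=> N => j; rewrite ltnS leq_eqVlt => /orP[/eqP ->|jJ].
    have : `|Lam (x J) - logpot beta (l N) (x J)| <= e / 2 by near: N.
    by rewrite ler_norml => /andP[_]; lra.
  by move: j jJ; near: N.
(* The comparison uses grid point [j.+1], and [j] may reach the truncated quotient, whence [.+2]. *)
pose J := (Num.truncn ((hi - lo) / h)).+2.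
near=> N => q qlo qhi.
have lN i : beta * l N i < lo by move: i; near: N.
pose j := Num.truncn ((q - lo) / h).
have qx : 0 <= (q - lo) / h by rewrite divr_ge0 ?subr_ge0 // ltW.
have /andP[jl ju] : j%:R <= (q - lo) / h < j.+1%:R by exact: truncn_itv.
rewrite ler_pdivlMr // in jl; rewrite ltr_pdivrMr // in ju.
have jJ : (j.+1 < J)%N.
  by rewrite /J !ltnS; apply: le_truncn; rewrite ler_pM2r ?invr_gt0 // lerD2r.
have gj : Lam (x j.+1) - e / 2 <= logpot beta (l N) (x j.+1).
  by move: j.+1 jJ; near: N; exact: grid.
have := LP _ (xlo j.+1).
have mono : logpot beta (l N) (x j.+1) <= logpot beta (l N) q.
  apply: logpot_le => i; first by have := lN i; lra.
  by rewrite lerD2r /x; lra.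
have xq : x j.+1 * s <= q * s + e / 2.
  have -> : e / 2 = h * s by rewrite /h; field; rewrite gt_eqF.
  rewrite -mulrDl ler_pM2r // /x -natr1 mulrDl mul1r; lra.
lra.
Unshelve. all: by end_near. Qed.

Lemma ln_le_tangent (R : realType) (s x : R) : 0 < s -> 0 < x ->
  ln x <= ln s + (x - s) / s.
Proof.
move=> s0 x0; have y0 : 0 < x / s by rewrite divr_gt0.
have -> : x = s * (x / s) by field; rewrite gt_eqF.
rewrite lnM ?posrE // lerD2l -ler_expR lnK ?posrE //.
by apply: le_trans (expR_ge1Dx _); rewrite le_eqVlt; apply/orP; left; apply/eqP; field;
  rewrite gt_eqF.
Qed.

Lemma sqrt_natM_exprE (R : realType) (x : R) N : (0 < N)%N -> 0 < x ->
  Num.sqrt (N%:R * x) ^+ N = Num.sqrt N%:R ^+ N * expR (N%:R * (1 / 2 * ln x)).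
Proof. by move=> N0 x0; rewrite sqrtrM // exprMn [X in _ * X]sqrt_exprE. Qed.

Lemma half_expR_ge (R : realType) N (e : R) : 0 < e -> 2 <= expR (N%:R * e) ->
  expR (- (N%:R * e)) <= 1 / 2.
Proof. by move=> e0 h; rewrite expRN div1r lef_pV2 ?posrE ?expR_gt0. Qed.

Lemma sub_min_le (R : realType) (x m t : R) : 0 <= t -> x - m <= t -> x - Num.min x m <= t.
Proof. by move=> t0 xm; case: (leP x m) => _; lra. Qed.

Section deterministic.
Context (R : realType) (beta lb : R) (U : forall N, 'M[R]_N)
  (l : forall N, 'I_N -> R) (Lam : R -> R).
Arguments l : clear implicits.
Hypotheses (beta0 : 0 < beta) (lb0 : 0 < lb) (UU : forall N, orthomx (U N)).
Hypothesis ledge : forall e : R, 0 < e -> \forall N \near \oo, forall i, `|l N i| <= lb + e.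
Hypothesis lcount : forall e : R, 0 < e -> exists2 p : R, 0 < p &
  \forall N \near \oo, p * N%:R <= \sum_i (lb - e <= l N i)%R%:R.
Hypothesis Lcvg : forall q, beta * lb < q ->
  (fun N => logpot beta (l N) q) @ \oo --> Lam q.

Lemma near_logpot_le q e : beta * lb < q -> 0 < e ->
  \forall N \near \oo, (forall i, 0 < q - beta * l N i) /\
    logpot beta (l N) q <= Lam q + e.
Proof.
move=> qlb e0; have /cvgrPdist_le/(_ _ e0) cv := Lcvg qlb.
have k0 : 0 < (q - beta * lb) / (2 * beta) by rewrite divr_gt0 ?subr_gt0 // mulr_gt0.
near=> N; split.
  move=> i; have : `|l N i| <= lb + (q - beta * lb) / (2 * beta).
    by move: i; near: N; exact: ledge.
  rewrite ler_norml => /andP[_]; rewrite -(ler_pM2l beta0) mulrDr.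
  rewrite (_ : beta * (_ / _) = (q - beta * lb) / 2); last by field; rewrite gt_eqF.
  by move=> ?; lra.
have : `|Lam q - logpot beta (l N) q| <= e by near: N.
by rewrite ler_norml => /andP[]; lra.
Unshelve. all: by end_near. Qed.

(* Spectrum truncated at [lb - ep]: the tilted Gaussian then has positive spectral gap, so
   the shell carries half of its mass even in the low-temperature phase. *)
Lemma shellint_asymptotic_lower s P e : 0 < s ->
  (forall q, beta * lb < q -> P <= q * s + Lam q) -> 0 < e ->
  exists2 d0, 0 < d0 & forall dl, 0 < dl -> dl <= d0 -> \forall N \near \oo,
    ((expR (N%:R * (lnsqrtpi R + P - e)))%:E <=
      shellint (orthodiag (U N) (l N)) beta (N%:R * (s - dl)) (N%:R * (s + dl)))%E.
Proof.
(* The second bound keeps the cost [2 beta ep s] of the truncation below [e / 4]; [ep <= lb] keeps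
   the truncation level [lb - ep] nonnegative, hence [q >= 0]. *)
move=> s0 LP e0; pose ep := Num.min lb (e / (8 * beta * s)).
have ep0 : 0 < ep by rewrite lt_min lb0 /= divr_gt0 // !mulr_gt0.
have eplb : ep <= lb by rewrite ge_min lexx.
have epe : 2 * beta * ep * s <= e / 4.
  have : ep <= e / (8 * beta * s) by rewrite ge_min lexx orbT.
  by rewrite ler_pdivlMr ?mulr_gt0 //; lra.
clearbody ep.
have [p p0 pN] := lcount ep0.
pose c := p / (2 * s).
have c0 : 0 < c by rewrite divr_gt0 // mulr_gt0.
have bep : 0 < beta * ep by rewrite mulr_gt0.
(* The range of [q + 2 beta ep] when [q] is the saddle point of the truncated spectrum; it stays
   strictly to the right of the edge. *)
pose lo := beta * lb + beta * ep; pose hi := lo + 1 / (2 * s).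
have blb : 0 < beta * lb by rewrite mulr_gt0.
have i2s : 0 < 1 / (2 * s) by rewrite divr_gt0 // mulr_gt0.
have hi0 : 0 < hi by rewrite /hi /lo; lra.
have e4 : 0 < e / 4 by rewrite divr_gt0.
exists (e / 4 / hi) => [|dl dl0]; first by rewrite divr_gt0.
rewrite ler_pdivlMr // => dlhi.
pose h := Num.min (c / 2) (dl * c ^+ 2 / 2).
have h0 : 0 < h by rewrite lt_min !divr_gt0 // mulr_gt0 // exprn_gt0.
near=> N.
have N0 : (0 < N)%N by near: N; exact: nbhs_infty_gt.
have N0R : 0 < N%:R :> R by rewrite ltr0n.
have lN i : `|l N i| <= lb + ep by move: i; near: N; exact: ledge.
have hN : 6 <= N%:R * h * dl.
  rewrite -mulrA -ler_pdivrMr ?mulr_gt0 //; near: N; exact: nbhs_infty_ger.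
have twoN : 2 <= expR (N%:R * (e / 4)) by near: N; exact: near_expR_ge.
have grid q : lo <= q -> q <= hi -> P - e / 4 <= q * s + logpot beta (l N) q.
  move: q; near: N; apply: (@logpot_grid _ _ lo hi _ P _ l Lam beta0 s0 e4) => [|q qlo|q qlo].
  - near=> N => i; have : `|l N i| <= lb + ep / 2.
      by move: i; near: N; apply: ledge; rewrite divr_gt0.
    rewrite ler_norml => /andP[_]; rewrite -(ler_pM2l beta0) /lo; lra.
  - by apply: Lcvg; move: qlo; rewrite /lo; lra.
  - by apply: LP; move: qlo; rewrite /lo; lra.
pose M := lb - ep; pose m i := Num.min (l N i) M.
have mE i : m i = Num.min (l N i) M by [].
have mM i : m i <= M by rewrite ge_min lexx orbT.
have mcount : p * N%:R <= \sum_i (m i == M)%:R.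
  have /le_trans : p * N%:R <= \sum_i (lb - ep <= l N i)%R%:R by near: N.
  apply; apply: ler_sum => i _; rewrite ler_nat -/M /m.
  by case: (leP M (l N i)) => // _; rewrite ?eqxx.
have ml i : m i <= l N i by rewrite ge_min lexx.
clearbody m.
have [q [ql qu qsum]] := mean_inv_ivt N0 beta0 s0 p0 mM mcount.
have dpos i : c <= q - beta * m i.
  by have := mM i; rewrite -(ler_pM2l beta0); move: ql; rewrite /c; lra.
have M0 : 0 <= beta * M by rewrite mulr_ge0 ?(ltW beta0) // subr_ge0.
have q0 : 0 <= q by move: ql; rewrite -/c; lra.
have h1 : h <= c / 2 by rewrite ge_min lexx.
have h2 : h <= dl * c ^+ 2 / 2 by rewrite ge_min lexx orbT.
have := shellint_lower (UU N) (ltW beta0) q0 ml c0 dpos qsum dl0 h0 h1 h2 hN.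
apply: le_trans; rewrite lee_fin.
have dpos' i : 0 < q - beta * m i by apply: lt_le_trans (dpos i).
rewrite gaussvol_logpot //.
(* Truncation moves an eigenvalue from at most [lb + ep] down to [lb - ep], so shifting [q] by
   [2 beta ep] compensates it for every [i]. *)
have lp : logpot beta (l N) (q + 2 * beta * ep) <= logpot beta m q.
  apply: logpot_le => // i.
  suff : l N i - m i <= 2 * ep by rewrite -(ler_pM2l beta0); lra.
  have := lN i; rewrite ler_norml => /andP[_ lNi]; rewrite mE.
  by apply: sub_min_le; rewrite /M; lra.
have := grid (q + 2 * beta * ep).
have bM : beta * M = beta * lb - beta * ep by rewrite mulrBr.
have g1 : lo <= q + 2 * beta * ep by move: ql; rewrite /lo -/c bM; lra.
have g2 : q + 2 * beta * ep <= hi by move: qu; rewrite /hi /lo bM; lra.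
move=> /(_ g1 g2) gr.
(* The error [e] is spent in four quarters: the grid, the shift of [q], the width of the shell
   through [q dl <= hi dl], and the factor 1/2 of the concentration bound. *)
apply: (@le_trans _ _ (expR (N%:R * (q * (s - dl))) * (expR (N%:R * (lnsqrtpi R + logpot beta m
  q)) * expR (- (N%:R * (e / 4)))))).
  rewrite -!expRD ler_expR -mulrN -!mulrDr ler_wpM2l // ?(ltW N0R) //.
  have : q * dl <= hi * dl.
    by rewrite ler_wpM2r ?(ltW dl0) //; move: qu; rewrite /hi /lo bM; lra.
  lra.
rewrite ler_wpM2l ?expR_ge0 // ler_wpM2l ?expR_ge0 //.
by apply: le_trans (half_expR_ge e4 twoN) _; rewrite mul1r.
Unshelve. all: by end_near. Qed.

(** * Exponential rate of the spherical integral *)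

Section sphere_model.
Context (r P : R).
Hypothesis r0 : 0 < r.
Hypothesis PLamr : forall q, beta * lb < q -> P <= q * r ^+ 2 + Lam q.
Hypothesis Pinfr : forall e, 0 < e -> exists2 q, beta * lb < q & q * r ^+ 2 + Lam q <= P + e.

Let sr0 : 0 < r ^+ 2. Proof. by rewrite exprn_gt0. Qed.

(** [P] stands for the minimum of [q r^2 + Lam q]. It is described through [q > beta lb] only, where
    [logpot] converges; a minimizer on the edge is thus replaced by near-minimizers to its right. *)
Lemma sphere_asymptotic :
  explim (fun N => Num.sqrt N%:R ^+ N *
      fine (ballint (spherefun (orthodiag (U N) (l N)) beta r)))
    (lnsqrtpi R + P - 1 / 2 * ln (r ^+ 2)).
Proof.
move=> e e0; move: sr0 PLamr Pinfr; set s := r ^+ 2 => s0 PLam Pinf.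
pose b := lb + 1; have b0 : 0 < b by rewrite addr_gt0.
have e2 : 0 < e / 2 by rewrite divr_gt0.
have e4 : 0 < e / 4 by rewrite divr_gt0.
have [d0 d00 Hd] := shellint_asymptotic_lower s0 PLam e2.
pose kk := beta * b + 1 / (2 * s).
have kk0 : 0 < kk by apply: addr_gt0; [exact: mulr_gt0|rewrite divr_gt0 // mulr_gt0].
pose dl := Num.min d0 (Num.min (s / 2) (e / 4 / kk)).
have dl0 : 0 < dl by rewrite !lt_min d00 !divr_gt0.
have dld : dl <= d0 by rewrite ge_min lexx.
have dls2 : dl <= s / 2 by rewrite !ge_min lexx orbT.
have dlk : dl * kk <= e / 4 by rewrite -ler_pdivlMr // !ge_min lexx !orbT.
have dls : dl < s by lra.
have dlk' : dl * (beta * b) + dl / (2 * s) <= e / 4.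
  by move: dlk; rewrite /kk mulrDr mul1r.
have dbk : 0 < dl * (beta * b) by rewrite !mulr_gt0.
have dsk : 0 < dl / (2 * s) by rewrite divr_gt0 // mulr_gt0.
have [q qlb qP] := Pinf _ e4.
near=> N.
have N0 : (0 < N)%N by near: N; exact: nbhs_infty_gt.
have N0R : 0 < N%:R :> R by rewrite ltr0n.
have lN i : `|l N i| <= b by move: i; near: N; exact: ledge.
have sN0 : 0 < Num.sqrt N%:R ^+ N :> R by rewrite exprn_gt0 // sqrtr_gt0.
have I0 : 0 <= fine (ballint (spherefun (orthodiag (U N) (l N)) beta r)).
  by rewrite fine_ge0 // ballint_ge0 // => z; exact: expR_ge0.
apply/andP; split.
  have lowN : ((expR (N%:R * (lnsqrtpi R + P - e / 2)))%:E <=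
      shellint (orthodiag (U N) (l N)) beta (N%:R * (s - dl)) (N%:R * (s + dl)))%E.
    by near: N; exact: Hd.
  have := le_trans lowN (sphere_lower (UU N) (ltW beta0) lN r0 N0 dl0 dls).
  rewrite lee_fin sqrt_natM_exprE //; last by rewrite addr_gt0.
  rewrite -/s; set I := fine _ => le1.
  have {}le1 : expR (N%:R * (lnsqrtpi R + P - e / 2)) <=
     expR (N%:R * (beta * b * dl + 1 / 2 * ln (s + dl))) * (Num.sqrt N%:R ^+ N * I).
    by apply: le_trans le1 _; rewrite [N%:R * (_ + _)]mulrDr expRD le_eqVlt; apply/orP; left;
      apply/eqP; ring.
  rewrite -(ler_pM2l (expR_gt0 (N%:R * (beta * b * dl + 1 / 2 * ln (s + dl))))).
  apply: le_trans le1; rewrite -expRD ler_expR -mulrDr ler_wpM2l ?(ltW N0R) //.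
  have := ln_le_tangent s0 (addr_gt0 s0 dl0).
  have -> : (s + dl - s) / s = 2 * (dl / (2 * s)) by field; rewrite gt_eqF.
  lra.
have [ql0 ql] : (forall i, 0 < q - beta * l N i) /\ logpot beta (l N) q <= Lam q + e / 4.
  by near: N; exact: near_logpot_le.
have q0 : 0 <= q by apply: le_trans (ltW qlb); rewrite mulr_ge0 // ltW.
have := sphere_upper (UU N) (ltW beta0) lN r0 N0 dl0 dls q0 ql0.
rewrite -/s gaussvol_logpot // !sqrt_natM_exprE ?subr_gt0 // -mulrBr.
set I := fine _ => le1.
have t1 : 2 <= expR (N%:R * (dl / (2 * s))) by near: N; exact: near_expR_ge.
have t2 : 2 <= expR (N%:R * (e / 4)) by near: N; exact: near_expR_ge.
(* The ball of squared radius [N (s - dl)] carries at most half of the integral over the ball of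
   squared radius [N s], so the shell between them keeps the other half. *)
have half : expR (N%:R * (1 / 2 * ln (s - dl))) <= 1 / 2 * expR (N%:R * (1 / 2 * ln s)).
  have sd0 : 0 < s - dl by rewrite subr_gt0.
  apply: (@le_trans _ _ (expR (- (N%:R * (dl / (2 * s)))) * expR (N%:R * (1 / 2 * ln s)))).
    rewrite -expRD ler_expR -mulrN -mulrDr ler_wpM2l ?(ltW N0R) //.
    have := ln_le_tangent s0 sd0.
    have -> : (s - dl - s) / s = - (2 * (dl / (2 * s))) by field; rewrite gt_eqF.
    lra.
  by rewrite ler_wpM2r ?expR_ge0 // half_expR_ge.
rewrite -(ler_pM2l (expR_gt0 (N%:R * (1 / 2 * ln s)))) -expRD -mulrDr.
apply: (@le_trans _ _ (2 * (expR (N%:R * (beta * b * dl + q * s))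
  * expR (N%:R * (lnsqrtpi R + logpot beta (l N) q))))).
  rewrite -ler_pdivrMl //; apply: le_trans le1.
  rewrite [leRHS](_ : _ = (Num.sqrt N%:R ^+ N * I) * (expR (N%:R * (1 / 2 * ln s))
    - expR (N%:R * (1 / 2 * ln (s - dl))))); last by ring.
  rewrite [leLHS](_ : _ = (Num.sqrt N%:R ^+ N * I) * (2^-1 * expR (N%:R * (1 / 2 * ln s))));
    last by ring.
  by rewrite ler_wpM2l //; [rewrite mulr_ge0 // ltW|lra].
apply: le_trans (ler_wpM2r _ t2) _; first by rewrite mulr_ge0 ?expR_ge0.
rewrite -!expRD ler_expR -!mulrDr ler_wpM2l ?(ltW N0R) //; lra.
Unshelve. all: by end_near. Qed.

End sphere_model.
End deterministic.

Lemma gaussvol_half (R : realType) N :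
  gaussvol (fun _ : 'I_N => 2^-1 : R) = expR (N%:R * (lnsqrtpi R + 1 / 2 * ln 2)).
Proof.
rewrite gaussvolE // sumr_const card_ord lnV ?posrE // -mulr_natr; congr expR; ring.
Qed.

(** The rate is [1/2 ln (2 pi e)]. *)
Lemma ballvol_asymptotic (R : realType) :
  explim (fun N => Num.sqrt N%:R ^+ N * ballvol R N) (1 / 2 + lnsqrtpi R + 1 / 2 * ln 2).
Proof.
move=> e e0; pose dl := Num.min 1 (e / 2).
have dl0 : 0 < dl by rewrite lt_min ltr01 divr_gt0.
have dle : dl <= e / 2 by rewrite ge_min lexx orbT.
have e4 : 0 < e / 4 by rewrite divr_gt0.
pose h := Num.min (1 / 4) (dl / 8).
have h0 : 0 < h by rewrite lt_min !divr_gt0.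
near=> N.
have N0 : (0 < N)%N by near: N; exact: nbhs_infty_gt.
have N0R : 0 < N%:R :> R by rewrite ltr0n.
have hN : 6 <= N%:R * h * dl.
  rewrite -mulrA -ler_pdivrMr ?mulr_gt0 //; near: N; exact: nbhs_infty_ger.
have twoN : 2 <= expR (N%:R * (e / 4)) by near: N; exact: near_expR_ge.
apply/andP; split; last first.
  apply: le_trans (ballvol_upper R N0) _; rewrite gaussvol_half -expRD ler_expR.
  by rewrite -mulrDr ler_wpM2l ?(ltW N0R) //; lra.
have h1 : h <= 1 / 4 by rewrite ge_min lexx.
have h2 : h <= dl / 8 by rewrite ge_min lexx orbT.
have := ballvol_lower dl0 h0 h1 h2 hN.
rewrite sqrt_natM_exprE ?addr_gt0 // gaussvol_half [leRHS]mulrAC => le1.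
rewrite -(ler_pM2r (expR_gt0 (N%:R * (1 / 2 * ln (1 + dl))))).
apply: le_trans le1; rewrite -expRD.
apply: (@le_trans _ _ (expR (N%:R * ((1 - dl) / 2)) * (expR (N%:R * (lnsqrtpi R + 1 / 2 * ln 2))
  * expR (- (N%:R * (e / 4)))))).
  rewrite -!expRD ler_expR -mulrN -!mulrDr ler_wpM2l ?(ltW N0R) //.
  have := ln_le_tangent ltr01 (addr_gt0 ltr01 dl0); rewrite ln1 divr1 => ?; lra.
rewrite ler_wpM2l ?expR_ge0 // ler_wpM2l ?expR_ge0 //.
by apply: le_trans (half_expR_ge e4 twoN) _; rewrite mul1r.
Unshelve. all: by end_near. Qed.

(** * The Gaussian model for a fixed matrix *)

Definition zgfun (R : realType) N (A : 'M[R]_N) (beta lam : R) (z : 'rV[R]_N) : R :=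
  (2 * pi) `^ (- (N%:R / 2)) * expR (- sqnorm z / 2) *
  expR (beta * quad A z - beta ^+ 2 / (4 * N%:R) * sqnorm z ^+ 2 + lam / 2 * sqnorm z).

Definition ln2pi (R : realType) : R := ln (2 * pi).

(** The Legendre transform of the radial weight: the maximum over [x] of
    [q x - beta^2 x^2 / 4 + (lam - 1) x / 2], attained at [x = (2 q + lam - 1) / beta^2]. *)
Definition dualquad (R : realType) (beta lam q : R) : R :=
  (2 * q + lam - 1) ^+ 2 / (4 * beta ^+ 2).

Section gaussian_model.
Context (R : realType) (N : nat) (U : 'M[R]_N) (l : 'I_N -> R) (beta lam : R).
Hypotheses (UU : orthomx U) (beta0 : 0 < beta) (N0 : (0 < N)%N).

Let N0R : 0 < N%:R :> R. Proof. by rewrite ltr0n. Qed.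

Lemma zgfunE (A : 'M[R]_N) z : zgfun A beta lam z =
  expR (N%:R * (- (1 / 2) * ln2pi R - beta ^+ 2 * (sqnorm z / N%:R) ^+ 2 / 4
     + (lam - 1) * (sqnorm z / N%:R) / 2) + beta * quad A z).
Proof.
rewrite /zgfun /powR gt_eqF ?mulr_gt0 ?pi_gt0 // -/(ln2pi R) -!expRD; congr expR.
by field; rewrite gt_eqF.
Qed.

Lemma vmeasr_zgfun (A : 'M[R]_N) : vmeasr (zgfun A beta lam).
Proof.
rewrite /zgfun; apply: vmeasrM; first by vmeas.
apply: vmeasr_exp; apply: vmeasrD; last by vmeas.
by apply: vmeasrD; [by vmeas|apply: vmeasrN; apply: vmeasrM; [by vmeas|]];
  apply: (vmeasr_comp (h := fun x => x ^+ 2)) => //; exact: vmeasr_sqnorm.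
Qed.

Lemma zgfun_ge0 (A : 'M[R]_N) z : 0 <= zgfun A beta lam z.
Proof. by rewrite zgfunE expR_ge0. Qed.

(* [- beta^2 x^2 / 4 + (lam - 1) x / 2 <= dualquad q - q x], the tangent line to the quartic term. *)
Lemma zg_upper q : (forall i, 0 < q - beta * l i) ->
  (iint (fun z => (zgfun (orthodiag U l) beta lam z)%:E) <=
   (expR (N%:R * (dualquad beta lam q - 1 / 2 * ln2pi R)) *
     gaussvol (fun i => q - beta * l i)%R)%:E)%E.
Proof.
move=> ql; rewrite EFinM -(gaussian_orthodiag UU ql).
rewrite -iintZR ?expR_ge0 //; last by vmeas.
apply: le_iintR; [exact: vmeasr_zgfun|by vmeas|exact: zgfun_ge0|move=> z].
rewrite zgfunE -expRD ler_expR quad_orthodiagB // quad_orthodiag_cst // quad_orthodiagZ //.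
set x := sqnorm z / N%:R.
have -> : sqnorm z = N%:R * x by rewrite /x mulrC divfK // gt_eqF.
have : - beta ^+ 2 * x ^+ 2 / 4 + (lam - 1) * x / 2 <= dualquad beta lam q - q * x.
  rewrite -subr_ge0 (_ : _ - _ = (beta * x / 2 - (2 * q + lam - 1) / (2 * beta)) ^+ 2).
    exact: sqr_ge0.
  by rewrite /dualquad; field; rewrite gt_eqF.
rewrite -(ler_pM2l N0R); lra.
Qed.

Lemma zg_fin : iint (fun z => (zgfun (orthodiag U l) beta lam z)%:E) \is a fin_num.
Proof.
rewrite ge0_fin_numE; last by apply: iintR_ge0; exact: zgfun_ge0.
apply: le_lt_trans (zg_upper (q := \sum_i `|beta * l i| + 1) _) _; last exact: ltry.
move=> i; rewrite (bigD1 i) //=.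
have := ler_norm (beta * l i); have : 0 <= \sum_(j | j != i) `|beta * l j| by exact: sumr_ge0.
lra.
Qed.

Lemma zg_lower s dl : 0 < dl -> dl < s ->
  ((expR (N%:R * (- (1 / 2) * ln2pi R - beta ^+ 2 * (s + dl) ^+ 2 / 4
      + (lam - 1) * s / 2 - `|lam - 1| * dl / 2)))%:E *
    shellint (orthodiag U l) beta (N%:R * (s - dl)) (N%:R * (s + dl)) <=
   iint (fun z => (zgfun (orthodiag U l) beta lam z)%:E))%E.
Proof.
move=> dl0 dls; rewrite -iintZR ?expR_ge0 //; last 2 first.
- by vmeas.
- by move=> z; case: ifP => // _; exact: expR_ge0.
apply: le_iintR; [by vmeas|exact: vmeasr_zgfun| |].
  by move=> z; rewrite mulr_ge0 ?expR_ge0 //; case: ifP => // _; exact: expR_ge0.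
move=> z; case: ifP => [/andP[zl zu]|_]; last by rewrite mulr0 zgfun_ge0.
rewrite -expRD zgfunE ler_expR lerD2r ler_wpM2l ?(ltW N0R) //.
set x := sqnorm z / N%:R.
have xl : s - dl <= x by rewrite ler_pdivlMr // mulrC ltW.
have xu : x <= s + dl by rewrite ler_pdivrMr // mulrC.
have x2 : beta ^+ 2 * x ^+ 2 <= beta ^+ 2 * (s + dl) ^+ 2.
  rewrite ler_wpM2l ?sqr_ge0 // ler_pXn2r ?nnegrE //; lra.
have : - (`|lam - 1| * dl) <= (lam - 1) * (x - s).
  rewrite lerNl -mulrN; apply: le_trans (ler_norm _) _; rewrite normrM.
  by rewrite ler_wpM2l // normrN ler_distl; apply/andP; split; lra.
lra.
Qed.

End gaussian_model.

Section gaussian_asymptotic.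
Context (R : realType) (beta lb lam : R) (U : forall N, 'M[R]_N)
  (l : forall N, 'I_N -> R) (Lam : R -> R).
Arguments l : clear implicits.
Hypotheses (beta0 : 0 < beta) (lb0 : 0 < lb) (UU : forall N, orthomx (U N)).
Hypothesis ledge : forall e : R, 0 < e -> \forall N \near \oo, forall i, `|l N i| <= lb + e.
Hypothesis lcount : forall e : R, 0 < e -> exists2 p : R, 0 < p &
  \forall N \near \oo, p * N%:R <= \sum_i (lb - e <= l N i)%R%:R.
Hypothesis Lcvg : forall q, beta * lb < q ->
  (fun N => logpot beta (l N) q) @ \oo --> Lam q.
Context (s P T : R).
Hypothesis s0 : 0 < s.
Hypothesis PLam : forall q, beta * lb < q -> P <= q * s + Lam q.
Hypothesis TE : T = - (1 / 2) * ln2pi R - beta ^+ 2 * s ^+ 2 / 4 + (lam - 1) * s / 2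
  + lnsqrtpi R + P.
Hypothesis Tinf : forall e : R, 0 < e -> exists2 q, beta * lb < q &
  dualquad beta lam q + Lam q - 1 / 2 * ln2pi R + lnsqrtpi R <= T + e.

(** The lower bound keeps a single shell around [s], the upper bound a single [q]. Hypotheses [TE]
    and [Tinf] express that the resulting primal and dual values coincide. *)
Lemma gaussian_asymptotic :
  explim (fun N => fine (iint (fun z => (zgfun (orthodiag (U N) (l N)) beta lam z)%:E))) T.
Proof.
move=> e e0; have e2 : 0 < e / 2 by rewrite divr_gt0.
have [d0 d00 Hd] := shellint_asymptotic_lower beta0 lb0 UU ledge lcount Lcvg s0 PLam e2.
(* The loss per unit of shell width in [zg_lower]; the 3 comes from [(s + dl)^2 <= s^2 + 3 s dl] for
   [dl <= s]. *)
pose kk := 3 * beta ^+ 2 * s / 4 + `|lam - 1| / 2.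
have kk0 : 0 < kk.
  by rewrite ltr_pwDl ?divr_ge0 // divr_gt0 // !mulr_gt0 // exprn_gt0.
pose dl := Num.min d0 (Num.min (s / 2) (e / 2 / kk)).
have dl0 : 0 < dl by rewrite !lt_min d00 !divr_gt0.
have dld : dl <= d0 by rewrite ge_min lexx.
have dls2 : dl <= s / 2 by rewrite !ge_min lexx orbT.
have dlk : dl * kk <= e / 2 by rewrite -ler_pdivlMr // !ge_min lexx !orbT.
have dls : dl < s by move: s0; lra.
have [q qlb qT] := Tinf e2.
near=> N.
have N0 : (0 < N)%N by near: N; exact: nbhs_infty_gt.
have N0R : 0 < N%:R :> R by rewrite ltr0n.
have zfin := zg_fin (l N) lam (UU N) beta0 N0.
apply/andP; split.
  rewrite -lee_fin fineK //; apply: le_trans (zg_lower (U N) (l N) beta lam N0 dl0 dls).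
  have lowN : ((expR (N%:R * (lnsqrtpi R + P - e / 2)))%:E <=
      shellint (orthodiag (U N) (l N)) beta (N%:R * (s - dl)) (N%:R * (s + dl)))%E.
    by near: N; exact: Hd.
  apply: le_trans (lee_wpmul2l _ lowN); last by rewrite lee_fin expR_ge0.
  rewrite -EFinM lee_fin -expRD ler_expR -mulrDr ler_wpM2l ?(ltW N0R) // TE.
  have b2 : 0 <= beta ^+ 2 by exact: sqr_ge0.
  have : beta ^+ 2 * (s + dl) ^+ 2 <= beta ^+ 2 * (s ^+ 2 + 3 * s * dl).
    by rewrite ler_wpM2l //; nra.
  move: dlk; rewrite /kk; lra.
have [ql0 ql] : (forall i, 0 < q - beta * l N i) /\ logpot beta (l N) q <= Lam q + e / 2.
  by near: N; exact: (near_logpot_le beta0 ledge Lcvg).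
rewrite -lee_fin fineK //; apply: le_trans (zg_upper lam (UU N) beta0 N0 ql0) _.
rewrite lee_fin gaussvol_logpot // -expRD ler_expR -mulrDr ler_wpM2l ?(ltW N0R) //.
lra.
Unshelve. all: by end_near. Qed.

End gaussian_asymptotic.

(** * The logarithmic potential of the semicircle law *)

Section semicircle.
Context (R : realType) (lb beta : R).
Hypotheses (lb0 : 0 < lb) (beta0 : 0 < beta).
Notation leb := (@lebesgue_measure R).
Notation D := (`[(- lb)%R, lb]%classic : set R).

Lemma bounded_integrable_sc (f : R -> R) B : measurable_fun setT f ->
  (forall x, - lb <= x -> x <= lb -> `|f x| <= B) -> leb.-integrable D (EFin \o f).
Proof.
move=> mf fB; apply: measurable_bounded_integrable => //.
- by rewrite /= lebesgue_measure_itv /=; case: ifP => // _; rewrite -EFinB ltry.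
- exact: measurable_funTS.
exists B; split; first exact: num_real.
move=> M BM x /=; rewrite in_itv /= => /andP[x1 x2].
by apply: le_trans (ltW BM); exact: fB.
Qed.

Lemma rho_ge0 x : 0 <= rho lb x.
Proof. by rewrite /rho divr_ge0 // mulr_ge0 ?sqrtr_ge0 ?pi_ge0 ?sqr_ge0. Qed.

Lemma measurable_rho : measurable_fun setT (rho lb).
Proof.
rewrite /rho; apply: measurable_funM => //; apply: measurable_funM => //.
apply: measurableT_comp.
  by apply: continuous_measurable_fun; exact: sqrt_continuous.
by apply: measurable_funB => //; apply: measurable_funX.
Qed.

Lemma measurable_rho_ln q : measurable_fun setT (fun x => rho lb x * ln (q - beta * x)).
Proof.
apply: measurable_funM; first exact: measurable_rho.
apply: measurableT_comp => //; apply: measurable_funB => //.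
Qed.

(** A bound on the support for the factor of the density other than [sqrt (lb - x)]. *)
Definition rhoC : R := 2 * Num.sqrt (2 * lb) / (pi * lb ^+ 2).

Lemma rhoC_ge0 : 0 <= rhoC.
Proof. by rewrite /rhoC divr_ge0 // mulr_ge0 ?sqrtr_ge0 ?pi_ge0 ?sqr_ge0. Qed.

Lemma rho_le x : - lb <= x -> x <= lb -> rho lb x <= rhoC * Num.sqrt (lb - x).
Proof.
move=> x1 x2; rewrite /rho /rhoC [leRHS]mulrAC; apply: ler_wpM2r.
  by rewrite invr_ge0 mulr_ge0 ?pi_ge0 ?sqr_ge0.
rewrite -mulrA ler_wpM2l // -sqrtrM ?mulr_ge0 ?(ltW lb0) // ler_wsqrtr //; nra.
Qed.

Lemma rho_bound x : - lb <= x -> x <= lb -> `|rho lb x| <= rhoC * Num.sqrt (2 * lb).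
Proof.
move=> x1 x2; rewrite ger0_norm ?rho_ge0 //; apply: le_trans (rho_le x1 x2) _.
by rewrite ler_wpM2l ?rhoC_ge0 // ler_wsqrtr //; lra.
Qed.

Lemma ln_le_sqrt (y : R) : 0 < y -> ln y <= 2 * Num.sqrt y.
Proof.
move=> y0; have s0 : 0 < Num.sqrt y by rewrite sqrtr_gt0.
rewrite -{1}[y]sqr_sqrtr ?(ltW y0) // lnXn // mulr2n.
have := ln_le_tangent ltr01 s0; rewrite ln1 divr1; lra.
Qed.

Lemma potarg_gt0 q x : beta * lb <= q -> x < lb -> 0 < q - beta * x.
Proof. by move=> qlb; rewrite -(ltr_pM2l beta0) => ?; lra. Qed.

(* [rho] vanishes like a square root at [lb], which absorbs the logarithmic singularity. *)
Lemma rho_div_sqrt q x : beta * lb <= q -> - lb <= x -> x < lb ->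
  rho lb x / Num.sqrt (q - beta * x) <= rhoC / Num.sqrt beta.
Proof.
move=> qlb x1 x2; have y0 : 0 < q - beta * x by exact: potarg_gt0.
rewrite ler_pdivrMr ?sqrtr_gt0 // mulrAC -mulrA.
apply: le_trans (rho_le x1 (ltW x2)) _; rewrite ler_wpM2l ?rhoC_ge0 //.
rewrite ler_pdivlMr ?sqrtr_gt0 // -sqrtrM; last by lra.
by rewrite ler_wsqrtr //; nra.
Qed.

Lemma rho_lb : rho lb lb = 0.
Proof. by rewrite /rho subrr sqrtr0 mulr0 mul0r. Qed.

Lemma rho_ln_bound q : beta * lb <= q -> forall x, - lb <= x -> x <= lb ->
  `|rho lb x * ln (q - beta * x)| <= rhoC / Num.sqrt beta * (2 * (q + beta * lb) + 2).
Proof.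
have blb : 0 < beta * lb by rewrite mulr_gt0.
move=> qlb x x1; rewrite le_eqVlt => /orP[/eqP ->|x2].
  (* The density vanishes at the edge, so the default value of [ln] at 0 is harmless when
     [q = beta lb]. *)
  rewrite rho_lb mul0r normr0; apply: mulr_ge0; last by lra.
  by rewrite divr_ge0 ?rhoC_ge0.
have y0 : 0 < q - beta * x by exact: potarg_gt0.
set y := q - beta * x in y0 *; set sy := Num.sqrt y.
have s0 : 0 < sy by rewrite sqrtr_gt0.
have yE : y = sy ^+ 2 by rewrite sqr_sqrtr // ltW.
(* [ln_le_sqrt] at [y] bounds the logarithm above, and at the inverse of [y] below. *)
have lnb : `|ln y| <= (2 * y + 2) / sy.
  rewrite ler_norml; apply/andP; split.
    have := @ln_le_sqrt y^-1; rewrite invr_gt0 lnV ?posrE // sqrtrV ?(ltW y0) // => /(_ y0).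
    rewrite -/sy => h; rewrite lerNl; apply: le_trans h _; rewrite ler_pdivlMr // divfK ?gt_eqF //.
    by have := y0; lra.
  apply: le_trans (ln_le_sqrt y0) _; rewrite -/sy ler_pdivlMr // -mulrA -expr2 -yE.
  by have := y0; lra.
rewrite normrM (ger0_norm (rho_ge0 x)).
apply: le_trans (ler_wpM2l (rho_ge0 x) lnb) _.
have -> : rho lb x * ((2 * y + 2) / sy) = (rho lb x / sy) * (2 * y + 2) by ring.
apply: ler_pM; first by rewrite divr_ge0 ?rho_ge0 ?ltW.
- by have := y0; lra.
- exact: rho_div_sqrt.
- by have : beta * - lb <= beta * x by [rewrite ler_pM2l]; rewrite /y; lra.
Qed.

Lemma integrable_rho_ln q : beta * lb <= q ->
  leb.-integrable D (EFin \o (fun x => rho lb x * ln (q - beta * x))).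
Proof.
move=> qlb; apply: bounded_integrable_sc; first exact: measurable_rho_ln.
exact: rho_ln_bound.
Qed.

Definition scpot (q : R) : R :=
  - (1 / 2) * (\int[leb]_(x in D) (rho lb x * ln (q - beta * x)))%R.

Lemma integrable_rho : leb.-integrable D (EFin \o rho lb).
Proof. by apply: bounded_integrable_sc; [exact: measurable_rho|exact: rho_bound]. Qed.

Lemma integrable_cst_sc k : leb.-integrable D (EFin \o (fun=> k)).
Proof. by apply: (@bounded_integrable_sc _ `|k|). Qed.

Lemma integral_cst_sc k : (\int[leb]_(x in D) k)%R = k * (2 * lb).
Proof.
rewrite Rintegral_cst // /= lebesgue_measure_itv /= lte_fin.
rewrite ifT; first by rewrite -EFinB /=; congr (_ * _); ring.
by have := lb0; lra.
Qed.

Definition scC : R := rhoC / Num.sqrt beta * (2 * lb).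

Lemma scC_ge0 : 0 <= scC.
Proof.
rewrite /scC; apply: mulr_ge0; last by have := lb0; lra.
by rewrite divr_ge0 ?rhoC_ge0.
Qed.

Lemma scpot_nonincreasing q q' : beta * lb <= q -> q <= q' -> scpot q' <= scpot q.
Proof.
move=> qlb qq; rewrite /scpot !mulNr lerN2 ler_wpM2l //.
apply: le_Rintegral => //; try exact: integrable_rho_ln.
  by apply: integrable_rho_ln; lra.
move=> x /=; rewrite in_itv /= => /andP[x1]; rewrite le_eqVlt => /orP[/eqP ->|x2].
  by rewrite rho_lb !mul0r.
by rewrite ler_wpM2l ?rho_ge0 // ler_ln ?posrE ?potarg_gt0 //; lra.
Qed.

(** With [ln (1 + t) <= 2 sqrt t] the increment of the logarithm is at most
    [2 sqrt (q' - q) / sqrt (q - beta x)], and [rho] absorbs the denominator. The bound includes the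
    edge; it yields continuity there as well as growth control at infinity. *)
Lemma scpot_hoelder q q' : beta * lb <= q -> q <= q' ->
  scpot q - scpot q' <= scC * Num.sqrt (q' - q).
Proof.
move=> qlb qq; have qlb' : beta * lb <= q' by lra.
rewrite /scpot -mulrBr -RintegralB //; try exact: integrable_rho_ln.
rewrite mulNr -mulrN.
have h0 : 0 <= q' - q by lra.
set I := (X in 1 / 2 * - X).
suff : - (2 * (rhoC / Num.sqrt beta * Num.sqrt (q' - q)) * (2 * lb)) <= I.
  by rewrite /scC; lra.
rewrite -mulNr -integral_cst_sc; apply: le_Rintegral => //.
- exact: integrable_cst_sc.
- have := integrableB _ (integrable_rho_ln qlb) (integrable_rho_ln qlb').
  by apply.
move=> x /=; rewrite in_itv /= => /andP[x1]; rewrite le_eqVlt => /orP[/eqP ->|x2].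
  rewrite rho_lb !mul0r subrr oppr_le0 mulr_ge0 // mulr_ge0 ?sqrtr_ge0 //.
  by rewrite divr_ge0 ?rhoC_ge0.
have y0 : 0 < q - beta * x by exact: potarg_gt0.
have y'0 : 0 < q' - beta * x by exact: potarg_gt0.
rewrite -mulrBr lerNl -mulrN opprB.
have lnd : ln (q' - beta * x) - ln (q - beta * x) <= 2 * (Num.sqrt (q' - q)
  / Num.sqrt (q - beta * x)).
  rewrite -ln_div ?posrE //.
  have -> : (q' - beta * x) / (q - beta * x) = 1 + (q' - q) / (q - beta * x).
    by field; rewrite gt_eqF.
  set t := (q' - q) / (q - beta * x).
  have t0 : 0 <= t by rewrite divr_ge0 // ltW.
  have -> : Num.sqrt (q' - q) / Num.sqrt (q - beta * x) = Num.sqrt t.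
    by rewrite /t sqrtrM // sqrtrV // ltW.
  have st0 : 0 <= Num.sqrt t by exact: sqrtr_ge0.
  apply: (@le_trans _ _ (ln ((1 + Num.sqrt t) ^+ 2))).
    rewrite ler_ln ?posrE; last by rewrite exprn_gt0 //; lra.
      by rewrite sqrrD sqr_sqrtr // expr1n; lra.
    by lra.
  rewrite lnXn; last by lra.
  have s1 : 0 < 1 + Num.sqrt t by lra.
  by have := ln_le_tangent ltr01 s1; rewrite ln1 divr1 mulr2n; lra.
apply: le_trans (ler_wpM2l (rho_ge0 x) lnd) _.
have := ler_wpM2r (sqrtr_ge0 (q' - q)) (rho_div_sqrt qlb x1 x2).
set sy := Num.sqrt (q - beta * x); set sh := Num.sqrt (q' - q).
move=> le1; have -> : rho lb x * (2 * (sh / sy)) = 2 * (rho lb x / sy * sh) by ring.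
by rewrite ler_wpM2l.
Qed.

Lemma scpot_convex t q q' : 0 < t -> t < 1 -> beta * lb <= q -> beta * lb <= q' ->
  scpot (t * q + (1 - t) * q') <= t * scpot q + (1 - t) * scpot q'.
Proof.
move=> t0 t1 qlb qlb'; have mlb : beta * lb <= t * q + (1 - t) * q' by nra.
rewrite [leRHS](_ : _ = - (1 / 2) * (t * (\int[leb]_(x in D) (rho lb x * ln (q - beta * x)))%R
  + (1 - t) * (\int[leb]_(x in D) (rho lb x * ln (q' - beta * x)))%R)); last first.
  by rewrite /scpot; ring.
rewrite /scpot !mulNr lerN2 ler_wpM2l //.
rewrite -!RintegralZl //; try exact: integrable_rho_ln.
have iZ k p : beta * lb <= p -> leb.-integrable D (EFin \o (fun x =>
  k * (rho lb x * ln (p - beta * x)))).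
  by move=> plb; have := integrableZl _ k (integrable_rho_ln plb); apply.
rewrite -RintegralD //; try exact: iZ.
apply: le_Rintegral => //.
- by have := integrableD _ (iZ t q qlb) (iZ (1 - t) q' qlb'); apply.
- exact: integrable_rho_ln.
move=> x /=; rewrite in_itv /= => /andP[x1]; rewrite le_eqVlt => /orP[/eqP ->|x2].
  by rewrite rho_lb !mul0r !mulr0 addr0.
have y0 : 0 < q - beta * x by exact: potarg_gt0.
have y'0 : 0 < q' - beta * x by exact: potarg_gt0.
have m0 : 0 < t * q + (1 - t) * q' - beta * x by nra.
have -> : t * (rho lb x * ln (q - beta * x)) + (1 - t) * (rho lb x * ln (q' - beta * x)) =
  rho lb x * (t * ln (q - beta * x) + (1 - t) * ln (q' - beta * x)) by ring.
rewrite ler_wpM2l ?rho_ge0 //.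
have t1' : 0 < 1 - t by lra.
have := ler_wpM2l (ltW t0) (ln_le_tangent m0 y0).
have := ler_wpM2l (ltW t1') (ln_le_tangent m0 y'0).
set m := t * q + (1 - t) * q' - beta * x in m0 *.
have E : t * ((q - beta * x - m) / m) + (1 - t) * ((q' - beta * x - m) / m) = 0.
  by rewrite /m; field; rewrite gt_eqF.
lra.
Qed.

Section mass.
Hypothesis rho1 : (\int[leb]_(x in D) rho lb x)%R = 1.

(** The ratio [(q + h - beta x) / (q - beta x)] is smallest at [x = - lb], where its logarithm is
    [kk > 0]. Integrating against a density of mass 1 gives a strict decrease, which later forces
    the optimal squared radius to be positive. *)
Lemma scpot_decreasing q h : beta * lb <= q -> 0 < h -> scpot (q + h) < scpot q.
Proof.
move=> qlb h0; have blb : 0 < beta * lb by rewrite mulr_gt0.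
pose kk := ln ((q + h + beta * lb) / (q + beta * lb)).
have qb0 : 0 < q + beta * lb by lra.
have kk0 : 0 < kk by rewrite ln_gt0 // ltr_pdivlMr // mul1r; lra.
suff : scpot (q + h) <= scpot q - 1 / 2 * kk by lra.
have qhlb : beta * lb <= q + h by lra.
rewrite /scpot; set I := Rintegral _ _ _; set I' := Rintegral _ _ _.
suff : kk <= I - I' by lra.
rewrite /I /I' -RintegralB //; try exact: integrable_rho_ln.
rewrite -[kk]mulr1 -rho1 -RintegralZl //; last exact: integrable_rho.
apply: le_Rintegral => //.
- by have := integrableZl _ kk integrable_rho; apply.
- by have := integrableB _ (integrable_rho_ln qhlb) (integrable_rho_ln qlb); apply.
move=> x /=; rewrite in_itv /= => /andP[x1]; rewrite le_eqVlt => /orP[/eqP ->|x2].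
  by rewrite rho_lb !mul0r mulr0 subrr.
have y0 : 0 < q - beta * x by exact: potarg_gt0.
have y'0 : 0 < q + h - beta * x by exact: potarg_gt0.
rewrite -mulrBr mulrC ler_wpM2l ?rho_ge0 // -ln_div ?posrE //.
rewrite ler_ln ?posrE ?divr_gt0 //; last by lra.
rewrite ler_pdivrMr // mulrAC ler_pdivlMr //.
have : beta * (- x) <= beta * lb by rewrite ler_pM2l //; lra.
nra.
Qed.

End mass.

(** The density is decreasing on [[a, b]], an interval of positive length inside the region where
    every such [f] equals 1, so its value at [b] times the length is a bound independent of [f]. *)
Lemma rho_mass_edge ep : 0 < ep -> ep <= lb -> exists2 c, 0 < c &
  forall f : R -> R, measurable_fun setT f ->
    (forall x, 0 <= f x <= 1) -> (forall x, lb - ep / 2 <= x -> f x = 1) ->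
    c <= (\int[leb]_(x in D) (f x * rho lb x))%R.
Proof.
move=> ep0 eplb; pose a := lb - ep / 2; pose b := lb - ep / 4.
have ab : a < b by rewrite /a /b; lra.
have rb0 : 0 < rho lb b.
  rewrite /rho divr_gt0 //; last by rewrite mulr_gt0 ?pi_gt0 ?exprn_gt0.
  by rewrite mulr_gt0 // sqrtr_gt0 /b; nra.
exists (rho lb b * (b - a)) => [|f mf f01 f1]; first by rewrite mulr_gt0 // subr_gt0.
have -> : rho lb b * (b - a) = (\int[leb]_(x in D) (rho lb b * \1_(`[a, b]%classic) x))%R.
  rewrite RintegralZl //; last first.
    apply: (@bounded_integrable_sc _ 1) => [|x _ _]; first exact: measurable_indic.
    by rewrite indicE ger0_norm //; case: (_ \in _).
  congr (_ * _); rewrite /Rintegral integral_indic //= setIidl.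
    by rewrite lebesgue_measure_itv /= lte_fin ab -EFinB.
  move=> x /=; rewrite !in_itv /= /a /b => /andP[? ?]; apply/andP.
  by have := lb0; split; lra.
have mr : measurable_fun setT (fun x => f x * rho lb x).
  by apply: measurable_funM => //; exact: measurable_rho.
apply: le_Rintegral => //.
- apply: (@bounded_integrable_sc _ (rho lb b)) => [|x _ _].
    by apply: measurable_funM => //; exact: measurable_indic.
  rewrite normrM (gtr0_norm rb0) ler_piMr ?(ltW rb0) //.
  by rewrite indicE ger0_norm //; case: (_ \in _).
- apply: (@bounded_integrable_sc _ (rhoC * Num.sqrt (2 * lb))) => // x x1 x2.
  rewrite normrM; have /andP[fx0 fx1] := f01 x; rewrite (ger0_norm fx0).
  by apply: le_trans (rho_bound x1 x2); rewrite ler_piMl.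
move=> x _; rewrite indicE; case: (boolP (_ \in _)) => [|_]; last first.
  by rewrite mulr0 mulr_ge0 ?rho_ge0 //; case/andP: (f01 x).
rewrite inE /= in_itv /= => /andP[xa xb]; rewrite mulr1 f1 // mul1r /rho.
apply: ler_wpM2r; first by rewrite invr_ge0 mulr_ge0 ?pi_ge0 ?sqr_ge0.
rewrite ler_wpM2l // ler_wsqrtr //.
by move: xa xb; rewrite /a /b; nra.
Qed.

End semicircle.

(** * The variational formulas *)

Lemma inf_eq_min (R : realType) (S : set R) x : S x -> (forall y, S y -> x <= y) -> inf S = x.
Proof.
move=> Sx xS; apply/le_anti/andP; split.
  by apply: ge_inf => //; exists x.
by apply: lb_le_inf => //; exists x.
Qed.

Lemma sup_eq_max (R : realType) (S : set R) x : S x -> (forall y, S y -> y <= x) -> sup S = x.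
Proof.
move=> Sx xS; apply/le_anti/andP; split.
  by apply: ge_sup => //; exists x.
by apply: ub_le_sup => //; exists x.
Qed.

Section variational.
Context (R : realType) (lb beta : R).
Hypotheses (lb0 : 0 < lb) (beta0 : 0 < beta).
Hypothesis rho1 :
  (\int[@lebesgue_measure R]_(x in (`[(- lb)%R, lb]%classic : set R)) rho lb x)%R = 1.
Notation a := (beta * lb).
Notation Lam := (scpot lb beta).

(** Freezing the argument at the edge gives continuity on the whole line; below [beta lb] the
    integrand of [scpot] would involve default values of [ln]. *)
Lemma scpot_max_continuous : continuous (fun q => Lam (Num.max q a)).
Proof.
move=> q; apply/cvgrPdist_le => e e0.
have C0 : 0 < scC lb beta + 1 by rewrite ltr_wpDl ?scC_ge0.
pose dl := (e / (scC lb beta + 1)) ^+ 2.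
have dl0 : 0 < dl by rewrite exprn_gt0 // divr_gt0.
have half x y : y <= x -> x - y <= dl -> `|Lam (Num.max y a) - Lam (Num.max x a)| <= e.
  move=> yx xy; have ya : a <= Num.max y a by rewrite le_max lexx orbT.
  have mxy : Num.max y a <= Num.max x a by rewrite ge_max !le_max yx lexx orbT.
  rewrite ger0_norm ?subr_ge0; last exact: scpot_nonincreasing.
  apply: le_trans (scpot_hoelder lb0 beta0 ya mxy) _.
  apply: (@le_trans _ _ ((scC lb beta + 1) * (e / (scC lb beta + 1)))); last first.
    by rewrite mulrCA divff ?gt_eqF // mulr1.
  apply: ler_pM; rewrite ?scC_ge0 ?sqrtr_ge0 ?lerDl //.
  rewrite -[leRHS]ger0_norm; last by rewrite divr_ge0 ?ltW.
  rewrite -sqrtr_sqr ler_wsqrtr //; apply: le_trans xy.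
  by rewrite !maxEle; case: ifP; case: ifP => ? ?; lra.
near=> x.
have : `|q - x| <= dl by near: x; apply/nbhs_ballP; exists dl => // y; rewrite /ball /= => /ltW.
case: (leP x q) => [xq|/ltW qx]; first by rewrite ger0_norm ?subr_ge0 // distrC; exact: half.
by rewrite ler0_norm ?subr_le0 // opprB; exact: half.
Unshelve. all: by end_near. Qed.

(** Beyond [K] the value at the edge already does better, so the extreme value theorem on a compact
    interval suffices. *)
Lemma scpot_min (h : R -> R) K : continuous h ->
  (forall q, K <= q -> a <= q -> h a + Lam a <= h q + Lam q) ->
  exists2 q0, a <= q0 & forall q, a <= q -> h q0 + Lam q0 <= h q + Lam q.
Proof.
move=> hc hK; pose b := Num.max a K.
have ab : a <= b by rewrite le_max lexx.
pose f q := h q + Lam (Num.max q a).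
have fc : {within `[a, b], continuous f}.
  apply: continuous_subspaceT => q; apply: cvgD; first exact: hc.
  exact: scpot_max_continuous.
have fE q : a <= q -> f q = h q + Lam q by move=> aq; rewrite /f (max_idPl aq).
have [q0 + q0min] := EVT_min ab fc.
rewrite in_itv /= => /andP[aq0 q0b]; exists q0 => // q aq.
rewrite -!fE //; have [qb|/ltW bq] := leP q b.
  by apply: q0min; rewrite in_itv /= aq.
apply: (@le_trans _ _ (f a)); first by apply: q0min; rewrite in_itv /= lexx.
by rewrite !fE //; apply: hK => //; apply: le_trans bq; rewrite le_max lexx orbT.
Qed.

Lemma FsfE s q : Fsf lb beta s q = q * s + Lam q - 1 / 2 * ln s - 1 / 2 - 1 / 2 * ln 2.
Proof. by rewrite /Fsf /scpot /Rintegral; ring. Qed.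

Lemma spherical_min s : 0 < s ->
  exists2 q0, a <= q0 & forall q, a <= q -> q0 * s + Lam q0 <= q * s + Lam q.
Proof.
(* With [w = sqrt (q - a)], this is where the linear gain [s w^2] overtakes the Hoelder loss
   [scC w]. *)
move=> s0; apply: (@scpot_min (fun q => q * s) (a + (scC lb beta / s) ^+ 2)).
  by move=> q; apply: cvgM; [exact: cvg_id|exact: cvg_cst].
move=> q qK aq; have := scpot_hoelder lb0 beta0 (lexx a) aq.
set w := Num.sqrt (q - a) => h; have w0 : 0 <= w by exact: sqrtr_ge0.
have wE : q - a = w ^+ 2 by rewrite sqr_sqrtr // subr_ge0.
have Cw : scC lb beta / s <= w.
  rewrite -[leLHS]ger0_norm; last by rewrite divr_ge0 ?scC_ge0 ?ltW.
  by rewrite -sqrtr_sqr ler_wsqrtr //; lra.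
rewrite ler_pdivrMr // in Cw.
have : scC lb beta * w <= s * (q - a).
  by rewrite wE expr2 mulrA ler_wpM2r // mulrC.
lra.
Qed.

Lemma AsfE s q0 : a <= q0 -> (forall q, a <= q -> q0 * s + Lam q0 <= q * s + Lam q) ->
  Asf lb beta s = Fsf lb beta s q0.
Proof.
move=> aq0 q0min; apply: inf_eq_min; first by exists q0.
by move=> _ [q /= aq <-]; rewrite !FsfE; have := q0min q aq; lra.
Qed.

Lemma dualquad_continuous lam : continuous (dualquad beta lam).
Proof.
move=> q; apply: cvgM; last exact: cvg_cst.
apply: (@cvg_comp _ _ _ (fun q => 2 * q + lam - 1) (fun x : R => x ^+ 2));
  last exact: exprn_continuous.
apply: cvgB; last exact: cvg_cst.
apply: cvgD; last exact: cvg_cst.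
by apply: cvgM; [exact: cvg_cst|exact: cvg_id].
Qed.

Lemma gaussian_min lam :
  exists2 q1, a <= q1 & forall q, a <= q -> dualquad beta lam q1 + Lam q1 <= dualquad beta lam q
    + Lam q.
Proof.
have C0 : 0 <= scC lb beta by exact: scC_ge0.
(* The final 1 makes [q - a >= 1], so that [sqrt (q - a) <= q - a]; the rest lets the quadratic
   growth of [dualquad] beat the Hoelder loss and its own linear term. *)
pose B := beta ^+ 2 * (scC lb beta + `|(2 * a + lam - 1) / beta ^+ 2|) + 1.
have b20 : 0 < beta ^+ 2 by rewrite exprn_gt0.
apply: (@scpot_min _ (a + B)); first exact: dualquad_continuous.
move=> q qB aq; have := scpot_hoelder lb0 beta0 (lexx a) aq.
set w := Num.sqrt (q - a) => h; have w0 : 0 <= w by exact: sqrtr_ge0.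
set g := (2 * a + lam - 1) / beta ^+ 2 in B qB *.
have E : dualquad beta lam q = dualquad beta lam a + g * (q - a) + (q - a) ^+ 2 / beta ^+ 2.
  by rewrite /dualquad /g; field; rewrite gt_eqF.
have X1 : 1 <= q - a.
  have : 0 <= beta ^+ 2 * (scC lb beta + `|g|) by rewrite mulr_ge0 ?(ltW b20) // addr_ge0.
  by move: qB; rewrite /B; lra.
have wX : w <= q - a.
  rewrite -[leRHS]sqr_sqrtr -/w; last by lra.
  have : 1 <= w by rewrite -sqrtr1 ler_wsqrtr.
  by move=> ?; nra.
have : scC lb beta * w <= scC lb beta * (q - a) by rewrite ler_wpM2l.
have : - `|g| * (q - a) <= g * (q - a).
  by rewrite ler_wpM2r; [by []|lra|rewrite lerNl -normrN ler_norm].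
have : (scC lb beta + `|g|) * (q - a) <= (q - a) ^+ 2 / beta ^+ 2.
  rewrite ler_pdivlMr // mulrAC expr2 ler_wpM2r //; first by lra.
  by move: qB; rewrite /B; lra.
rewrite E; lra.
Qed.

(** First-order optimality, valid also when [q1] is the edge. [s1] is the derivative of [dualquad]
    at [q1]: a move by a fraction [t] towards [q] changes [dualquad] by [t (q - q1) s1] plus a term
    of order [t^2], while convexity bounds the change of the potential by [t] times its increment;
    dividing by [t] leaves the linearized inequality. Were [s1 <= 0], the strict decrease of the
    potential would contradict it at [q1 + 1]. *)
Lemma gaussian_min_dual lam q1 : a <= q1 ->
  (forall q, a <= q -> dualquad beta lam q1 + Lam q1 <= dualquad beta lam q + Lam q) ->
  let s1 := (2 * q1 + lam - 1) / beta ^+ 2 in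
  0 < s1 /\ forall q, a <= q -> q1 * s1 + Lam q1 <= q * s1 + Lam q.
Proof.
move=> aq1 q1min s1; have b20 : 0 < beta ^+ 2 by rewrite exprn_gt0.
have lin q : a <= q -> q1 * s1 + Lam q1 <= q * s1 + Lam q.
  move=> aq; apply/ler_addgt0Pr => e e0.
  pose k := (q - q1) ^+ 2 / beta ^+ 2.
  have k0 : 0 <= k by rewrite divr_ge0 ?sqr_ge0.
  pose t := Num.min (1 / 2) (e / (k + 1)).
  have k1 : 0 < k + 1 by lra.
  have t0 : 0 < t by rewrite lt_min !divr_gt0.
  have t1 : t < 1.
    have : t <= 1 / 2 by rewrite ge_min lexx.
    lra.
  have tk : t * k <= e.
    have : t <= e / (k + 1) by rewrite ge_min lexx orbT.
    rewrite ler_pdivlMr //; lra.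
  have := scpot_convex lb0 beta0 t0 t1 aq aq1.
  have am : a <= t * q + (1 - t) * q1.
    have : t * a <= t * q by rewrite ler_pM2l.
    have : (1 - t) * a <= (1 - t) * q1 by rewrite ler_pM2l //; lra.
    lra.
  have := q1min _ am.
  have -> : dualquad beta lam (t * q + (1 - t) * q1) =
    dualquad beta lam q1 + t * ((q - q1) * s1) + t * (t * k).
    by rewrite /dualquad /s1 /k; field; rewrite gt_eqF.
  move=> h1 h2; rewrite -(ler_pM2l t0).
  have : t * (t * k) <= t * e by rewrite ler_pM2l.
  lra.
split=> //; rewrite ltNge; apply/negP => s1le.
have aq1' : a <= q1 + 1 by lra.
have := lin _ aq1'; have := scpot_decreasing lb0 beta0 rho1 aq1 ltr01.
lra.
Qed.

Lemma dual_point lam q1 : let s1 := (2 * q1 + lam - 1) / beta ^+ 2 in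
  q1 * s1 - beta ^+ 2 * s1 ^+ 2 / 4 + (lam - 1) * s1 / 2 = dualquad beta lam q1.
Proof. by rewrite /dualquad /=; field; rewrite gt_eqF. Qed.

Lemma dual_le lam q1 s :
  q1 * s - beta ^+ 2 * s ^+ 2 / 4 + (lam - 1) * s / 2 <= dualquad beta lam q1.
Proof.
rewrite -subr_ge0 (_ : _ - _ = (beta * s / 2 - (2 * q1 + lam - 1) / (2 * beta)) ^+ 2).
  exact: sqr_ge0.
by rewrite /dualquad; field; rewrite gt_eqF.
Qed.

(** Minimax by a saddle point: [dual_le] bounds [Gg] at every radius by the dual value at [q1], with
    equality at [s1], where [q1] also solves the inner minimization. The terms [1/2 ln s + 1/2] of
    [Gg] cancel those of [Fsf]. *)
Lemma AgE lam q1 : a <= q1 ->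
  (forall q, a <= q -> dualquad beta lam q1 + Lam q1 <= dualquad beta lam q + Lam q) ->
  let s1 := (2 * q1 + lam - 1) / beta ^+ 2 in
  Gg lb beta lam s1 = Ag lb beta lam /\
  Ag lb beta lam = dualquad beta lam q1 + Lam q1 - 1 / 2 * ln 2.
Proof.
move=> aq1 q1min s1; have [s10 q1s1] := gaussian_min_dual aq1 q1min.
have G1 : Gg lb beta lam s1 = dualquad beta lam q1 + Lam q1 - 1 / 2 * ln 2.
  rewrite /Gg (AsfE aq1 q1s1) FsfE -(dual_point lam q1) -/s1.
  by ring.
suff : Ag lb beta lam = Gg lb beta lam s1 by move=> ->.
apply: sup_eq_max; first by exists s1.
move=> _ [s /= s0 <-]; rewrite G1.
have [q0 aq0 q0min] := spherical_min s0.
rewrite /Gg (AsfE aq0 q0min) FsfE.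
have := q0min _ aq1; have := dual_le lam q1 s; lra.
Qed.

(** Steps off the edge, where the limit of [logpot] is not at hand. As the potential is
    nonincreasing, only the linear term has to be paid for. *)
Lemma scpot_right_approx s q0 e : 0 < s -> a <= q0 -> 0 < e ->
  exists2 q, a < q & q * s + Lam q <= q0 * s + Lam q0 + e.
Proof.
move=> s0 aq0 e0; have es : 0 < e / s by rewrite divr_gt0.
exists (q0 + e / s); first by lra.
have : Lam (q0 + e / s) <= Lam q0 by apply: scpot_nonincreasing => //; lra.
have -> : (q0 + e / s) * s = q0 * s + e by field; rewrite gt_eqF.
lra.
Qed.

Lemma dualquad_right_approx lam q1 e : a <= q1 -> 0 < e ->
  exists2 q, a < q & dualquad beta lam q + Lam q <= dualquad beta lam q1 + Lam q1 + e.
Proof.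
move=> aq1 e0; set s1 := (2 * q1 + lam - 1) / beta ^+ 2.
have b20 : 0 < beta ^+ 2 by rewrite exprn_gt0.
pose k := `|s1| + 1 / beta ^+ 2.
have ib : 0 < 1 / beta ^+ 2 by rewrite divr_gt0.
have k0 : 0 < k by rewrite ltr_wpDl.
pose h := Num.min 1 (e / k).
have h0 : 0 < h by rewrite lt_min ltr01 divr_gt0.
have h1 : h <= 1 by rewrite ge_min lexx.
have hk : h * k <= e by rewrite -ler_pdivlMr // ge_min lexx orbT.
exists (q1 + h); first by lra.
have : Lam (q1 + h) <= Lam q1 by apply: scpot_nonincreasing => //; lra.
have -> : dualquad beta lam (q1 + h) = dualquad beta lam q1 + h * s1 + h * (h * (1 / beta ^+ 2)).
  by rewrite /dualquad /s1; field; rewrite gt_eqF.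
have : h * s1 <= h * `|s1| by rewrite ler_pM2l // ler_norm.
have : h * (h * (1 / beta ^+ 2)) <= h * (1 / beta ^+ 2).
  by rewrite ler_pM2l // ler_piMl // ltW.
move: hk; rewrite /k; lra.
Qed.

End variational.

(** * Measurability *)

Lemma geometric_eseries_le (R : realType) (c z : R) : 0 <= c -> 0 <= z -> z < 1 ->
  (\sum_(0 <= k <oo) (c * z ^+ k)%:E <= (c / (1 - z))%:E)%E.
Proof.
move=> c0 z0 z1; apply: lime_le.
  by apply: is_cvg_nneseries => k _ _; rewrite lee_fin mulr_ge0 ?exprn_ge0.
apply: nearW => n; rewrite sumEFin lee_fin -mulr_sumr ler_wpM2l //.
have zz : 0 < 1 - z by lra.
rewrite -[leRHS]mul1r ler_pdivlMr // big_mkord.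
suff -> : (\sum_(i < n) z ^+ i) * (1 - z) = 1 - z ^+ n.
  by rewrite gerBl exprn_ge0.
by rewrite -[RHS]opprB subrX1 -mulNr opprB mulrC.
Qed.

Fixpoint mxpow (R : realType) N (A : 'M[R]_N) (k : nat) : 'M[R]_N :=
  if k is k'.+1 then A *m mxpow A k' else 1%:M.

Lemma measurable_mxpow (R : realType) N d (T : measurableType d) (A : T -> 'M[R]_N) k :
  (forall i j, measurable_fun setT (fun t => A t i j)) ->
  forall i j, measurable_fun setT (fun t => mxpow (A t) k i j).
Proof.
move=> mA; elim: k => [|k IH] i j /=; first exact: measurable_cst.
under eq_fun do rewrite mxE.
by apply: measurable_sum => m; apply: measurable_funM.
Qed.

Lemma mxpow_orthodiag (R : realType) N (U : 'M[R]_N) l k : orthomx U ->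
  mxpow (orthodiag U l) k = orthodiag U (fun i => l i ^+ k).
Proof.
move=> UU; elim: k => [|k IH] /=.
  rewrite /orthodiag (_ : diag_mx _ = 1%:M) ?mulmx1 ?orthomx_tr //.
  by apply/matrixP => i j; rewrite !mxE expr0.
rewrite IH /orthodiag !mulmxA -(mulmxA _ U) UU mulmx1; congr (_ *m _).
rewrite -!mulmxA; congr (_ *m _); rewrite mulmx_diag; congr diag_mx.
by apply/rowP => i; rewrite !mxE exprS.
Qed.

Lemma mxtrace_orthodiag (R : realType) N (U : 'M[R]_N) l : orthomx U ->
  \tr (orthodiag U l) = \sum_i l i.
Proof.
move=> UU; rewrite /orthodiag mxtrace_mulC mulmxA UU mul1mx mxtrace_diag.
by apply: eq_bigr => i _; rewrite mxE.
Qed.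

(* Makes the event [max |l_i| >= a] measurable. *)
Lemma spectral_radius_ge (R : realType) N (U : 'M[R]_N) l a : orthomx U -> 0 < a ->
  (exists2 x, root (char_poly (orthodiag U l)) x & a <= `|x|) <->
  (forall k, a ^+ (2 * k) <= \tr (mxpow (orthodiag U l) (2 * k))).
Proof.
move=> UU a0; have trE k : \tr (mxpow (orthodiag U l) (2 * k)) = \sum_i l i ^+ (2 * k).
  by rewrite mxpow_orthodiag // mxtrace_orthodiag.
have ev (x : R) k : x ^+ (2 * k) = `|x| ^+ (2 * k).
  by rewrite !exprM -normrX ger0_norm ?sqr_ge0.
split.
  case=> x /(root_orthodiag UU)[i <-] ai k; rewrite trE (bigD1 i) //= ev.
  apply: ler_wpDr; first by apply: sumr_ge0 => j _; rewrite ev exprn_ge0.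
  by rewrite lerXn2r ?nnegrE ?(ltW a0).
move=> trk; apply: contrapT => nx.
have lt_a i : `|l i| < a.
  rewrite ltNge; apply/negP => ai; apply: nx; exists (l i) => //.
  by apply/root_orthodiag => //; exists i.
pose c := \big[Num.max/0]_i `|l i|.
have c0 : 0 <= c by exact: bigmax_ge_id.
have ca : c < a by apply/bigmax_ltP; split=> // i _.
have lc i : `|l i| <= c by exact: le_bigmax.
pose z := (c / a) ^+ 2.
have z0 : 0 <= c / a by rewrite divr_ge0 // ltW.
have z1 : `|z| < 1.
  rewrite ger0_norm ?sqr_ge0 // expr_lt1 // ltr_pdivrMr // mul1r //.
(* If all [|l_i| <= c < a], the trace is at most [N c^(2k)], which falls below [a^(2k)] once
   [(c / a)^(2k) < 1 / (N + 1)]; [N + 1] also covers [N = 0]. *)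
have N1 : 0 < (N%:R + 1)^-1 :> R by rewrite invr_gt0 ltr_wpDl.
have /cvgrPdist_lt/(_ _ N1)[k _ /(_ k (leqnn k))] := cvg_expr z1.
rewrite /= sub0r normrN ger0_norm ?exprn_ge0 ?sqr_ge0 // => zk.
have := trk k; rewrite trE leNgt => /negP; apply.
apply: (@le_lt_trans _ _ (\sum_(i < N) c ^+ (2 * k))).
  by apply: ler_sum => i _; rewrite ev lerXn2r ?nnegrE.
rewrite sumr_const card_ord -mulr_natr.
have ak : 0 < a ^+ (2 * k) by rewrite exprn_gt0.
have -> : c ^+ (2 * k) = z ^+ k * a ^+ (2 * k).
  by rewrite /z -exprM expr_div_n divfK // gt_eqF.
rewrite mulrAC -[ltRHS]mul1r ltr_pM2r //.
have N1' : 0 < N%:R + 1 :> R by rewrite ltr_wpDl.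
apply: (@le_lt_trans _ _ (z ^+ k * (N%:R + 1))).
  by rewrite ler_wpM2l ?exprn_ge0 ?sqr_ge0 // lerDl.
by rewrite -ltr_pdivlMr // div1r.
Qed.

Lemma tr_scaledJ (R : realType) N (A : 'M[R]_N) : (forall i j, A i j = A j i) ->
  (scaledJ A)^T = scaledJ A.
Proof. by move=> Asym; apply/matrixP => i j; rewrite !mxE Asym. Qed.

Lemma measurable_scaledJ (R : realType) N d (T : measurableType d) (A : T -> 'M[R]_N) :
  (forall i j, measurable_fun setT (fun t => A t i j)) ->
  forall i j, measurable_fun setT (fun t => scaledJ (A t) i j).
Proof.
move=> mA i j; under eq_fun do rewrite mxE.
exact: measurable_funM.
Qed.

Lemma measurable_spectral_radius (R : realType) N d (T : measurableType d)
    (A : T -> 'M[R]_N) a :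
  (forall i j, measurable_fun setT (fun t => A t i j)) ->
  (forall t, (A t)^T = A t) -> 0 < a ->
  measurable [set t | exists x : R, root (char_poly (A t)) x /\ (a <= `|x|)%R].
Proof.
move=> mA Asym a0.
rewrite (_ : [set t | _] = \bigcap_k [set t | a ^+ (2 * k) <= \tr (mxpow (A t) (2 * k))]).
  apply: bigcapT_measurable => k.
  rewrite -[X in measurable X]setTI.
  apply: (measurable_fun_ler (measurable_cst _) _ measurableT (Y := [set true])) => //.
  by apply: measurable_sum => i; exact: measurable_mxpow.
apply/seteqP; split=> t; have [U [l [UU AE]]] := symmetric_orthodiag (Asym t).
  move=> [x [xr ax]] k _; rewrite AE in xr.
  have xx : exists2 x, root (char_poly (orthodiag U l)) x & a <= `|x| by exists x.
  by rewrite /= AE; exact: ((spectral_radius_ge l UU a0).1 xx k).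
move=> tk; have tk' k : a ^+ (2 * k) <= \tr (mxpow (orthodiag U l) (2 * k)).
  by have := tk k I; rewrite /= AE.
by have [x xr ax] := (spectral_radius_ge l UU a0).2 tk'; exists x; rewrite AE.
Qed.

Lemma measurable_Zsf (R : realType) N d (T : measurableType d) (J : T -> 'M[R]_N) beta r :
  (forall i j, measurable_fun setT (fun t => J t i j)) ->
  measurable_fun setT (fun t => Zsf (J t) beta r).
Proof.
move=> mJ; rewrite /Zsf /sphere_int; apply: (@measurableT_comp _ _ _ _ _ _ fine) => //.
apply: emeasurable_funM => //; apply: iint_jmeas => [d' S tau c mtau mc|t v]; last first.
  by rewrite lee_fin; case: ifP => // _; exact: expR_ge0.
apply/measurable_EFinP; apply: measurable_fun_ifT => //.
  by apply: measurable_fun_ler => //; exact: vmeasr_sqnorm.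
apply: measurableT_comp => //.
have mk : measurable_fun setT (fun x => r * Num.sqrt N%:R * (sqnorm (\row_i c i x)) `^ (- (2^-1))).
  apply: measurable_funM => //; apply: (measurableT_comp (measurable_powR _)).
  exact: vmeasr_sqnorm.
rewrite [X in measurable_fun _ X](_ : _ = fun x => beta * ((r * Num.sqrt N%:R * (sqnorm (\row_i c
  i x)) `^ (- (2^-1))) ^+ 2 * quad (scaledJ (J (tau x))) (\row_i c i x))).
  apply: measurable_funM => //; apply: measurable_funM; first exact: measurable_funX.
  apply: measurable_quad => // i j; apply: measurable_scaledJ => i' j'.
  exact: (measurableT_comp (mJ i' j')).
apply/funext => x; rewrite hamiltonianE mulrNN quadZ powRN powR12_sqrt ?sqnorm_ge0 //.
Qed.

Lemma measurable_Zg (R : realType) N d (T : measurableType d) (J : T -> 'M[R]_N) beta lam :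
  (forall i j, measurable_fun setT (fun t => J t i j)) ->
  measurable_fun setT (fun t => Zg (J t) beta lam).
Proof.
move=> mJ; rewrite /Zg; apply: (@measurableT_comp _ _ _ _ _ _ fine) => //.
apply: iint_jmeas => [d' S tau c mtau mc|t v]; last first.
  by rewrite lee_fin !mulr_ge0 ?expR_ge0 ?powR_ge0.
have msq := vmeasr_sqnorm mc.
apply/measurable_EFinP; apply: measurable_funM.
  apply: measurable_funM => //; apply: measurableT_comp => //.
  by apply: measurable_funM => //; apply: measurableT_comp.
apply: measurableT_comp => //; apply: measurable_funD; last exact: measurable_funM.
apply: measurable_funB; last by apply: measurable_funM => //; exact: measurable_funX.
apply: measurable_funM => //; under eq_fun do rewrite hamiltonianE.
apply: measurableT_comp => //; apply: measurable_quad => // i j.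
apply: measurable_scaledJ => i' j'; exact: (measurableT_comp (mJ i' j')).
Qed.

(** * Convergence of expectations *)

Section probability.
Context d (Omega : measurableType d) (R : realType) (P : probability Omega R).

(** Borel-Cantelli with a geometric bound. *)
Lemma ae_eventually_not (B : nat -> set Omega) (c z : R) :
  (forall N, measurable (B N)) -> 0 <= c -> 0 <= z -> z < 1 ->
  (forall N, (P (B N) <= (c * z ^+ N)%:E)%E) ->
  {ae P, forall w, \forall N \near \oo, ~ B N w}.
Proof.
move=> mB c0 z0 z1 PB.
have lim0 : P (lim_sup_set B) = 0%E.
  apply: lim_sup_set_cvg0 => //; apply: (@le_lt_trans _ _ (c / (1 - z))%:E); last exact: ltry.
  apply: le_trans (geometric_eseries_le c0 z0 z1).
  by apply: lee_nneseries => [N _ _|N _]; [exact: measure_ge0|exact: PB].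
exists (lim_sup_set B); split=> //.
  by apply: bigcapT_measurable => k; apply: bigcup_measurable.
move=> w nw; apply: contrapT => nB; apply: nw.
have [n nBn] : exists n, ~ (\bigcup_(j >= n) B j) w.
  by apply/existsNP => Bn; apply: nB => n _; exact: Bn.
by exists n => // j nj Bj; apply: nBn; exists j.
Qed.

Lemma clip_bound (C M x : R) (X : R) (K : nat) : 0 <= C -> M = C + `|x| ->
  `|X| <= C * (1 + K%:R) -> `|X - x| <= Num.min `|X - x| M + C * K%:R.
Proof.
move=> C0 -> XK; have CK : 0 <= C * K%:R by rewrite mulr_ge0.
case: (leP `|X - x| (C + `|x|)) => _; first by rewrite lerDl.
by apply: le_trans (ler_normB _ _) _; lra.
Qed.

Section one_term.
Context (X : Omega -> R) (B : nat -> set Omega) (x C c z : R).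
Hypotheses (mX : measurable_fun setT X) (mB : forall k, measurable (B k)).
Hypotheses (Cp : 0 < C) (c0 : 0 <= c) (z0 : 0 <= z) (z1 : z < 1).
Hypothesis PB : forall k, (P (B k) <= (c * z ^+ k.+1)%:E)%E.
Hypothesis XB : forall w k, ~ B k w -> `|X w| <= C * (1 + k%:R).

Let C0 : 0 <= C := ltW Cp.

Let M := C + `|x|.

Let mnorm : measurable_fun setT (fun w => `|X w - x|).
Proof. by apply: measurableT_comp => //; apply: measurable_funB. Qed.

Let mmin : measurable_fun setT (fun w => Num.min `|X w - x| M).
Proof. exact: measurable_minr. Qed.

Let m0 w : 0 <= Num.min `|X w - x| M.
Proof. by rewrite le_min normr_ge0 addr_ge0. Qed.

(** If [K] is the first index with [w] outside [B K], then [|X| <= C (1 + K)], the excess of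
    [|X - x|] over [M = C + |x|] is at most [C K], and [K] is at most the number of events
    containing [w]. *)
Lemma tail_count_bound w :
  (`|X w - x|%:E <= (Num.min `|X w - x| M)%:E +
    C%:E * (\sum_(0 <= k <oo) (\1_(B k) w)%:E))%E.
Proof.
have [K [BK XK]] : exists K : nat, (forall j, (j < K)%N -> B j w) /\
    `|X w - x| <= Num.min `|X w - x| M + C * K%:R.
  have [[k nBk]|allB] := pselect (exists k, ~ B k w).
    have ex : exists k, `[< ~ B k w >] by exists k; exact/asboolP.
    case: (ex_minnP ex) => K /asboolP nBK minK; exists K; split.
      move=> j jK; apply: contrapT => nBj.
      by have := minK j (asboolT nBj); rewrite leqNgt jK.
    by apply: clip_bound => //; exact: XB.
  have Bj j : B j w by apply: contrapT => nBj; apply: allB; exists j.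
  (* Here [w] lies in every [B j], so any [K] is allowed; it is taken so large that [C K] alone
     dominates the deviation. *)
  exists (Num.truncn (`|X w - x| / C)).+1; split=> //.
  apply: ler_wpDl => //; rewrite mulrC -ler_pdivrMr //.
  have : 0 <= `|X w - x| / C by rewrite divr_ge0.
  by move=> /truncn_itv /andP[_ /ltW].
apply: (@le_trans _ _ ((Num.min `|X w - x| M)%:E + C%:E * (K%:R)%:E)%E).
  by rewrite -EFinM -EFinD lee_fin.
apply: leeD => //; apply: lee_wpmul2l; first by rewrite lee_fin.
apply: le_trans (nneseries_lim_ge K _); last by move=> n _ _; rewrite lee_fin.
rewrite sumEFin lee_fin big_mkord.
rewrite (eq_bigr (fun=> 1)) ?sumr_const ?card_ord // => i _.
by rewrite indicE mem_set //; exact: BK.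
Qed.

Lemma tail_integral :
  (\int[P]_w (`|X w - x|%:E) <=
   \int[P]_w (Num.min `|X w - x| M)%:E + (C * (c * z / (1 - z)))%:E)%E.
Proof.
have mS : measurable_fun setT (fun w => (\sum_(0 <= k <oo) (\1_(B k) w)%:E)%E : \bar R).
  apply: (@ge0_emeasurable_sum _ _ _ _ (fun k w => (\1_(B k) w)%:E) xpredT).
    by move=> k w _ _; rewrite lee_fin.
  by move=> k _; apply/measurable_EFinP; exact: measurable_indic.
have S0 w : (0 <= \sum_(0 <= k <oo) (\1_(B k) w)%:E :> \bar R)%E.
  by apply: nneseries_ge0 => k _ _; rewrite lee_fin.
apply: (@le_trans _ _ (\int[P]_w ((Num.min `|X w - x| M)%:E +
    C%:E * (\sum_(0 <= k <oo) (\1_(B k) w)%:E)))%E).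
  apply: ge0_le_integral => //.
  - exact/measurable_EFinP.
  - by apply: emeasurable_funD; [exact/measurable_EFinP|exact: measurable_funeM].
  - by move=> w _; exact: tail_count_bound.
rewrite ge0_integralD //; last 4 first.
- by move=> w _; rewrite lee_fin.
- exact/measurable_EFinP.
- by move=> w _; rewrite mule_ge0.
- exact: measurable_funeM.
apply: leeD => //; rewrite ge0_integralZl_EFin // EFinM.
apply: lee_wpmul2l; first by rewrite lee_fin.
rewrite integral_nneseries //; last first.
  by move=> k; apply/measurable_EFinP; exact: measurable_indic.
apply: le_trans (geometric_eseries_le (mulr_ge0 c0 z0) z0 z1).
apply: lee_nneseries => [k _ _|k _]; first by apply: integral_ge0 => w _; rewrite lee_fin.
rewrite integral_indic // setIT; apply: le_trans (PB k) _.
by rewrite lee_fin exprS mulrA.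
Qed.

Lemma integral_min_bound : (\int[P]_w (Num.min `|X w - x| M)%:E <= M%:E)%E.
Proof.
have M0 : 0 <= M by rewrite addr_ge0.
apply: (@le_trans _ _ (\int[P]_w (cst M%:E w))%E).
  apply: ge0_le_integral => //.
  - by move=> w _; rewrite lee_fin.
  - exact/measurable_EFinP.
  - by move=> w _; rewrite lee_fin ge_min lexx orbT.
by rewrite integral_cst // [X in (_ * X <= _)%E](probability_setT P) mule1.
Qed.

Lemma integrable_dev : P.-integrable setT (EFin \o (fun w => X w - x)).
Proof.
apply/integrableP; split; first by apply/measurable_EFinP; apply: measurable_funB.
apply: le_lt_trans tail_integral _.
by apply: le_lt_trans (leeD integral_min_bound (lexx _)) _; rewrite -EFinD ltry.
Qed.

Lemma integrable_from_tail : P.-integrable setT (EFin \o X).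
Proof.
have icst : P.-integrable setT (EFin \o (fun _ : Omega => x)).
  exact: finite_measure_integrable_cst.
have := integrableD measurableT integrable_dev icst.
by apply: eq_integrable => // w _ /=; rewrite -EFinD subrK.
Qed.

Lemma expectation_dev :
  `|fine (\int[P]_w (X w)%:E)%E - x| <=
  fine (\int[P]_w (Num.min `|X w - x| M)%:E)%E + C * (c * z / (1 - z)).
Proof.
have icst : P.-integrable setT (EFin \o (fun _ : Omega => x)).
  exact: finite_measure_integrable_cst.
have -> : fine (\int[P]_w (X w)%:E)%E - x = (\int[P]_w (X w - x))%R.
  rewrite RintegralB //; last exact: integrable_from_tail.
  by rewrite Rintegral_cst // [X in x * fine X](probability_setT P) mulr1.
apply: le_trans (le_normr_Rintegral measurableT integrable_dev) _.
have minfin : (\int[P]_w (Num.min `|X w - x| M)%:E)%E \is a fin_num.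
  rewrite ge0_fin_numE; last by apply: integral_ge0 => w _; rewrite lee_fin.
  by apply: le_lt_trans integral_min_bound _; rewrite ltry.
rewrite -lee_fin EFinD (fineK minfin) /Rintegral fineK; first exact: tail_integral.
have := integrable_fin_num measurableT (integrable_norm integrable_dev).
by [].
Qed.

End one_term.

(** The deviation cut at [M] tends to 0 in mean by dominated convergence. The excess costs at most
    [C c z^N / (1 - z^N)]: tails geometric in [k] make this sum finite, and the exponent [N] makes
    it vanish. *)
Theorem cvg_expectation (X : nat -> Omega -> R) (B : nat -> nat -> set Omega)
    (x C c z : R) :
  (forall N, measurable_fun setT (X N)) -> (forall N k, measurable (B N k)) ->
  0 < C -> 0 <= c -> 0 <= z -> z < 1 ->
  (forall N k, (P (B N k) <= (c * (z ^+ N) ^+ k.+1)%:E)%E) ->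
  (\forall N \near \oo, forall w k, ~ B N k w -> `|X N w| <= C * (1 + k%:R)) ->
  {ae P, forall w, X N w @[N --> \oo] --> x} ->
  (\forall N \near \oo, P.-integrable setT (EFin \o X N)) /\
  (fun N => \int[P]_w (X N w)%:E)%E @ \oo --> x%:E.
Proof.
move=> mX mB C0 c0 z0 z1 PB XB Xae.
have zN1 : \forall N \near \oo, z ^+ N < 1.
  by exists 1%N => // N /= N0; rewrite exprn_ilt1 // -lt0n.
have int : \forall N \near \oo, P.-integrable setT (EFin \o X N).
  near=> N; apply: (@integrable_from_tail (X N) (B N) x C c (z ^+ N)) => //.
  - by rewrite exprn_ge0.
  - by near: N.
  - by near: N.
split => //.
pose M := C + `|x|; have M0 : 0 <= M by rewrite addr_ge0 // ltW.
pose m N := (\int[P]_w (Num.min `|X N w - x| M)%:E)%E.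
have m0 : m @ \oo --> 0%:E.
  have [] := @dominated_convergence _ _ _ P setT measurableT
    (fun N w => (Num.min `|X N w - x| M)%:E) (cst 0%E) (cst M%:E).
  - move=> N; apply/measurable_EFinP; apply: measurable_minr => //.
    by apply: measurableT_comp => //; apply: measurable_funB.
  - exact: measurable_cst.
  - apply: filterS Xae => w Xw _; apply/cvg_EFin; first by apply: nearW.
    apply/cvgrPdist_le => e e0 /=; near=> N.
    rewrite sub0r normrN ger0_norm; last by rewrite le_min normr_ge0.
    rewrite ge_min; apply/orP; left; rewrite distrC; near: N.
    by move: e e0; apply/cvgrPdist_le.
  - exact: finite_measure_integrable_cst.
  - apply: nearW => w N _; rewrite /= lee_fin ger0_norm; last by rewrite le_min normr_ge0.
    by rewrite ge_min lexx orbT.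
  by move=> _ _; rewrite integral0.
apply/cvg_EFin.
  near=> N; apply: integrable_fin_num => //; by near: N.
have {m0} fm0 : fine (m N) @[N --> \oo] --> 0 by exact: (fine_cvg m0).
have zN0 : z ^+ N @[N --> \oo] --> 0 by apply: cvg_expr; rewrite ger0_norm.
have bound0 : fine (m N) + C * (c * z ^+ N / (1 - z ^+ N)) @[N --> \oo] --> 0.
  rewrite -[0 in X in _ --> X](_ : 0 + C * (c * 0 / (1 - 0)) = 0);
    last by rewrite mulr0 mul0r mulr0 addr0.
  apply: cvgD => //; apply: cvgM; first exact: cvg_cst.
  apply: cvgM; first by apply: cvgM => //; exact: cvg_cst.
  apply: cvgV; first by rewrite subr0 oner_eq0.
  by apply: cvgB => //; exact: cvg_cst.
apply/cvgrPdist_le => e e0; near=> N; rewrite distrC.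
apply: (@le_trans _ _ (fine (m N) + C * (c * z ^+ N / (1 - z ^+ N)))).
  apply: (@expectation_dev (X N) (B N)) => //.
  - by rewrite exprn_ge0.
  - by near: N.
  - by near: N.
apply: le_trans (ler_norm _) _; rewrite -normrN -sub0r; near: N.
by move: e e0; apply/cvgrPdist_le.
Unshelve. all: by end_near. Qed.

End probability.

(** * From the empirical spectral distribution to the partition functions *)

Definition clip (R : realType) (a b x : R) : R := Num.max a (Num.min x b).

Lemma clip_continuous (R : realType) (a b : R) : continuous (clip a b).
Proof.
move=> x; apply: (@continuous_max R R (fun=> a) (fun x => Num.min x b)).
  exact: cvg_cst.
by apply: (@continuous_min R R id (fun=> b)); [exact: cvg_id|exact: cvg_cst].
Qed.

Lemma clip_itv (R : realType) (a b x : R) : a <= b -> a <= clip a b x <= b.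
Proof. by move=> ab; rewrite /clip le_max lexx ge_max ab ge_min lexx orbT. Qed.

Lemma clip_id (R : realType) (a b x : R) : a <= x -> x <= b -> clip a b x = x.
Proof. by move=> ax xb; rewrite /clip (min_idPl xb) (max_idPr ax). Qed.

Section empirical_spectrum.
Context (R : realType) (beta lb : R) (l : forall N, 'I_N -> R).
Arguments l : clear implicits.
Hypotheses (beta0 : 0 < beta) (lb0 : 0 < lb).
Notation D := (`[(- lb)%R, lb]%classic : set R).
Hypothesis ledge : forall e : R, 0 < e -> \forall N \near \oo, forall i, `|l N i| <= lb + e.
Hypothesis esd : forall f : R -> R, continuous f ->
  (exists M : R, forall x, `|f x| <= M) ->
  (fun N : nat => N%:R^-1 * \sum_(i < N) f (l N i)) @ \oo -->
  fine (\int[@lebesgue_measure R]_(mu in D) (f mu * rho lb mu)%:E)%E.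

(** Testing the weak convergence on the constant 1 gives the mass without evaluating the integral of
    the density. *)
Lemma rho_mass : (\int[@lebesgue_measure R]_(x in D) rho lb x)%R = 1.
Proof.
have c1 : (fun N : nat => N%:R^-1 * \sum_(i < N) (1 : R)) @ \oo --> (1 : R).
  apply: cvg_near_cst; near=> N; rewrite sumr_const card_ord mulVf // pnatr_eq0 -lt0n.
  by near: N; exact: nbhs_infty_gt.
have c2 := esd (f := fun=> 1) (fun x => cvg_cst _) (ex_intro _ 1 (fun x => _)).
have -> : (\int[@lebesgue_measure R]_(x in D) rho lb x)%R =
  fine (\int[@lebesgue_measure R]_(mu in D) (1 * rho lb mu)%:E)%E.
  by rewrite /Rintegral; congr fine; apply: eq_integral => x _; rewrite mul1r.
apply: (cvg_unique _ _ c1) => //; apply: c2 => /= x; by rewrite normr1.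
Unshelve. all: by end_near. Qed.

(** The logarithm is not a bounded continuous test function, so its argument is clipped at [m],
    halfway between [lb] and [q / beta]. Eventually all eigenvalues lie in [[- m, m]], where
    clipping changes nothing. *)
Lemma logpot_cvg q : beta * lb < q ->
  (fun N => logpot beta (l N) q) @ \oo --> scpot lb beta q.
Proof.
move=> qlb; pose m := (lb + q / beta) / 2.
have lq : lb < q / beta by rewrite ltr_pdivlMr // mulrC.
have lm : lb < m by rewrite /m; lra.
have m0 : 0 < m by apply: lt_trans lm.
have mq : beta * m < q by rewrite mulrC -ltr_pdivlMr // /m; lra.
pose f x := ln (q - beta * clip (- m) m x).
have cl x : - m <= clip (- m) m x <= m by apply: clip_itv; lra.
have arg0 x : q - beta * m <= q - beta * clip (- m) m x <= q + beta * m.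
  have /andP[c1 c2] := cl x; move: c1 c2; rewrite -(ler_pM2l beta0 (- m))
    -(ler_pM2l beta0 (clip _ _ _)) => ? ?.
  by apply/andP; split; lra.
have bm : 0 < beta * m by rewrite mulr_gt0 // (lt_trans lb0).
have qm0 : 0 < q - beta * m by lra.
have fc : continuous f.
  move=> x; pose g := fun x => q - beta * clip (- m) m x.
  have gc : {for x, continuous g}.
    apply: (@cvgB _ R); first exact: cvg_cst.
    by apply: cvgM; [exact: cvg_cst|exact: clip_continuous].
  have lc : {for g x, continuous (@ln R)}.
    by apply: continuous_ln; case/andP: (arg0 x) => h _; exact: lt_le_trans h.
  exact: (continuous_comp gc lc).
have fb : exists M : R, forall x, `|f x| <= M.
  exists (`|ln (q - beta * m)| + `|ln (q + beta * m)|) => x.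
  have /andP[h1 h2] := arg0 x.
  have f1 : ln (q - beta * m) <= f x by rewrite ler_ln ?posrE //; exact: (lt_le_trans qm0 h1).
  have f2 : f x <= ln (q + beta * m).
    by rewrite ler_ln ?posrE //; [exact: (lt_le_trans qm0 h1)|lra].
  have := ler_norm (ln (q + beta * m)); have := ler_norm (- ln (q - beta * m)).
  rewrite normrN ler_norml => ? ?.
  have := normr_ge0 (ln (q - beta * m)); have := normr_ge0 (ln (q + beta * m)).
  by move=> ? ?; apply/andP; split; lra.
have := esd fc fb.
have -> : fine (\int[@lebesgue_measure R]_(mu in D) (f mu * rho lb mu)%:E)%E =
  (\int[@lebesgue_measure R]_(x in D) (rho lb x * ln (q - beta * x)))%R.
  rewrite /Rintegral; congr fine; apply: eq_integral => x.
  rewrite inE /= in_itv /= => /andP[x1 x2]; rewrite /f clip_id ?[ln _ * _]mulrC //; lra.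
set I := Rintegral _ _ _ => cv.
have {}cv : (fun N : nat => - (1 / 2) * (N%:R^-1 * \sum_(i < N) f (l N i))) @ \oo --> - (1 / 2) * I.
  by apply: cvgM; [exact: cvg_cst|exact: cv].
rewrite /scpot -/I; apply: (cvg_trans _ cv); apply: near_eq_cvg.
near=> N; rewrite /logpot; congr (_ * (_ * _)).
symmetry; apply: eq_bigr => i _; rewrite /f.
have : `|l N i| <= lb + (m - lb) by move: i; near: N; apply: ledge; lra.
by rewrite ler_norml => /andP[? ?]; rewrite clip_id //; lra.
Unshelve. all: by end_near. Qed.

Lemma edge_count e : 0 < e -> exists2 p : R, 0 < p &
  \forall N \near \oo, p * N%:R <= \sum_i (lb - e <= l N i)%R%:R.
Proof.
move=> e0; pose ep := Num.min e lb.
have ep0 : 0 < ep by rewrite lt_min e0.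
have eplb : ep <= lb by rewrite ge_min lexx orbT.
have epe : ep <= e by rewrite ge_min lexx.
have [c c0 Hc] := rho_mass_edge lb0 ep0 eplb.
(* The piecewise linear cutoff rising from 0 at [lb - ep] to 1 at [lb - ep / 2]: a continuous
   minorant of the indicator being counted. *)
pose f x := clip 0 1 ((x - (lb - ep)) / (ep / 2)).
have f01 x : 0 <= f x <= 1 by exact: clip_itv.
have fc : continuous f.
  move=> x; pose g := fun x => (x - (lb - ep)) / (ep / 2).
  have gc : {for x, continuous g}.
    apply: cvgM; last exact: cvg_cst.
    by apply: (@cvgB _ R); [exact: cvg_id|exact: cvg_cst].
  exact: (continuous_comp gc (@clip_continuous R 0 1 (g x))).
have fb : exists M : R, forall x, `|f x| <= M.
  by exists 1 => x; have /andP[h1 h2] := f01 x; rewrite ger0_norm.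
have f1 x : lb - ep / 2 <= x -> f x = 1.
  move=> xl; rewrite /f /clip (min_idPr _) ?(max_idPr _) // ler_pdivlMr ?divr_gt0 // mul1r.
  lra.
have cI := Hc f (continuous_measurable_fun fc) f01 f1.
have c2 : 0 < c / 2 by rewrite divr_gt0.
have /cvgrPdist_le/(_ _ c2) cv := esd fc fb.
exists (c / 2) => //; near=> N.
have N0 : 0 < N%:R :> R by rewrite ltr0n; near: N; exact: nbhs_infty_gt.
have : c / 2 <= N%:R^-1 * \sum_(i < N) f (l N i).
  have : `|fine (\int[@lebesgue_measure R]_(mu in D) (f mu * rho lb mu)%:E)%E - N%:R^-1 * \sum_(i
    < N) f (l N i)| <= c / 2.
    by near: N.
  move: cI; rewrite /Rintegral ler_norml => ? /andP[_ ?]; lra.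
rewrite ler_pdivlMl // mulrC => /le_trans; apply.
apply: ler_sum => i _; have [li|li] := leP (lb - e) (l N i).
  by case/andP: (f01 (l N i)).
rewrite /f /clip (max_idPl _) //= ge_min; apply/orP; left.
by rewrite ler_pdivrMr ?divr_gt0 // mul0r; lra.
Unshelve. all: by end_near. Qed.

End empirical_spectrum.

Lemma Zsf_sphere (R : realType) N (J : 'M[R]_N) beta r :
  ballint (spherefun (scaledJ J) beta r) \is a fin_num ->
  Zsf J beta r = fine (ballint (spherefun (scaledJ J) beta r)) / ballvol R N.
Proof.
move=> bfin; rewrite /Zsf /sphere_int.
have -> : iint (fun x : 'rV[R]_N =>
      (if sqnorm x <= 1 then expR (- beta * hamiltonian J ((r * Num.sqrt N%:R / Num.sqrt (sqnorm
        x)) *: x))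
       else 0)%:E) = ballint (spherefun (scaledJ J) beta r).
  by apply: eq_iint => x; rewrite hamiltonianE mulrNN.
by rewrite fineM.
Qed.

Lemma Zg_zgfun (R : realType) N (J : 'M[R]_N) beta lam :
  Zg J beta lam = fine (iint (fun z => (zgfun (scaledJ J) beta lam z)%:E)).
Proof.
by congr fine; apply: eq_iint => z; rewrite /zgfun hamiltonianE mulrNN.
Qed.

Lemma half_ln2pi (R : realType) : - (1 / 2) * ln2pi R + lnsqrtpi R = - (1 / 2) * ln 2.
Proof.
have p0 := pi_gt0 R; rewrite /ln2pi /lnsqrtpi lnM ?posrE //.
move: (pi : R) p0 => p p0.
have s0 : 0 < Num.sqrt p by rewrite sqrtr_gt0.
by rewrite -{1}[p]sqr_sqrtr ?(ltW p0) // lnXn // mulr2n; field.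
Qed.

(** * Bounds by the spectral radius, uniform in the disorder *)

Section bounds.
Context (R : realType) (beta lam r : R).
Hypotheses (beta0 : 0 < beta) (r0 : 0 < r).

(** The true rate is [1/2 + 1/2 ln (2 pi)]. Giving up the first 1/2 leaves exactly the normalization
    of the Gaussian measure, which then cancels in [Zg_bound]. *)
Lemma ballvol_near_ge : \forall N \near \oo,
  (0 < N)%N /\ expR (N%:R * (1 / 2 * ln2pi R)) <= Num.sqrt N%:R ^+ N * ballvol R N.
Proof.
have h2 : 0 < 1 / 2 :> R by lra.
near=> N; split; first by near: N; exact: nbhs_infty_gt.
have /andP[+ _] : expR (N%:R * (1 / 2 + lnsqrtpi R + 1 / 2 * ln 2 - 1 / 2))
  <= Num.sqrt N%:R ^+ N * ballvol R N <=
   expR (N%:R * (1 / 2 + lnsqrtpi R + 1 / 2 * ln 2 + 1 / 2)).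
  by near: N; exact: ballvol_asymptotic.
apply: le_trans; rewrite ler_expR ler_wpM2l //.
by have := half_ln2pi R; lra.
Unshelve. all: by end_near. Qed.

(** The threshold on [N] comes from the volume of the ball alone, hence does not depend on [J];
    domination in [cvg_expectation] requires this. *)
Lemma Zsf_bound : \forall N \near \oo, forall (J : 'M[R]_N) U l b, orthomx U ->
  scaledJ J = orthodiag U l -> (forall i, `|l i| <= b) ->
  `|N%:R^-1 * ln (Zsf J beta r)| <= beta * r ^+ 2 * b.
Proof.
apply: filterS ballvol_near_ge => N [N0 VN] J U l b UU JE lb.
have N0R : 0 < N%:R :> R by rewrite ltr0n.
have V0 : 0 < ballvol R N.
  have : 0 < Num.sqrt N%:R ^+ N * ballvol R N by apply: lt_le_trans VN; exact: expR_gt0.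
  by rewrite pmulr_rgt0 // exprn_gt0 // sqrtr_gt0.
have fin := spherefun_fin UU (ltW beta0) lb r0 N0.
rewrite Zsf_sphere JE //; set I := fine _.
have cst_ge0 k : forall v : 'rV[R]_N, 0 <= (if sqnorm v <= 1 then expR k else 0 : R).
  by move=> v; case: ifP => // _; exact: expR_ge0.
have cst_int k : iint (fun v : 'rV[R]_N => (if sqnorm v <= 1 then expR k else 0)%:E)
  = (expR k * ballvol R N)%:E.
  have := @ballvol_scale R N 1 ltr01; rewrite sqrtr1 expr1n mul1r EFinM => <-.
  rewrite -iintZR ?expR_ge0 //; last first.
  - by move=> v; case: ifP.
  - by vmeas.
  by apply: eq_iint => v; case: ifP; rewrite ?mulr1 ?mulr0.
have mg := vmeasr_spherefun U l beta r.
have gb := spherefun_bound UU (ltW beta0) lb r0 N0.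
set K := N%:R * (beta * b * r ^+ 2) in gb.
have Il : expR (- K) * ballvol R N <= I.
  rewrite -lee_fin /I fineK // -cst_int; apply: le_iintR => //; [by vmeas|exact: vmeasr_ball|].
  by move=> v; case: ifP => // _; case/andP: (gb v).
have Iu : I <= expR K * ballvol R N.
  rewrite -lee_fin /I fineK // -cst_int; apply: le_iintR => //; [exact: vmeasr_ball|by vmeas| |].
    by move=> v; case: ifP => // _; exact: expR_ge0.
  by move=> v; case: ifP => // _; case/andP: (gb v).
have I0 : 0 < I by apply: lt_le_trans Il; rewrite mulr_gt0 ?expR_gt0.
have lnb : `|ln (I / ballvol R N)| <= K.
  rewrite ler_norml -!(ler_expR (- K)) -(ler_expR _ K) lnK ?posrE ?divr_gt0 //.
  by rewrite ler_pdivlMr // ler_pdivrMr // Il.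
rewrite normrM ger0_norm ?invr_ge0 ?(ltW N0R) // ler_pdivrMl //.
by apply: le_trans lnb _; rewrite /K le_eqVlt; apply/orP; left; apply/eqP; ring.
Qed.

(** Collects two estimates: from below, restriction to the ball [sqnorm z <= N], with
    [beta b <= beta (1 + b^2)]; from above, [q = beta b + 1], where [dualquad] is at most
    [2 b^2 + (1 + lam)^2 / (2 beta^2)]. *)
Definition zgC : R := 2 + beta + beta ^+ 2 / 4 + (`|lam| + 1) / 2 +
  (1 + lam) ^+ 2 / (2 * beta ^+ 2) + `|ln 2|.

Lemma Zg_bound : \forall N \near \oo, forall (J : 'M[R]_N) U l b, orthomx U ->
  scaledJ J = orthodiag U l -> 0 <= b -> (forall i, `|l i| <= b) ->
  `|N%:R^-1 * ln (Zg J beta lam)| <= zgC * (1 + b ^+ 2).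
Proof.
apply: filterS ballvol_near_ge => N [N0 VN] J U l b UU JE b0 lb.
have N0R : 0 < N%:R :> R by rewrite ltr0n.
rewrite Zg_zgfun JE; set I := fine _.
have fin := zg_fin l lam UU beta0 N0.
pose K := beta * b + beta ^+ 2 / 4 + (`|lam| + 1) / 2.
have Il : expR (N%:R * (- K)) <= I.
  apply: (@le_trans _ _ (expR (N%:R * (- (1 / 2) * ln2pi R - K))
    * (Num.sqrt N%:R ^+ N * ballvol R N))).
    apply: (@le_trans _ _ (expR (N%:R * (- (1 / 2) * ln2pi R - K))
      * expR (N%:R * (1 / 2 * ln2pi R)))).
      by rewrite -expRD ler_expR; lra.
    by rewrite ler_wpM2l ?expR_ge0.
  rewrite -lee_fin /I fineK // EFinM -ballvol_scale // -iintZR ?expR_ge0 //; last first.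
  - by move=> v; case: ifP.
  - by vmeas.
  apply: le_iintR; [by vmeas|exact: vmeasr_zgfun| |].
    by move=> v; rewrite mulr_ge0 ?expR_ge0 //; case: ifP.
  move=> z; case: ifP => [zN|_]; last by rewrite mulr0 zgfun_ge0.
  rewrite mulr1 zgfunE // ler_expR.
  set x := sqnorm z / N%:R.
  have x0 : 0 <= x by rewrite divr_ge0 ?sqnorm_ge0 // ltW.
  have x1 : x <= 1 by rewrite ler_pdivrMr // mul1r.
  have zE : sqnorm z = N%:R * x by rewrite /x mulrC divfK // gt_eqF.
  have := quad_orthodiag_bound UU z lb; rewrite zE ler_norml => /andP[qb _].
  have qb' : - (N%:R * (beta * b)) <= beta * quad (orthodiag U l) z.
    have : beta * - (b * (N%:R * x)) <= beta * quad (orthodiag U l) z by rewrite ler_pM2l.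
    apply: le_trans; rewrite mulrN lerN2.
    have -> : beta * (b * (N%:R * x)) = (N%:R * (beta * b)) * x by ring.
    by rewrite ler_piMr // !mulr_ge0 // ltW.
  have x2 : beta ^+ 2 * x ^+ 2 <= beta ^+ 2.
    by rewrite ler_piMr ?sqr_ge0 // expr_le1.
  have lx : - (`|lam| + 1) <= (lam - 1) * x.
    have : `|lam - 1| <= `|lam| + 1 by apply: le_trans (ler_normB _ _) _; rewrite normr1.
    have : - `|lam - 1| <= (lam - 1) * x.
      rewrite lerNl -mulNr; apply: le_trans (ler_norm _) _.
      by rewrite normrM normrN (ger0_norm x0) ler_piMr.
    lra.
  have : N%:R * (- (beta ^+ 2 / 4) - (`|lam| + 1) / 2) <= N%:R * (- beta ^+ 2 * x ^+ 2 / 4 + (lam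
    - 1) * x / 2).
    by rewrite ler_pM2l //; lra.
  rewrite /K; lra.
have I0 : 0 < I by apply: lt_le_trans Il; exact: expR_gt0.
have q0 i : 1 <= beta * b + 1 - beta * l i.
  have := lb i; rewrite ler_norml => /andP[_]; rewrite -(ler_pM2l beta0 (l i)); lra.
have q0' i : 0 < beta * b + 1 - beta * l i by apply: lt_le_trans (q0 i).
have Iu : I <= expR (N%:R * (dualquad beta lam (beta * b + 1) - 1 / 2 * ln 2)).
  rewrite -lee_fin /I fineK //; apply: le_trans (zg_upper lam UU beta0 N0 q0') _.
  rewrite lee_fin gaussvol_logpot // -expRD ler_expR -mulrDr ler_wpM2l ?(ltW N0R) //.
  have : logpot beta l (beta * b + 1) <= 0.
    rewrite /logpot mulNr oppr_le0 !mulr_ge0 ?invr_ge0 // sumr_ge0 // => i _.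
    exact: ln_ge0.
  have := half_ln2pi R; lra.
have lnI : - (N%:R * K) <= ln I <= N%:R * (dualquad beta lam (beta * b + 1) - 1 / 2 * ln 2).
  by rewrite -mulrN -!(ler_expR _ (ln _)) -(ler_expR (ln _)) lnK ?posrE // Il.
have bt := beta0.
have b2 : b <= 1 + b ^+ 2 by nra.
have bb : 0 <= b ^+ 2 by exact: sqr_ge0.
have t1 : 0 <= (`|lam| + 1) / 2 by rewrite divr_ge0 // addr_ge0.
have t2 : 0 <= beta ^+ 2 / 4 by rewrite divr_ge0 // sqr_ge0.
have t3 : 0 <= (1 + lam) ^+ 2 / (2 * beta ^+ 2).
  by rewrite divr_ge0 ?sqr_ge0 // mulr_ge0 // sqr_ge0.
have t4 : 0 <= `|ln 2 : R| by exact: normr_ge0.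
have dq : dualquad beta lam (beta * b + 1) <= 2 * b ^+ 2 + (1 + lam) ^+ 2 / (2 * beta ^+ 2).
  rewrite -subr_ge0 (_ : _ - _ = (2 * beta * b - (1 + lam)) ^+ 2 / (4 * beta ^+ 2)).
    by rewrite divr_ge0 ?sqr_ge0 // mulr_ge0 // sqr_ge0.
  by rewrite /dualquad; field; rewrite gt_eqF.
have ln2 : - (1 / 2 * ln 2) <= `|ln 2 : R|.
  have := ler_norm (- ln 2 : R); rewrite normrN; lra.
have CC : zgC * (1 + b ^+ 2) = zgC + zgC * b ^+ 2 by ring.
have C2 : 2 * b ^+ 2 <= zgC * b ^+ 2 by rewrite ler_wpM2r // /zgC; lra.
have Cb : beta * b <= beta * (1 + b ^+ 2) by rewrite ler_pM2l.
have Cb2 : beta * b ^+ 2 <= zgC * b ^+ 2 by rewrite ler_wpM2r // /zgC; lra.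
rewrite normrM ger0_norm ?invr_ge0 ?(ltW N0R) // ler_pdivrMl // ler_norml.
case/andP: lnI => h1 h2; apply/andP; split.
  apply: le_trans h1; rewrite lerN2 ler_pM2l // /K CC; move: Cb Cb2; rewrite /zgC; lra.
apply: le_trans h2 _; rewrite ler_pM2l // CC; move: C2; rewrite /zgC; lra.
Qed.

End bounds.

Lemma explim_near (R : realType) (Y W : nat -> R) T :
  (\forall N \near \oo, Y N = W N) -> explim Y T -> explim W T.
Proof.
move=> YW YT e e0; near=> N.
have <- : Y N = W N by near: N.
by near: N; exact: YT.
Unshelve. all: by end_near. Qed.

Lemma cvg_scaled_expectation d (Omega : measurableType d) (R : realType)
    (P : probability Omega R) (Z : nat -> Omega -> R) (T : R) :
  (\forall N \near \oo, P.-integrable setT (EFin \o (fun w => N%:R^-1 * ln (Z N w)))) ->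
  (fun N => \int[P]_w (N%:R^-1 * ln (Z N w))%:E)%E @ \oo --> T%:E ->
  (fun N : nat => ((N%:R^-1)%:E * 'E_P[fun w => ln (Z N w)%R])%E) @ \oo --> T%:E.
Proof.
move=> iX; apply: cvg_trans; apply: near_eq_cvg; near=> N.
have N0 : N%:R != 0 :> R.
  by rewrite pnatr_eq0 -lt0n; near: N; exact: nbhs_infty_gt.
have iN : P.-integrable setT (EFin \o (fun w => N%:R^-1 * ln (Z N w))) by near: N.
rewrite unlock.
have -> : (\int[P]_w (ln (Z N w))%:E = N%:R%:E * \int[P]_w (N%:R^-1 * ln (Z N w))%:E)%E.
  rewrite -(integralZl measurableT iN); apply: eq_integral => w _ /=.
  by rewrite -EFinM mulVKf.
by rewrite muleA -EFinM mulVf // mul1e.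
Unshelve. all: by end_near. Qed.

(** * Limits along a fixed sample *)

Section pathwise.
Context (R : realType) (J : forall N : nat, 'M[R]_N) (U : forall N, 'M[R]_N)
  (l : forall N, 'I_N -> R) (lb beta lam r : R).
Arguments l : clear implicits.
Hypotheses (UU : forall N, orthomx (U N)) (JE : forall N, scaledJ (J N) = orthodiag (U N) (l N)).
Hypotheses (lb0 : 0 < lb) (beta0 : 0 < beta) (r0 : 0 < r).
Hypothesis ledge : forall e : R, 0 < e -> \forall N \near \oo, forall i, `|l N i| <= lb + e.
Hypothesis esd : forall f : R -> R, continuous f ->
  (exists M : R, forall x, `|f x| <= M) ->
  (fun N : nat => N%:R^-1 * \sum_(i < N) f (l N i)) @ \oo -->
  fine (\int[@lebesgue_measure R]_(mu in `[(- lb)%R, lb]) (f mu * rho lb mu)%:E)%E.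

Let rho1 := rho_mass esd.
Let Lcvg := logpot_cvg beta0 lb0 ledge esd.
Let lcount := edge_count lb0 esd.

Lemma Zsf_cvg : (fun N : nat => N%:R^-1 * ln (Zsf (J N) beta r)) @ \oo --> Asf lb beta (r ^+ 2).
Proof.
have s0 : 0 < r ^+ 2 by rewrite exprn_gt0.
have [q0 aq0 q0min] := spherical_min lb0 beta0 s0.
set P := q0 * r ^+ 2 + scpot lb beta q0.
have PLam q : beta * lb < q -> P <= q * r ^+ 2 + scpot lb beta q.
  by move=> aq; apply: q0min; exact: ltW.
have Pinf e : 0 < e -> exists2 q, beta * lb < q & q * r ^+ 2 + scpot lb beta q <= P + e.
  by move=> e0; exact: scpot_right_approx.
have I1 := sphere_asymptotic beta0 lb0 UU ledge lcount Lcvg r0 PLam Pinf.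
have IV := explim_div I1 (@ballvol_asymptotic R).
have -> : Asf lb beta (r ^+ 2) = lnsqrtpi R + P - 1 / 2 * ln (r ^+ 2)
  - (1 / 2 + lnsqrtpi R + 1 / 2 * ln 2).
  by rewrite (AsfE aq0 q0min) FsfE /P; ring.
apply: explim_cvg; apply: explim_near IV; near=> N.
have N0 : (0 < N)%N by near: N; exact: nbhs_infty_gt.
have sN : Num.sqrt N%:R ^+ N != 0 :> R by rewrite expf_neq0 // gt_eqF // sqrtr_gt0 ltr0n.
have lN i : `|l N i| <= lb + 1 by move: i; near: N; exact: ledge.
rewrite Zsf_sphere JE; last exact: (spherefun_fin (UU N) (ltW beta0) lN r0 N0).
by rewrite invfM mulrACA divff // mul1r.
Unshelve. all: by end_near. Qed.

Lemma Zg_cvg : (fun N : nat => N%:R^-1 * ln (Zg (J N) beta lam)) @ \oo --> Ag lb beta lam.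
Proof.
have [q1 aq1 q1min] := gaussian_min lb0 beta0 lam.
have [s10 q1s1] := gaussian_min_dual lb0 beta0 rho1 aq1 q1min.
have [_ AgE1] := AgE lb0 beta0 rho1 aq1 q1min.
set s1 := (2 * q1 + lam - 1) / beta ^+ 2 in s10 q1s1.
set P := q1 * s1 + scpot lb beta q1.
have PLam q : beta * lb < q -> P <= q * s1 + scpot lb beta q.
  by move=> aq; apply: q1s1; exact: ltW.
have TE : Ag lb beta lam = - (1 / 2) * ln2pi R - beta ^+ 2 * s1 ^+ 2 / 4 + (lam - 1) * s1 / 2
  + lnsqrtpi R + P.
  rewrite AgE1 -(dual_point beta0 lam q1) -/s1 /P.
  by have := half_ln2pi R; lra.
have Tinf e : 0 < e -> exists2 q, beta * lb < q &
    dualquad beta lam q + scpot lb beta q - 1 / 2 * ln2pi R + lnsqrtpi R <= Ag lb beta lam + e.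
  move=> e0; have [q qlb qe] := dualquad_right_approx lb0 beta0 lam aq1 e0.
  by exists q => //; rewrite AgE1; have := half_ln2pi R; lra.
have G1 := gaussian_asymptotic beta0 lb0 UU ledge lcount Lcvg s10 PLam TE Tinf.
apply: explim_cvg; apply: explim_near G1; apply: nearW => N.
by rewrite Zg_zgfun JE.
Qed.

End pathwise.

(** * Almost sure convergence and convergence in mean *)

Unset Implicit Arguments.
Set Strict Implicit.
Set Printing Implicit Defensive.

Theorem mainTheorem1 (R : realType) (d : measure_display)
  (Omega : measurableType d) (P : probability Omega R)
  (J : forall N : nat, Omega -> 'M[R]_N) (sJ2 lb : R)
  (* entries are random variables *)
  (Jmeas : forall N (i j : 'I_N), measurable_fun setT (fun w => J N w i j))
  (* symmetric *)
  (Jsym : forall N w (i j : 'I_N), J N w i j = J N w j i)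
  (* the entries J_ij, i <= j, are (mutually) independent *)
  (Jindep : forall N (B : 'I_N -> 'I_N -> set R),
     (forall i j, measurable (B i j)) ->
     fine (P (\bigcap_(k in [set k : 'I_N * 'I_N | (k.1 <= k.2)%N])
                [set w | B k.1 k.2 (J N w k.1 k.2)]))
     = \prod_(k : 'I_N * 'I_N | (k.1 <= k.2)%N)
         fine (P [set w | B k.1 k.2 (J N w k.1 k.2)]))
  (* centered, variance J^2 > 0 *)
  (Jmean : forall N (i j : 'I_N), ('E_P[fun w => J N w i j] = 0)%E)
  (sJ2_pos : 0 < sJ2)
  (Jvar : forall N (i j : 'I_N), ('E_P[fun w => (J N w i j ^+ 2)%R] = sJ2%:E)%E)
  (* uniform exponential moment *)
  (Jexp : exists theta0 : R, 0 < theta0 /\ exists C : R, forall N (i j : 'I_N),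
     ('E_P[fun w => expR (theta0 * J N w i j ^+ 2 / N%:R)%R] <= C%:E)%E)
  (* Hypothesis H (1) *)
  (lb_pos : 0 < lb)
  (Htail : exists C1 theta : R, 0 < C1 /\ 0 < theta /\
     forall (N : nat) (a : R), lb < a ->
       (P [set w | exists l : R, root (char_poly (scaledJ (J N w))) l /\ (a <= `|l|)%R]
        <= (C1 * expR (- theta * a ^+ 2 * N%:R))%:E)%E)
  (* Hypothesis H (2): a.s. weak convergence of the ESD to the semicircle law *)
  (Hesd : {ae P, forall w, forall f : R -> R, continuous f ->
     (exists M : R, forall x, `|f x| <= M) ->
     forall l : forall N : nat, 'I_N -> R,
       (forall N, is_spectrum (scaledJ (J N w)) (l N)) ->
       (fun N : nat => N%:R^-1 * \sum_(i < N) f (l N i)) @ \oo -->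
       fine (\int[@lebesgue_measure R]_(mu in `[(- lb)%R, lb])
               (f mu * rho lb mu)%:E)%E})
  (beta Rad lam : R) (hbeta : 0 < beta) (hRad : 0 < Rad) :
  (* (i) spherical model *)
  ((exists q0 : R, beta * lb <= q0 /\
      Fsf lb beta (Rad ^+ 2) q0 = Asf lb beta (Rad ^+ 2)) /\
   {ae P, forall w, (fun N : nat => N%:R^-1 * ln (Zsf (J N w) beta Rad)) @ \oo
                      --> Asf lb beta (Rad ^+ 2)} /\
   (fun N : nat => ((N%:R^-1)%:E * 'E_P[fun w => ln (Zsf (J N w) beta Rad)%R])%E)
      @ \oo --> (Asf lb beta (Rad ^+ 2))%:E)
  /\
  (* (ii) Gaussian model *)
  ((exists r0 : R, 0 < r0 /\ Gg lb beta lam r0 = Ag lb beta lam) /\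
   {ae P, forall w, (fun N : nat => N%:R^-1 * ln (Zg (J N w) beta lam)) @ \oo
                      --> Ag lb beta lam} /\
   (fun N : nat => ((N%:R^-1)%:E * 'E_P[fun w => ln (Zg (J N w) beta lam)%R])%E)
      @ \oo --> (Ag lb beta lam)%:E).
Proof.
have Jmeas' N i j : measurable_fun setT (fun w => J N w i j) by exact: Jmeas.
have JT N w : (scaledJ (J N w))^T = scaledJ (J N w) by apply: tr_scaledJ; exact: Jsym.
have spec N w : exists Ul : 'M[R]_N * ('I_N -> R),
    orthomx Ul.1 /\ scaledJ (J N w) = orthodiag Ul.1 Ul.2.
  by have [U [l [UU lE]]] := symmetric_orthodiag (JT N w); exists (U, l).
(* The diagonalization is chosen separately for each [N] and [w], with no claim of measurability;
   probabilities are only taken of events phrased through the characteristic polynomial. *)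
pose U N w := (sval (cid (spec N w))).1.
pose l N w := (sval (cid (spec N w))).2.
have UU N w : orthomx (U N w) by have [] := svalP (cid (spec N w)).
have lE N w : scaledJ (J N w) = orthodiag (U N w) (l N w).
  by have [] := svalP (cid (spec N w)).
have [C1 [th [C10 [th0 tail]]]] := Htail.
pose Bad a N := [set w | exists x : R, root (char_poly (scaledJ (J N w))) x /\ (a <= `|x|)%R].
have mBad a N : 0 < a -> measurable (Bad a N).
  by move=> a0; apply: measurable_spectral_radius => //; exact: measurable_scaledJ.
have notBad a N w : ~ Bad a N w -> forall i, `|l N w i| < a.
  move=> nB i; rewrite ltNge; apply/negP => ai; apply: nB; exists (l N w i); split=> //.
  by rewrite lE; apply/root_orthodiag => //; exists i.
have edge_ae : {ae P, forall w, forall m : nat, \forall N \near \oo, ~ Bad (lb + m.+1%:R^-1) N w}.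
  apply: ae_foralln => m; set a := lb + _.
  have lba : lb < a by rewrite ltrDl invr_gt0 ltr0n.
  have a0 : 0 < a by exact: lt_trans lba.
  apply: (@ae_eventually_not _ _ _ P _ C1 (expR (- (th * a ^+ 2)))) => //.
  - by move=> N; exact: mBad.
  - exact: ltW.
  - by rewrite -expR0 ltr_expR oppr_lt0 mulr_gt0 // exprn_gt0.
  - by move=> N; rewrite -expRM_natr -mulNr; exact: tail.
have good : {ae P, forall w,
    (forall e, 0 < e -> \forall N \near \oo, forall i, `|l N w i| <= lb + e) /\
    (forall f : R -> R, continuous f -> (exists M : R, forall x, `|f x| <= M) ->
     (fun N : nat => N%:R^-1 * \sum_(i < N) f (l N w i)) @ \oo -->
     fine (\int[@lebesgue_measure R]_(mu in `[(- lb)%R, lb]) (f mu * rho lb mu)%:E)%E)}.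
  apply: filterS2 edge_ae Hesd => w Ew Hw; split.
    move=> e e0; have [m me] : exists m : nat, m.+1%:R^-1 <= e.
      exists (Num.truncn e^-1); rewrite -[leRHS]invrK lef_pV2 ?posrE ?invr_gt0 ?ltr0n //.
      by have /andP[_ /ltW] := truncn_itv (ltW (etrans (invr_gt0 e) e0)).
    apply: filterS (Ew m) => N nB i.
    by apply: le_trans (ltW (notBad _ _ _ nB i)) _; rewrite lerD2l.
  move=> f fc fb; apply: Hw => // N; rewrite lE; exact: is_spectrum_orthodiag.
(* The mass of [rho] is deterministic, so a single good sample is enough to compute it. *)
have [w0 [_ esd0]] : exists w, (forall e, 0 < e -> \forall N \near \oo, forall i, `|l N w i| <=
  lb + e) /\
    (forall f : R -> R, continuous f -> (exists M : R, forall x, `|f x| <= M) ->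
     (fun N : nat => N%:R^-1 * \sum_(i < N) f (l N w i)) @ \oo -->
     fine (\int[@lebesgue_measure R]_(mu in `[(- lb)%R, lb]) (f mu * rho lb mu)%:E)%E).
  have PT : (P setT > 0)%E by rewrite (probability_setT P) lte01.
  by have := @filter_ex _ _ (ae_properfilter_algebraOfSetsType PT) _ good.
have rho1 := rho_mass esd0.
have Zsf_ae : {ae P, forall w, (fun N : nat => N%:R^-1 * ln (Zsf (J N w) beta Rad)) @ \oo
                      --> Asf lb beta (Rad ^+ 2)}.
  apply: filterS good => w [ledge esd].
  exact: (@Zsf_cvg R (J ^~ w) (U ^~ w) (l ^~ w) lb beta Rad).
have Zg_ae : {ae P, forall w, (fun N : nat => N%:R^-1 * ln (Zg (J N w) beta lam)) @ \oo
                      --> Ag lb beta lam}.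
  apply: filterS good => w [ledge esd].
  exact: (@Zg_cvg R (J ^~ w) (U ^~ w) (l ^~ w) lb beta lam).
(* Levels whose squares grow linearly in [k]: the Gaussian tail then becomes geometric in [k], and
   [a k ^+ 2 >= k + 1] gives the exponent [k.+1] asked for by [cvg_expectation], while the term
   [lb ^+ 2] keeps each level above [lb]. *)
pose a k : R := Num.sqrt (lb ^+ 2 + 1 + k%:R).
have arg0 k : 0 < lb ^+ 2 + 1 + k%:R by rewrite ltr_wpDr // addr_gt0 // exprn_gt0.
have a0 k : 0 < a k by rewrite sqrtr_gt0.
have a2 k : a k ^+ 2 = lb ^+ 2 + 1 + k%:R by rewrite sqr_sqrtr // ltW.
have lba k : lb < a k.
  rewrite -(ltr_pXn2r (n := 2)) ?nnegrE ?ltW // a2.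
  by have : 0 <= k%:R :> R by []; lra.
have PB N k : (P (Bad (a k) N) <= (C1 * (expR (- th) ^+ N) ^+ k.+1)%:E)%E.
  apply: le_trans (tail N _ (lba k)) _; rewrite lee_fin ler_wpM2l ?(ltW C10) //.
  rewrite -exprM -expRM_natr ler_expR !mulNr lerN2 -mulrA ler_wpM2l ?(ltW th0) //.
  rewrite natrM mulrC ler_wpM2r // a2 -natr1.
  by have := sqr_ge0 lb; lra.
have a_le k : a k ^+ 2 + 1 <= (lb ^+ 2 + 2) * (1 + k%:R).
  rewrite a2; have : 0 <= k%:R :> R by [].
  by have := sqr_ge0 lb; nra.
have expect (Z : nat -> Omega -> R) (T C : R) :
    (forall N, measurable_fun setT (Z N)) -> 0 < C ->
    (\forall N \near \oo, forall w b, 0 <= b -> (forall i, `|l N w i| <= b) ->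
      `|N%:R^-1 * ln (Z N w)| <= C * (b ^+ 2 + 1)) ->
    {ae P, forall w, (fun N : nat => N%:R^-1 * ln (Z N w)) @ \oo --> T} ->
    (fun N : nat => ((N%:R^-1)%:E * 'E_P[fun w => ln (Z N w)%R])%E) @ \oo --> T%:E.
  move=> mZ C0 Zb Zae.
  have [] := @cvg_expectation _ _ _ P (fun N w => N%:R^-1 * ln (Z N w))
    (fun N k => Bad (a k) N) T (C * (lb ^+ 2 + 2)) C1 (expR (- th));
      last exact: cvg_scaled_expectation.
  - by move=> N; apply: measurable_funM => //; apply: measurableT_comp.
  - by move=> N k; exact: mBad.
  - by rewrite mulr_gt0 // addr_gt0 // exprn_gt0.
  - exact: ltW.
  - exact: expR_ge0.
  - by rewrite -expR0 ltr_expR oppr_lt0.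
  - exact: PB.
  - apply: filterS Zb => N Zb w k nB.
    apply: le_trans (Zb w (a k) (ltW (a0 k)) _) _.
      by move=> i; apply/ltW/notBad.
    by rewrite -mulrA ler_wpM2l // ltW.
  - exact: Zae.
have s0 : 0 < Rad ^+ 2 by rewrite exprn_gt0.
split.
  have [q0 aq0 q0min] := spherical_min lb_pos hbeta s0.
  split; first by exists q0; split=> //; rewrite (AsfE aq0 q0min).
  split=> //; apply: (expect _ _ (beta * Rad ^+ 2)) => //.
  - by move=> N; exact: measurable_Zsf.
  - by rewrite mulr_gt0.
  apply: filterS (Zsf_bound hbeta hRad) => N Zb w b b0 lb'.
  apply: le_trans (Zb _ _ _ _ (UU N w) (lE N w) lb') _.
  by rewrite ler_wpM2l ?mulr_ge0 ?sqr_ge0 ?(ltW hbeta) //; nra.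
have [q1 aq1 q1min] := gaussian_min lb_pos hbeta lam.
have [GA _] := AgE lb_pos hbeta rho1 aq1 q1min.
have [s10 _] := gaussian_min_dual lb_pos hbeta rho1 aq1 q1min.
split; first by eexists; split; [exact: s10|exact: GA].
split=> //; apply: (expect _ _ (zgC beta lam)) => //.
- by move=> N; exact: measurable_Zg.
- rewrite /zgC; have := normr_ge0 lam; have := normr_ge0 (ln 2 : R).
  have : 0 <= (1 + lam) ^+ 2 / (2 * beta ^+ 2).
    by rewrite divr_ge0 ?sqr_ge0 // mulr_ge0 // sqr_ge0.
  by have := sqr_ge0 beta; lra.
apply: filterS (Zg_bound lam hbeta) => N Zb w b b0 lb'.
by rewrite addrC; exact: (Zb _ _ _ _ (UU N w) (lE N w) b0 lb').
Qed.
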